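(* Let $d\ge 3$, $p=d/2$, $\omega>s_+$, $s_\gamma=\omega-s_+>0$, and $\mathfrak{c}=16\,\omega/s_\gamma^2$. Let $\tilde h=\tilde h_o+V$ on $L^2(\mathbb{T}_\tau,\ell^2(\mathcal V))$. (i) Let $\sup_{t}|V_x(t)|\le u_x$ and $\sup_t (V_x(t))_-\le (v_-)_x$ for all $x\in\mathcal V$, where $u^2,v_-\in\ell^{p}(\mathcal V)$, and let $q_-=\mathfrak{c}u^2+v_-$. Then the number of eigenvalues of $\tilde h$ in $\gamma_-=[-\tfrac{s_\gamma}{2},0)$ satisfies $$\tilde n(\gamma_-)\le \frac{9\omega}{s_\gamma}\,C_{ks}^-\Big(1+\frac{2\|q_-\|_\infty}{\omega}\Big)\|q_-\|_p^p .$$ (ii) Let the top $s_+$ of the spectrum of $h_o$ be regular (or let the graph $\mathcal G$ be bipartite). Let $\sup_{t}|V_x(t)|\le u_x$ and $\sup_t (V_x(t))_+\le (v_+)_x$ for all $x\in\mathcal V$, where $u^2,v_+\in\ell^{p}(\mathcal V)$, and let $q_+=\mathfrak{c}u^2+v_+$ and $\gamma_+=(-s_\gamma,-\tfrac{s_\gamma}{2}]$. Then $$\tilde n(\gamma_+)\le \frac{9\omega}{s_\gamma}\,C_{ks}^+\Big(1+\frac{2\|q_+\|_\infty}{\omega}\Big)\|q_+\|_p^p .$$ (iii) Let all the hypotheses on $V$, $u$, $v_\pm$ and on the top of the spectrum (or bipartiteness) in (i) and (ii) hold. Then the number $\tilde n(\gamma)$ of eigenvalues of $\tilde h$ in the main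 gap $\gamma=(-s_\gamma,0)$ is finite and satisfies $$\tilde n(\gamma)\le C^+\|q_+\|_p^p+C^-\|q_-\|_p^p,\qquad C^\pm=\frac{9\omega}{s_\gamma}\,C_{ks}^\pm\Big(1+\frac{2\|q_\pm\|_\infty}{\omega}\Big).$$
   Context: Graph: $\Gamma\subset\mathbb{R}^d$ is a lattice of rank $d$ with basis $a_1,\dots,a_d$; $\mathcal G=(\mathcal V,\mathcal E)$ is a connected infinite locally finite graph embedded in $\mathbb{R}^d$ (loops and multiple edges allowed), with $\mathcal G+a=\mathcal G$ for all $a\in\Gamma$ and with $\mathcal G/\Gamma$ finite. $\mathcal G$ is bipartite if $\mathcal V$ is a disjoint union of two sets such that every edge joins vertices of different sets. Unperturbed operator: $h_o=\Delta+\mathfrak p$ on $\ell^2(\mathcal V)$, where $(\Delta f)_x=\sum_{y\sim x}(f_x-f_y)$ (sum over all edges starting at $x$) and $\mathfrak p:\mathcal V\to\mathbb{R}$ is a $\Gamma$-periodic potential, acting by multiplication. $s_+=\max\sigma(h_o)$ and it is assumed that $\sigma(h_o)\subset[0,s_+]$. Regularity: for $\vartheta\in\mathbb{T}^d=\mathbb{R}^d/(2\pi\mathbb{Z})^d$ let $h_o(\vartheta)$ be the fiber operator, i.e. $h_o$ acting on the finite-dimensional space of functions with $f_{x+a_s}=e^{i\vartheta_s}f_x$ for all $x,s$ (dimension $\nu=\#(\mathcal V/\Gamma)$), and let $\mathfrak b_\nu(\vartheta)$ be its largest eigenvalue. The top $s_+$ is called regular if $\{\vartheta\in\mathbb{T}^d:\mathfrak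 b_\nu(\vartheta)=s_+\}$ is a finite set of points $\vartheta_1,\dots,\vartheta_{n_R}$ and for each $j$ there is a positive definite matrix $B_j$ with $\mathfrak b_\nu(\vartheta)=s_+-(B_ja,a)+O(|a|^3)$ as $a=\vartheta-\vartheta_j\to0$. Time-periodic operator: $\tau>0$, $\omega=2\pi/\tau$, $\mathbb{T}_\tau=\mathbb{R}/\tau\mathbb{Z}$; $V=V_x(t)$, $(t,x)\in\mathbb{R}\times\mathcal V$, is a real (measurable) function, $\tau$-periodic in $t$. On $L^2(\mathbb{T}_\tau,\ell^2(\mathcal V))$ put $\partial=-i\,\partial/\partial t$ (self-adjoint, periodic boundary conditions), $\tilde h_o=\partial+h_o$, and $\tilde h=\tilde h_o+V$, with $V$ acting by multiplication by $V_x(t)$. For $A\subset\mathbb{R}$, $\tilde n(A)$ is the number of eigenvalues of $\tilde h$ in $A$ counted with multiplicity. Notation: $(z)_\pm=(|z|\pm z)/2$ for real $z$; $\|q\|_p=(\sum_{x}|q_x|^p)^{1/p}$, $\|q\|_\infty=\sup_x|q_x|$. Constants: $C_{ks}^-$ is a constant depending only on $\mathcal G$ and $\mathfrak p$ such that for every real $\mathfrak q\in\ell^{d/2}(\mathcal V)$ and $\mu<0$ the number (with multiplicity) of eigenvalues of $h_o+\mathfrak q$ below $\mu$ is at most $C_{ks}^-\sum_x\big((\mathfrak q_x-\mu)_-\big)^{d/2}$. If $s_+$ is regular (or $\mathcal G$ is bipartite), $C_{ks}^+$ is a constant depending only on $\mathcal G$ and $\mathfrak p$ such that for every real $\mathfrak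 q\in\ell^{d/2}(\mathcal V)$ and $\mu>s_+$ the number of eigenvalues of $h_o+\mathfrak q$ above $\mu$ is at most $C_{ks}^+\sum_x\big((\mathfrak q_x-\mu+s_+)_+\big)^{d/2}$. (Both are known estimates; such constants exist.) *)

(* Defs.v *)
From HB Require Import structures.
From mathcomp Require Import all_boot all_order all_algebra.
From mathcomp Require Import complex.
From mathcomp Require Import all_classical all_reals all_analysis.
From Stdlib Require Import Relation_Operators.

Set Implicit Arguments.
Unset Strict Implicit.
Unset Printing Implicit Defensive.

Import Order.TTheory GRing.Theory Num.Theory.
Import numFieldNormedType.Exports.
Local Open Scope classical_set_scope.
Local Open Scope complex_scope.
Local Open Scope ring_scope.

Local Notation normc := ComplexField.Normc.normc.

Definition lattice (R : realType) (d : nat) (a : 'M[R]_d) : set 'rV[R]_d :=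
  [set v | exists n : 'I_d -> int, v = \sum_s (n s)%:~R *: row s a].

(* Vertices are points of R^d.  Each edge, loops included, is represented by its
   two orientations e and rev e; parallel edges are distinct elements of [edge].
   Finiteness of the set of edge orbits follows from [locally_finite] and
   [finite_quotient]. *)
Record periodic_graph (R : realType) (d : nat) := PeriodicGraph {
  basis : 'M[R]_d;  (* row s is the basis vector a_s *)
  basis_free : row_free basis;
  vert : set 'rV[R]_d;
  vert_infinite : infinite_set vert;
  edge : choiceType;
  src : edge -> vert;
  tgt : edge -> vert;
  rev : edge -> edge;
  revK : involutive rev;
  rev_neq : forall e, rev e <> e;
  src_rev : forall e, src (rev e) = tgt e;
  locally_finite : forall x : vert, finite_set [set e | src e = x];
  connected_graph : forall x y : vert,
    clos_refl_trans vert (fun u v => exists e, src e = u /\ tgt e = v) x y;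
  vert_periodic : forall a, lattice basis a ->
    forall x, vert x -> vert (x + a);
  edge_periodic : forall a, lattice basis a ->
    exists phi : edge -> edge, bijective phi /\
      forall e, [/\ val (src (phi e)) = val (src e) + a,
                    val (tgt (phi e)) = val (tgt e) + a
                  & phi (rev e) = rev (phi e)];
  finite_quotient : exists F : set 'rV[R]_d, [/\ finite_set F, F `<=` vert
    & forall x, vert x -> exists y a, [/\ F y, lattice basis a & x = y + a]]
}.

Section operators.
Variables (R : realType) (d : nat) (G : periodic_graph R d).
Local Notation C := R[i].
Local Notation U := (vert G -> C^o).

Definition bipartite : Prop :=
  exists A : set (vert G), forall e : edge G, A (src e) <-> ~ A (tgt e).

Definition periodic_potential (p : vert G -> R) : Prop :=
  forall x y : vert G, lattice (basis G) (val y - val x) -> p y = p x.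

Definition laplacian (f : U) : U :=
  fun x => \sum_(e \in [set e : edge G | src e = x]) (f x - f (tgt e)).

(* [schrodinger p] is Delta + p, on arbitrary functions on the vertex set. *)
Definition schrodinger (p : vert G -> R) (f : U) : U :=
  fun x => laplacian f x + (p x)%:C * f x.

Definition l2sq (f : U) : \bar R :=
  (\esum_(x in [set: vert G]) (normc (f x) ^+ 2)%:E)%E.

Definition l2 : set U := [set f | (l2sq f < +oo)%E].

(* z is in the resolvent set iff H - z has a bounded two-sided inverse T on
   l^2; T is linear on l^2 when H is, being an inverse of H - z. *)
Definition resolvent_set (H : U -> U) : set C :=
  [set z | exists (T : U -> U) (M : R), forall f, l2 f ->
     [/\ (l2sq (T f) <= M%:E * l2sq f)%E,
         H (T f) - z *: T f = f
       & T (H f - z *: f) = f]].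

Definition spectrum (H : U -> U) : set C := ~` resolvent_set H.

Definition quasi_periodic (theta : 'rV[R]_d) (f : U) : Prop :=
  forall (s : 'I_d) (x y : vert G), val y = val x + row s (basis G) ->
    f y = (cos (theta 0 s) +i* sin (theta 0 s)) * f x.

(* The fiber operator acts on a nonzero finite-dimensional space and has real
   eigenvalues, so this supremum is its largest eigenvalue. *)
Definition top_band (p : vert G -> R) (theta : 'rV[R]_d) : R :=
  sup [set l : R | exists f : U,
    [/\ quasi_periodic theta f, f <> 0 & schrodinger p f = l%:C *: f]].

Definition posdef (B : 'M[R]_d) : Prop :=
  B^T = B /\ forall a : 'rV[R]_d, a != 0 -> 0 < (a *m B *m a^T) 0 0.

(* The torus is represented by the fundamental domain [0, 2 pi)^d; top_band p is
   (2 pi Z)^d-periodic on R^d.  The norm of 'rV[R]_d in the remainder is the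
   sup norm, equivalent to the Euclidean one. *)
Definition regular_top (p : vert G -> R) (sp : R) : Prop :=
  finite_set [set theta : 'rV[R]_d |
    (forall s, 0 <= theta 0 s < 2 * pi) /\ top_band p theta = sp] /\
  forall theta : 'rV[R]_d, top_band p theta = sp ->
    exists2 B : 'M[R]_d, posdef B &
      exists K : R, \forall a \near (0 : 'rV[R]_d),
        `|top_band p (theta + a) - (sp - (a *m B *m a^T) 0 0)|
          <= K * `|a| ^+ 3.

Definition lp_norm (r : R) (q : vert G -> R) : \bar R :=
  poweR (\esum_(x in [set: vert G]) (`|q x| `^ r)%:E)%E r^-1.

Definition lp_space (r : R) : set (vert G -> R) :=
  [set q | (lp_norm r q < +oo)%E].

Definition linf_norm (q : vert G -> R) : \bar R :=
  ereal_sup [set `|q x|%:E | x in [set: vert G]].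

End operators.

Section counting.
Variables (R : realType) (W : lmodType R[i]).

Definition dimension (S : set W) : \bar R :=
  ereal_sup [set (n%:R)%:E | n in [set n : nat | exists f : 'I_n -> W,
    (forall j, S (f j)) /\
    (forall c : 'I_n -> R[i], \sum_j c j *: f j = 0 -> forall j, c j = 0)]].

(* E l is the eigenspace for l, zero when l is not an eigenvalue. *)
Definition eigen_count (E : R -> set W) (A : set R) : \bar R :=
  (\esum_(l in A) dimension (E l))%E.

End counting.

Section estimates.
Variables (R : realType) (d : nat) (G : periodic_graph R d).
Variable p : vert G -> R.
Local Notation C := R[i].
Local Notation U := (vert G -> C^o).

Definition pos_part (z : R) : R := (`|z| + z) / 2.
Definition neg_part (z : R) : R := (`|z| - z) / 2.

Definition eigenspace_l2 (q : vert G -> R) (l : R) : set U :=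
  [set f | l2 f /\ schrodinger (p \+ q) f = l%:C *: f].

Definition ks_minus (K : R) : Prop :=
  forall (q : vert G -> R) (mu : R), lp_space (d%:R / 2) q -> mu < 0 ->
    (eigen_count (eigenspace_l2 q) [set l | (l < mu)%R] <=
     K%:E * \esum_(x in [set: vert G])
              (neg_part (q x - mu) `^ (d%:R / 2))%:E)%E.

Definition ks_plus (sp K : R) : Prop :=
  forall (q : vert G -> R) (mu : R), lp_space (d%:R / 2) q -> sp < mu ->
    (eigen_count (eigenspace_l2 q) [set l | (mu < l)%R] <=
     K%:E * \esum_(x in [set: vert G])
              (pos_part (q x - mu + sp) `^ (d%:R / 2))%:E)%E.

End estimates.

Section time_periodic.
Variables (R : realType) (d : nat) (G : periodic_graph R d) (tau : R).
Variable p : vert G -> R.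
Local Notation C := R[i].
Local Notation X := (R -> vert G -> C^o).
Local Notation leb := (@lebesgue_measure R).

(* Representatives, tau-periodic in t, of elements of L^2(R/tau Z, l^2). *)
Definition L2_per : set X :=
  [set f : X | [/\ forall t x, f (t + tau) x = f t x,
    forall x, measurable_fun setT (fun t => complex.Re (f t x)) /\
              measurable_fun setT (fun t => complex.Im (f t x))
    & (\esum_(x in [set: vert G])
         \int[leb]_(t in `[0%R, tau]) (normc (f t x : C) ^+ 2)%:E < +oo)%E]].

Definition cintegral (A : set R) (g : R -> C) : C :=
  (\int[leb]_(t in A) complex.Re (g t))%R +i*
  (\int[leb]_(t in A) complex.Im (g t))%R.

(* f is the absolutely continuous representative of an element of the domain
   of d/dt with periodic boundary conditions (f is tau-periodic), and g is its
   derivative.  Such a representative is unique, so linear independence of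
   functions f is linear independence in L^2. *)
Definition time_derivative (f g : X) : Prop :=
  [/\ L2_per f, L2_per g & forall t x, 0 <= t <= tau ->
    f t x = f 0 x + cintegral `[0, t] (fun s => g s x)].

(* f is in the domain of -i d/dt + Delta + p + V, and k is its image. *)
Definition floquet_graph (V : R -> vert G -> R) (f k : X) : Prop :=
  L2_per k /\
  exists2 g, time_derivative f g & forall x, {ae leb, forall t,
    k t x = - ('i%C * g t x) + schrodinger p (f t) x + (V t x)%:C * f t x}.

Definition floquet_count (V : R -> vert G -> R) : set R -> \bar R :=
  eigen_count (fun l => [set f : X | floquet_graph V f (l%:C *: f)]).

End time_periodic.

(* Main.v *)
Require Import Defs.
From HB Require Import structures.
From mathcomp Require Import all_boot all_order all_algebra.
From mathcomp Require Import complex ring lra zify.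
From mathcomp Require Import all_classical all_reals all_analysis.
From mathcomp Require Import measurable_realfun.

Set Implicit Arguments.
Unset Strict Implicit.
Unset Printing Implicit Defensive.

Import Order.TTheory GRing.Theory Num.Theory.
Import numFieldNormedType.Exports.
Local Open Scope classical_set_scope.
Local Open Scope complex_scope.
Local Open Scope ring_scope.

Local Notation normc := ComplexField.Normc.normc.

(** An eigenfunction [f] at level [l] is a periodic solution of
   [-i f' + (h + V - l) f = 0] with values in [l^2].  Write [om] for the
   frequency, [sg] for the width of the gap, and split [f = a + b] into the
   frequencies [n >= 0] and [n < 0].  Testing the equation against [a - b], the
   cross terms of the symmetric operator [V] cancel in the real part, so that [V]
   enters only through [<V a, a>] and [- <V b, b>], that is, through a lower bound
   [- Qa <= V] and an upper bound [V <= Qb].  On combinations of orthonormal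
   eigenfunctions with levels within [r] of [c], the operator minus [c] has norm at
   most [r]; so the Fourier coefficients [f_n] of such a combination satisfy

     sum over n >= 0 of <(om n + h - Qa - (c + r)) f_n, f_n>
       + sum over n >= 1 of <(om n - h - Qb + (c - r)) f_(-n), f_(-n)>  <=  0.

   If these forms are positive once [f_n] and [f_(-n-1)] are orthogonal to [N0]
   vectors for [n < K], then a space of such combinations of dimension larger than
   [2 K N0] would contain a nonzero element for which all these orthogonality
   conditions hold, a contradiction.  Hence there are at most [2 K N0] eigenvalues
   with multiplicity: this is [index_bound].

   In the half of the gap next to [0] one takes [Qa = v_-] and [Qb = u].  The first
   form is then at least [om n + h - q].  In the second one [om n - h >= sg], of
   which the level uses one half; [u <= sg / 8 + 2 u^2 / sg] uses another part and
   charges the rest to a fraction [sg / (4 om)] of [om n + h - q], which fixes the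
   constant [16 om / sg^2] in front of [u^2] ([mult_absorbed], [far_form]).
   Now [om n + h - q] is nonnegative when [om n >= |q|_oo], which leaves about
   [|q|_oo / om] frequencies, and for these it is nonnegative up to an arbitrarily small error on the orthogonal complement of
   the eigenvectors of [h - q] below a small negative number ([near_form]), whose
   number the hypothesis on time-independent perturbations bounds by
   [C |q|_p^p].  In the half next to [- sg] the two frequency ranges exchange their
   roles and [s - h] replaces [h].  The open end of each half is harmless because
   only finitely many levels are compared at a time.

   Three devices keep the argument elementary.  Time is sampled at [M] points, [M]
   odd, and [-i d/dt] becomes a Crank-Nicolson difference, whose symbol
   [(2 M / tau) tan (pi n / M)] dominates [om n]; eigenfunctions solve the scheme up
   to errors of square norm [O(1 / M)] ([floquet_approx_eigenfunction]), and their
   Gram matrices converge because the scheme conserves scalar products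
   ([mean_gram_same_level], [mean_gram_levels]).  Eigenfunctions of one level are
   orthonormalized at time zero, which determines them
   ([approx_eigenfunction_initial0]).  The spectral theorem is replaced by the
   remark that an infimum of a quadratic form is a point where the operator is not
   bounded below ([form_lower_bound]), combined with a finite-rank Weyl argument for
   potentials truncated to finitely many vertices ([negative_spectrum]). *)

(** * Inner product spaces *)

Lemma normc_sqr (R : realType) (z : R[i]) :
  normc z ^+ 2 = complex.Re z ^+ 2 + complex.Im z ^+ 2.
Proof. by case: z => a b /=; rewrite sqr_sqrtr// addr_ge0 ?sqr_ge0. Qed.

Lemma normc_ge0 (R : realType) (z : R[i]) : 0 <= normc z.
Proof. by case: z => a b /=; rewrite sqrtr_ge0. Qed.

Lemma normc_distC (R : realType) (z w : R[i]) : normc (z - w) = normc (w - z).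
Proof. by case: z w => a b [a' b'] /=; congr Num.sqrt; ring. Qed.

Lemma ge_normc_Re (R : realType) (y : R[i]) : `|complex.Re y| <= normc y.
Proof.
rewrite -ler_sqr ?nnegrE ?normc_ge0 ?normr_ge0// normc_sqr real_normK ?num_real//.
by rewrite lerDl sqr_ge0.
Qed.

Lemma ge_normc_Im (R : realType) (y : R[i]) : `|complex.Im y| <= normc y.
Proof.
rewrite -ler_sqr ?nnegrE ?normc_ge0 ?normr_ge0// normc_sqr real_normK ?num_real//.
by rewrite lerDr sqr_ge0.
Qed.

(** Fewer linear conditions than vectors: used for Gram-Schmidt at time zero, and to
   find a combination of eigenfunctions that contradicts positivity. *)
Lemma underdetermined_kernel (F : fieldType) (I K : finType) (a : I -> K -> F) :
  (#|K| < #|I|)%N ->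
  exists2 c : I -> F, (exists i, c i != 0) & forall k, \sum_i c i * a i k = 0.
Proof.
move=> ltKI.
pose B := \matrix_(i < #|I|, k < #|K|) a (enum_val i) (enum_val k).
have : kermx B != 0.
  rewrite kermx_eq0 /row_free neq_ltn.
  by apply/orP; left; apply: leq_ltn_trans (rank_leq_col _) ltKI.
move=> /rowV0Pn[v /sub_kermxP vB v0].
exists (fun i => v 0 (enum_rank i)).
  have [j vj] : exists j, v 0 j != 0.
    apply/existsP; apply: contraNT v0 => /existsPn h.
    by apply/eqP/rowP => j; rewrite mxE; apply/eqP; have := h j; rewrite negbK.
  by exists (enum_val j); rewrite enum_valK.
move=> k; have /rowP/(_ (enum_rank k)) := vB; rewrite !mxE => vBk.
rewrite (reindex (@enum_val I predT)) /=; last first.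
  by exists enum_rank => i _; rewrite ?enum_valK ?enum_rankK.
rewrite -[RHS]vBk; apply: eq_bigr => i _.
by rewrite enum_valK mxE enum_rankK.
Qed.

(** The real part of a hermitian inner product: it is a real scalar product for
   which multiplication by a complex number has its conjugate as adjoint, and
   the hermitian product is recovered by [cip].  Every estimate below is thus an
   inequality between reals. *)
Record is_dot (R : realType) (H : lmodType R[i]) (dot : H -> H -> R) : Prop :=
 IsDot {
  dotC : forall x y, dot x y = dot y x;
  dotDl : forall x y z, dot (x + y) z = dot x z + dot y z;
  dotZl : forall (a : R) x y, dot (a%:C *: x) y = a * dot x y;
  dotI : forall x y, dot ('i%C *: x) y = - dot x ('i%C *: y);
  dot_ge0 : forall x, 0 <= dot x x;
  dot_eq0 : forall x, dot x x = 0 -> x = 0 }.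

Lemma form_cauchy_schwarz (R : realFieldType) (b0 b1 b2 : R) :
  0 <= b0 -> 0 <= b2 -> (forall t, 0 <= b0 + 2 * t * b1 + t ^+ 2 * b2) ->
  b1 ^+ 2 <= b0 * b2.
Proof.
move=> b0p b2p h.
have [b20|b2n] := eqVneq b2 0.
  have h1 := h (- (b0 + 1) / (2 * b1)).
  have [->|b1n] := eqVneq b1 0; first by rewrite b20 mulr0 expr0n.
  have h2 : 2 * (- (b0 + 1) / (2 * b1)) * b1 = - (b0 + 1) by field.
  by rewrite b20 in h1; rewrite h2 in h1; lra.
have b2gt : 0 < b2 by rewrite lt_neqAle eq_sym b2n.
have h1 := h (- b1 / b2).
have -> : b1 ^+ 2 = b0 * b2 - (b0 + 2 * (- b1 / b2) * b1 + (- b1 / b2) ^+ 2 * b2) * b2.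
  by field.
by rewrite lerBlDr lerDl mulr_ge0.
Qed.

Section DotTheory.
Variables (R : realType) (H : lmodType R[i]) (dot : H -> H -> R).
Hypothesis D : is_dot dot.
Implicit Types (x y z : H) (a b : R) (c : R[i]).

Lemma dotDr x y z : dot x (y + z) = dot x y + dot x z.
Proof. by rewrite !(dotC D x) (dotDl D). Qed.

Lemma dotZr a x y : dot x (a%:C *: y) = a * dot x y.
Proof. by rewrite !(dotC D x) (dotZl D). Qed.

Lemma dot0l x : dot 0 x = 0.
Proof. by rewrite -(scale0r x) (dotZl D) mul0r. Qed.

Lemma dotNl x y : dot (- x) y = - dot x y.
Proof.
by apply/eqP; rewrite -addr_eq0 -(dotDl D) addrC subrr dot0l.
Qed.

Lemma dotNr x y : dot x (- y) = - dot x y.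
Proof. by rewrite !(dotC D x) dotNl. Qed.

Lemma dotBl x y z : dot (x - y) z = dot x z - dot y z.
Proof. by rewrite (dotDl D) dotNl. Qed.

Lemma dotBr x y z : dot x (y - z) = dot x y - dot x z.
Proof. by rewrite dotDr dotNr. Qed.

Lemma dot_suml (I : Type) (r : seq I) (P : pred I) (F : I -> H) y :
  dot (\sum_(i <- r | P i) F i) y = \sum_(i <- r | P i) dot (F i) y.
Proof.
by apply: (big_morph (fun x => dot x y)); [move=> u v; rewrite (dotDl D)|rewrite dot0l].
Qed.

Lemma dot_sumr (I : Type) (r : seq I) (P : pred I) (F : I -> H) y :
  dot y (\sum_(i <- r | P i) F i) = \sum_(i <- r | P i) dot y (F i).
Proof. by rewrite (dotC D) dot_suml; apply: eq_bigr => i _; rewrite (dotC D). Qed.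

Lemma dotIr x y : dot x ('i%C *: y) = - dot ('i%C *: x) y.
Proof. by rewrite (dotI D) opprK. Qed.

Lemma dotII x y : dot ('i%C *: x) ('i%C *: y) = dot x y.
Proof.
rewrite (dotI D) scalerA (_ : 'i%C * 'i%C = -1) ?scaleN1r ?dotNr ?opprK//.
by simpc.
Qed.

Lemma dotIxx x : dot ('i%C *: x) x = 0.
Proof. by have := dotI D x x; rewrite (dotC D x); lra. Qed.

Lemma dotZRe c x y : dot (c *: x) y = complex.Re c * dot x y + complex.Im c * dot ('i%C *: x) y.
Proof.
have e : 'i%C * (complex.Im c)%:C *: x = (complex.Im c)%:C *: ('i%C *: x).
  by rewrite scalerA mulrC.
by rewrite {1}[c]complexE scalerDl (dotDl D) (dotZl D) e (dotZl D).
Qed.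

Lemma dotZ_adj c x y : dot (c *: x) y = dot x (c^*%C *: y).
Proof.
rewrite (dotZRe c x y) [RHS](dotC D) (dotZRe _ y x) (dotC D y x).
rewrite (dotI D y x) (dotC D y ('i%C *: x)).
by case: c => a b /=; ring.
Qed.

Lemma n2Z c x : dot (c *: x) (c *: x) = normc c ^+ 2 * dot x x.
Proof.
rewrite dotZ_adj scalerA normc_sqr (dotC D x) (dotZRe _ x x) dotIxx mulr0 addr0.
by case: c => a b /=; ring.
Qed.

Lemma n2D x y : dot (x + y) (x + y) = dot x x + 2 * dot x y + dot y y.
Proof. by rewrite (dotDl D) !dotDr (dotC D y x); ring. Qed.

Lemma cauchy_schwarz x y : dot x y ^+ 2 <= dot x x * dot y y.
Proof.
apply: form_cauchy_schwarz => [||t]; try exact: (dot_ge0 D).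
have := dot_ge0 D (x + t%:C *: y).
by rewrite n2D dotZr (dotZl D) dotZr; nra.
Qed.

Lemma dot_norm x y : `|dot x y| <= Num.sqrt (dot x x) * Num.sqrt (dot y y).
Proof.
rewrite -sqrtrM ?(dot_ge0 D)// -sqrtr_sqr ler_wsqrtr// cauchy_schwarz//.
Qed.

Lemma n2D_le x y : dot (x + y) (x + y) <= 2 * dot x x + 2 * dot y y.
Proof.
rewrite n2D; have := dot_ge0 D (x - y).
by rewrite n2D dotNr dotNl dotNr; lra.
Qed.

(** Weighted arithmetic-geometric mean form of Cauchy-Schwarz. *)
Lemma dot_amgm (k : R) x y : 0 < k -> `|dot x y| <= k * dot x x + dot y y / k.
Proof.
move=> k0; have nx := dot_ge0 D x; have ny := dot_ge0 D y.
rewrite -(ler_pM2r k0) mulrDl divfK ?gt_eqF//.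
rewrite -{1}(gtr0_norm k0) -normrM ler_norml; apply/andP; split.
  have := dot_ge0 D (k%:C *: x + y); rewrite n2D (dotZl D) dotZr (dotZl D) => h.
  have : 0 <= k * k * dot x x + dot y y by rewrite addr_ge0// !mulr_ge0// ltW.
  by nra.
have := dot_ge0 D (k%:C *: x - y).
rewrite n2D !dotNr dotNl dotZr !(dotZl D) => h.
have : 0 <= k * k * dot x x + dot y y by rewrite addr_ge0// !mulr_ge0// ltW.
by nra.
Qed.

Lemma n2_sum_le (I : finType) (F : I -> H) :
  dot (\sum_i F i) (\sum_i F i) <= #|I|%:R * \sum_i dot (F i) (F i).
Proof.
rewrite dot_suml.
apply: (@le_trans _ _ (\sum_(i : I) \sum_(j : I) (dot (F i) (F i) + dot (F j) (F j)) / 2)).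
  apply: ler_sum => i _; rewrite dot_sumr; apply: ler_sum => j _.
  have := dot_ge0 D (F i - F j); rewrite n2D !dotNr dotNl; lra.
under eq_bigr do rewrite -mulr_suml big_split/= sumr_const.
rewrite -mulr_suml big_split/= sumr_const sumrMnl.
rewrite -(mulr_natl (\sum_i _)) -[#|xpredT|]/#|I|; lra.
Qed.

(** The hermitian product, linear in its first argument. *)
Definition cip x y : R[i] := dot x y +i* dot x ('i%C *: y).

Lemma cipDl x y z : cip (x + y) z = cip x z + cip y z.
Proof. by rewrite /cip !(dotDl D). Qed.

Lemma cipZl c x y : cip (c *: x) y = c * cip x y.
Proof.
rewrite /cip !(dotZRe c) dotIr dotII.
case: c => a b /=; simpc; congr (_ +i* _); rewrite ?(dotI D); ring.
Qed.

Lemma cip0l y : cip 0 y = 0.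
Proof. by rewrite /cip !dot0l. Qed.

Lemma cip_suml (I : Type) (r : seq I) (P : pred I) (F : I -> H) y :
  cip (\sum_(i <- r | P i) F i) y = \sum_(i <- r | P i) cip (F i) y.
Proof. by apply: (big_morph (fun x => cip x y)); [move=> u v; rewrite cipDl|rewrite cip0l]. Qed.

Lemma cip_eq0 x y : cip x y = 0 <-> dot x y = 0 /\ dot ('i%C *: x) y = 0.
Proof.
rewrite /cip dotIr; split => [[-> /eqP]|[-> ->]]; last by rewrite oppr0.
by rewrite oppr_eq0 => /eqP.
Qed.

Lemma cip_eq0C x y : cip x y = 0 -> cip y x = 0.
Proof.
move=> /cip_eq0[h1 h2]; apply/cip_eq0; split; first by rewrite (dotC D).
by rewrite (dotI D) (dotC D) h2 oppr0.
Qed.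

End DotTheory.

Section LinearMaps.
Variables (R : realType) (H : lmodType R[i]) (B : H -> H).
Hypothesis linB : linear B.

Lemma linD x y : B (x + y) = B x + B y.
Proof. by have := linB 1 x y; rewrite !scale1r. Qed.

Lemma lin0 : B 0 = 0.
Proof. by apply: (addrI (B 0)); rewrite addr0 -linD addr0. Qed.

Lemma linZ a x : B (a *: x) = a *: B x.
Proof. by have := linB a x 0; rewrite !addr0 lin0 addr0. Qed.

Lemma linN x : B (- x) = - B x.
Proof. by rewrite -scaleN1r linZ scaleN1r. Qed.

Lemma linBr x y : B (x - y) = B x - B y.
Proof. by rewrite linD linN. Qed.

Lemma lin_sum (I : Type) (r : seq I) (P : pred I) (F : I -> H) :
  B (\sum_(i <- r | P i) F i) = \sum_(i <- r | P i) B (F i).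
Proof. by apply: (big_morph B linD lin0). Qed.

End LinearMaps.

(** * Lower bounds of self-adjoint operators *)

Section Spectral.
Variables (R : realType) (H : lmodType R[i]) (dot : H -> H -> R).
Hypothesis D : is_dot dot.
Implicit Types (x y z : H) (B : H -> H).

Definition selfadjoint B := forall x y, dot (B x) y = dot x (B y).

Definition form_bounded B := exists C : R, forall x, `|dot (B x) x| <= C * dot x x.

(** Stated with squares, so that no square root of [dot] is needed. *)
Definition bounded_below B (m : R) := exists M : R, forall x,
  dot x x <= M * dot (B x - m%:C *: x) (B x - m%:C *: x).

Lemma cipC x y : cip dot x y = (cip dot y x)^*%C.
Proof. by rewrite /cip /= (dotC D x y) (dotC D x) (dotI D). Qed.

Lemma cipZr c x y : cip dot x (c *: y) = c^*%C * cip dot x y.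
Proof. by rewrite cipC (cipZl D) rmorphM (cipC x y). Qed.

Lemma cip_sumr (I : Type) (r : seq I) (P : pred I) (F : I -> H) y :
  cip dot y (\sum_(i <- r | P i) F i) = \sum_(i <- r | P i) cip dot y (F i).
Proof.
by rewrite cipC (cip_suml D) rmorph_sum; apply: eq_bigr => i _; rewrite (cipC y (F i)).
Qed.

Lemma cip_bound x y : normc (cip dot x y) ^+ 2 <= 2 * (dot x x * dot y y).
Proof.
rewrite normc_sqr /= mulr_natl mulr2n lerD ?(cauchy_schwarz D)//.
by rewrite -(dotII D y y) (cauchy_schwarz D).
Qed.

Lemma cip_self x : cip dot x x = (dot x x)%:C.
Proof. by rewrite /cip (dotIr D) (dotIxx D) oppr0. Qed.

(** The infimum of the spectrum is reached by the quadratic form: if [m] is the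
   infimum of the form and [B - m] is bounded below, then Cauchy-Schwarz for the
   nonnegative form of [B - m] pushes the infimum strictly above [m]. *)
Lemma form_lower_bound B (mu : R) : linear B -> selfadjoint B -> form_bounded B ->
  (forall m, m < mu -> bounded_below B m) ->
  forall x, mu * dot x x <= dot (B x) x.
Proof.
move=> linB symB [C bdB] below x0; rewrite leNgt; apply/negP => ltx0.
have x0n : 0 < dot x0 x0.
  rewrite lt_neqAle (dot_ge0 D) andbT eq_sym; apply/eqP => x00.
  move: ltx0; rewrite (dot_eq0 D x00) (lin0 linB) (dot0l D) mulr0.
  by rewrite ltxx.
pose S := [set r : R | forall x, r * dot x x <= dot (B x) x].
have SC : S (- C).
  by move=> x; have := bdB x; rewrite ler_norml mulNr => /andP[].
have ubS : forall r, S r -> r <= dot (B x0) x0 / dot x0 x0.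
  by move=> r /(_ x0); rewrite ler_pdivlMr.
have supS : has_sup S by split; [exists (- C) | exists (dot (B x0) x0 / dot x0 x0)].
pose m := sup S.
have Sm : S m.
  move=> x; have := dot_ge0 D x; rewrite le_eqVlt => /orP[/eqP x00|xp].
    by rewrite (dot_eq0 D (esym x00)) (lin0 linB) (dot0l D) mulr0.
  rewrite -ler_pdivlMr//; apply: ge_sup; first by exists (- C).
  by move=> r /(_ x); rewrite -ler_pdivlMr.
have mmu : m < mu.
  apply: (@le_lt_trans _ _ (dot (B x0) x0 / dot x0 x0)).
    by apply: ge_sup => //; exists (- C).
  by rewrite ltr_pdivrMr.
have [M hM] := below _ mmu.
(* Cauchy-Schwarz for the form of [P >= 0] gives [P^2 <= C' P]. *)
pose P x := B x - m%:C *: x.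
have PE x y : dot (P x) y = dot (B x) y - m * dot x y.
  by rewrite /P (dotBl D) (dotZl D).
have P0 x : 0 <= dot (P x) x by rewrite PE subr_ge0 Sm.
have symP x y : dot (P x) y = dot x (P y).
  by rewrite PE (dotC D x (P y)) PE symB !(dotC D x).
have linP : linear P.
  move=> a x y; rewrite /P linB scalerDr scalerBr !scalerA mulrC opprD.
  by rewrite addrACA.
pose C' := `|C| + `|m| + 1.
have C'0 : 0 < C' by rewrite ltr_wpDl.
have bdP x : dot (P x) x <= C' * dot x x.
  rewrite PE; have := bdB x; rewrite ler_norml => /andP[_ h].
  have := dot_ge0 D x; have := ler_norm C; have := ler_norm (- m); rewrite normrN.
  by rewrite /C'; nra.
have key x : dot (P x) (P x) <= C' * dot (P x) x.
  have cs : dot (P x) (P x) ^+ 2 <= dot (P x) x * dot (P (P x)) (P x).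
    apply: form_cauchy_schwarz => // t.
    have := P0 (x + t%:C *: P x).
    rewrite (linD linP) (linZ linP) (dotDl D) !(dotDr D _ x (_ *: _)).
    rewrite !(dotZl D) !(dotZr D).
    by rewrite (symP (P x) x); nra.
  have := bdP (P x); have := dot_ge0 D (P x); rewrite le_eqVlt => /orP[/eqP<- _|pp b].
    by rewrite mulr_ge0// ltW.
  rewrite -(ler_pM2r pp) -expr2; apply: le_trans cs _.
  by rewrite mulrAC mulrC ler_wpM2r.
pose M' := `|M| + 1.
have M'0 : 0 < M' by rewrite ltr_wpDl.
(* [|x|^2 <= M' |P x|^2 <= M' C' <P x, x>], so that [m] is not the supremum. *)
have : S (m + (M' * C')^-1).
  move=> x; rewrite mulrDl -lerBrDl.
  have := PE x x => <-; rewrite ler_pdivrMl ?mulr_gt0// -mulrA.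
  apply: le_trans (hM x) _; apply: (@le_trans _ _ (M' * dot (P x) (P x))).
    by rewrite ler_wpM2r ?(dot_ge0 D)// /M'; have := ler_norm M; lra.
  by rewrite ler_wpM2l ?key// ltW.
move=> /(ub_le_sup supS.2); rewrite -/m gerDl leNgt invr_gt0 mulr_gt0//.
Qed.

Definition finite_rank n (k : 'I_n -> R) (g : 'I_n -> H) x : H :=
  \sum_j ((k j)%:C * cip dot x (g j)) *: g j.

Section FiniteRank.
Variables (n : nat) (k : 'I_n -> R) (g : 'I_n -> H).
Local Notation K := (finite_rank k g).

Lemma finite_rank_linear : linear K.
Proof.
move=> a x y; rewrite /finite_rank scaler_sumr -big_split; apply: eq_bigr => j _ /=.
by rewrite (cipDl D) (cipZl D) mulrDr scalerDl scalerA mulrCA.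
Qed.

Lemma finite_rank_dot x y :
  dot (K x) y = \sum_j k j * (dot x (g j) * dot y (g j) + dot x ('i%C *: g j) * dot y ('i%C *: g j)).
Proof.
rewrite /finite_rank (dot_suml D); apply: eq_bigr => j _.
rewrite -scalerA (dotZl D) (dotZRe D) /= (dotC D (g j)) (dotC D (_ *: g j)).
by [].
Qed.

Lemma finite_rank_selfadjoint : selfadjoint K.
Proof.
move=> x y; rewrite (dotC D x) !finite_rank_dot; apply: eq_bigr => j _; congr (_ * _).
by rewrite (mulrC (dot x _)) (mulrC (dot x ('i%C *: _))).
Qed.

Lemma finite_rank_form_bounded : form_bounded K.
Proof.
exists (\sum_j `|k j| * (2 * dot (g j) (g j))) => x.
rewrite finite_rank_dot; apply: le_trans (ler_norm_sum _ _ _) _.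
rewrite mulr_suml; apply: ler_sum => j _; rewrite normrM -mulrA ler_wpM2l//.
rewrite -!expr2 ger0_norm ?addr_ge0 ?sqr_ge0//.
have := cip_bound x (g j); rewrite normc_sqr /=; nra.
Qed.

(** Weyl's theorem in the finite-rank case.  Writing [c_j = <x, g_j>], the
   equation [(A + K - m) x = r] determines [c] from [r] through a square matrix:
   a kernel vector of it is an eigenvector, and otherwise [x] is controlled by [r]. *)
Lemma finite_rank_weyl (A : H -> H) (m : R) : linear A -> bounded_below A m ->
  (forall y, exists x, A x - m%:C *: x = y) ->
  (exists2 x, x != 0 & A x + K x = m%:C *: x) \/ bounded_below (fun x => A x + K x) m.
Proof.
move=> linA [M hM] surj.
have [T TE] := choice (fun j => surj (g j)).
(* With [w = x + \sum_j k_j c_j T_j] one has [(A - m) w = (A + K - m) x], and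
   [c W] lists the products [<w, g_i>]. *)
pose W : 'M[R[i]]_n := \matrix_(j, i) ((j == i)%:R + (k j)%:C * cip dot (T j) (g i)).
have linAm : linear (fun x => A x - m%:C *: x).
  move=> a x y /=; rewrite linA scalerDr scalerBr !scalerA mulrC opprD.
  by rewrite addrACA.
have rowE (c : 'rV_n) i : (c *m W) 0 i =
    c 0 i + cip dot (\sum_j ((k j)%:C * c 0 j) *: T j) (g i).
  rewrite mxE (cip_suml D).
  under eq_bigr => j _ do rewrite mxE mulrDr.
  rewrite big_split/=; congr (_ + _).
    rewrite (bigD1 i)//= eqxx mulr1 big1 ?addr0// => j /negbTE ->.
    by rewrite mulr0.
  by apply: eq_bigr => j _; rewrite (cipZl D) mulrA (mulrC (c 0 j)).
have AmT (c : 'rV_n) : let w := \sum_j ((k j)%:C * c 0 j) *: T j in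
    A w - m%:C *: w = \sum_j ((k j)%:C * c 0 j) *: g j.
  rewrite /= (lin_sum linAm); apply: eq_bigr => j _.
  by rewrite (linZ linAm) TE.
have [/det0P[c c0 cW]|detW] := boolP (\det W == 0).
  left; pose w := \sum_j ((k j)%:C * c 0 j) *: T j.
  have cE i : cip dot (- w) (g i) = c 0 i.
    have := rowE c i; rewrite cW mxE -/w => /esym/eqP.
    by rewrite addr_eq0 => /eqP ->; rewrite -scaleN1r (cipZl D) mulN1r.
  exists (- w).
    apply: contra c0 => /eqP w0; apply/eqP/rowP => i; rewrite -cE w0 (cip0l D).
    by rewrite mxE.
  have -> : K (- w) = A w - m%:C *: w.
    by rewrite AmT /finite_rank; apply: eq_bigr => j _; rewrite cE.
  by rewrite (linN linA) addrA addNr add0r scalerN.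
right.
have Wu : W \in unitmx by rewrite unitmxE unitfE.
pose V := invmx W.
pose g' j := \sum_i (V i j)^*%C *: g i.
pose M' := 2 * (1 + n%:R * \sum_j (k j ^+ 2 * (2 * dot (g' j) (g' j))) * dot (T j) (T j)).
exists (M' * M) => x.
pose c : 'rV_n := \row_j cip dot x (g j).
pose w := x + \sum_j ((k j)%:C * c 0 j) *: T j.
have wE : A w - m%:C *: w = A x + K x - m%:C *: x.
  rewrite /w (linD linAm) AmT addrAC; congr (_ + _).
  by rewrite /finite_rank; congr (_ + _); apply: eq_bigr => j _; rewrite mxE.
have cE j : c 0 j = cip dot w (g' j).
  have cW : c *m W = \row_i cip dot w (g i).
    by apply/rowP => i; rewrite rowE mxE [RHS]mxE /w (cipDl D).
  have -> : c = (\row_i cip dot w (g i)) *m V by rewrite -cW mulmxK.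
  rewrite mxE /g' cip_sumr; apply: eq_bigr => i _.
  by rewrite mxE cipZr conjcK mulrC.
have xE : x = w - \sum_j ((k j)%:C * c 0 j) *: T j by rewrite /w addrK.
have M'0 : 0 <= M'.
  rewrite mulr_ge0// addr_ge0// mulr_ge0// sumr_ge0// => j _.
  by rewrite mulr_ge0 ?(dot_ge0 D)// mulr_ge0 ?sqr_ge0// mulr_ge0 ?(dot_ge0 D).
rewrite -wE -mulrA; apply: le_trans (ler_wpM2l M'0 (hM w)).
rewrite {1 2}xE.
apply: le_trans (n2D_le D _ _) _; rewrite (dotNl D) (dotNr D) opprK.
rewrite -mulrDr /M' -mulrA ler_pM2l// mulrDl mul1r lerD2l.
apply: le_trans (n2_sum_le D _) _; rewrite card_ord -mulrA ler_wpM2l//.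
rewrite mulr_suml; apply: ler_sum => j _.
rewrite (n2Z D) ComplexField.Normc.normcM exprMn [leRHS]mulrAC.
rewrite ler_wpM2r ?(dot_ge0 D)// normc_sqr /= expr0n addr0 -[leRHS]mulrA.
rewrite ler_wpM2l ?sqr_ge0// cE; have := cip_bound w (g' j); lra.
Qed.

End FiniteRank.

(** Families are indexed by [nat] and used below [n] only, which makes extending
   a family by one vector painless. *)
Definition eigenfamily B (mu : R) (n : nat) (e : nat -> H) (l : nat -> R) :=
  (forall i j, (i < n)%N -> (j < n)%N -> cip dot (e i) (e j) = (i == j)%:R) /\
  (forall i, (i < n)%N -> l i < mu /\ B (e i) = (l i)%:C *: e i).

Lemma selfadjoint_orth B (l m : R) x y : selfadjoint B -> l != m ->
  B x = l%:C *: x -> B y = m%:C *: y -> dot x y = 0.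
Proof.
move=> symB lm Bx By; have := symB x y.
rewrite Bx By (dotZl D) (dotZr D) => /eqP.
by rewrite -subr_eq0 -mulrBl mulf_eq0 subr_eq0 (negbTE lm) => /eqP.
Qed.

(** Below the spectrum of [A], the finite-rank perturbation [B] has only
   eigenvalues.  For a maximal orthonormal family of eigenvectors with eigenvalues
   [< mu], adding a finite-rank operator that moves these eigenvalues up to [mu]
   leaves an operator without spectrum below [mu], by maximality. *)
Lemma negative_spectrum A (mu : R) n (k : 'I_n -> R) (g : 'I_n -> H) (N : nat) :
  let B x := A x + finite_rank k g x in
  linear A -> selfadjoint A -> form_bounded A -> mu <= 0 ->
  (forall m, m < 0 -> bounded_below A m /\ forall y, exists x, A x - m%:C *: x = y) ->
  (forall n' e l, eigenfamily B mu n' e l -> (n' <= N)%N) ->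
  exists n' (e : nat -> H), (n' <= N)%N /\ forall x,
    (forall i, (i < n')%N -> cip dot x (e i) = 0) -> mu * dot x x <= dot (B x) x.
Proof.
move=> B linA symA bdA mu0 resA maxN.
have symB : selfadjoint B.
  move=> x y; rewrite /B (dotDl D) (dotDr D) symA; congr (_ + _).
  exact: finite_rank_selfadjoint.
have linB : linear B.
  move=> a x y; rewrite /B linA finite_rank_linear scalerDr addrACA//.
pose P n' := `[< exists e l, eigenfamily B mu n' e l >].
have exP : exists n', P n'.
  by exists 0%N; apply/asboolP; exists (fun=> 0), (fun=> 0); split.
have PN n' : P n' -> (n' <= N)%N by move=> /asboolP[e [l h]]; exact: maxN h.
case: (ex_maxnP exP PN) => n' /asboolP[e [l [eo eB]]] maxn'.
exists n', e; split; first by apply: (maxN n' e l); split.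
pose k' (i : 'I_(n + n')) := match fintype.split i with inl j => k j | inr j => mu - l j end.
pose g' (i : 'I_(n + n')) := match fintype.split i with inl j => g j | inr j => e j end.
have KE x : finite_rank k' g' x = finite_rank k g x +
    finite_rank (fun i : 'I_n' => mu - l i) (fun i : 'I_n' => e i) x.
  rewrite /finite_rank big_split_ord /=; congr (_ + _); apply: eq_bigr => j _.
    by rewrite /k' /g' (unsplitK (inl j)).
  by rewrite /k' /g' (unsplitK (inr j)).
pose B' x := A x + finite_rank k' g' x.
have linB' : linear B'.
  by move=> a x y; rewrite /B' linA finite_rank_linear scalerDr addrACA.
have symB' : selfadjoint B'.
  move=> x y; rewrite /B' (dotDl D) (dotDr D) symA; congr (_ + _).
  exact: finite_rank_selfadjoint.
have bdB' : form_bounded B'.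
  have [C1 h1] := bdA; have [C2 h2] := finite_rank_form_bounded k' g'.
  exists (C1 + C2) => x; rewrite (dotDl D) mulrDl.
  by apply: le_trans (ler_normD _ _) _; rewrite lerD.
have B'E x : (forall i, (i < n')%N -> cip dot x (e i) = 0) -> B' x = B x.
  move=> h; rewrite /B' KE /B addrA -[RHS]addr0; congr (_ + _).
  by rewrite /finite_rank big1// => i _; rewrite h ?ltn_ord// mulr0 scale0r.
have B'e i : (i < n')%N -> B' (e i) = mu%:C *: e i.
  move=> ilt; rewrite /B' KE addrA -/(B _) (eB i ilt).2.
  rewrite /finite_rank (bigD1 (Ordinal ilt))//= big1 ?addr0.
    by rewrite eo// eqxx mulr1 -scalerDl -rmorphD /= addrC subrK.
  move=> j ji; rewrite eo// (_ : (i == j :> nat) = false) ?mulr0 ?scale0r//.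
  by apply/negbTE; apply: contra ji => /eqP ij; apply/eqP/val_inj.
have lb : forall x, mu * dot x x <= dot (B' x) x.
  apply: form_lower_bound => // m mlt.
  have m0 : m < 0 := lt_le_trans mlt mu0.
  have [below surj] := resA m m0.
  (* An eigenvector of [B'] below [mu] is orthogonal to the family, hence is one of
     [B], against maximality. *)
  have [[f f0 fB]|//] := finite_rank_weyl k' g' linA below surj.
  have forth i : (i < n')%N -> cip dot f (e i) = 0.
    move=> ilt; have mmu : m != mu by rewrite lt_eqF.
    apply/(cip_eq0 D); split; apply: (selfadjoint_orth symB' mmu) (B'e i ilt) => //.
    by rewrite (linZ linB') -/(B' f) [B' f]fB !scalerA mulrC.
  have f0' : 0 < dot f f.
    rewrite lt_neqAle (dot_ge0 D) andbT eq_sym.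
    by apply: contra f0 => /eqP h; rewrite (dot_eq0 D h).
  pose w := ((Num.sqrt (dot f f))^-1)%:C *: f.
  have ww : cip dot w w = 1.
    rewrite cip_self (n2Z D) normc_sqr /= expr0n addr0 exprVn sqr_sqrtr ?ltW//.
    by rewrite mulVf ?gt_eqF.
  have worth i : (i < n')%N -> cip dot w (e i) = 0.
    by move=> ilt; rewrite (cipZl D) forth ?mulr0.
  have : (n'.+1 <= n')%N.
    apply: maxn'; apply/asboolP.
    exists (fun i => if i == n' then w else e i), (fun i => if i == n' then m else l i).
    split=> [i j|i].
      rewrite !ltnS (leq_eqVlt i) (leq_eqVlt j).
      have [-> _|/= ni ilt] := eqVneq i n'; have [-> _|/= nj jlt] := eqVneq j n'.
      - exact: ww.
      - exact: worth.
      - by rewrite (cip_eq0C D (worth i ilt)) (negbTE ni).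
      - exact: eo.
    rewrite ltnS leq_eqVlt; have [-> _|/= ni ilt] := eqVneq i n'; last exact: eB.
    split=> //; rewrite /w (linZ linB) -B'E// [B' f]fB !scalerA mulrC//.
  by rewrite ltnn.
by move=> x h; rewrite -B'E.
Qed.

End Spectral.

(** * The discrete Fourier transform *)

Section Trigonometry.
Variable R : realType.
Implicit Types t x : R.

(** This makes the symbol of the symmetric difference larger than that of the
   derivative, so that discretization never loses positivity. *)
Lemma tan_ge_id x : 0 <= x < pi / 2 -> x <= sin x / cos x.
Proof.
move=> /andP[x0 xpi].
have cpos c : c \in `[0, x] -> 0 < cos c.
  rewrite in_itv/= => /andP[c0 cx]; apply: cos_gt0_pihalf.
  by rewrite (le_lt_trans cx)// andbT (lt_le_trans _ c0)// oppr_lt0 divr_gt0// pi_gt0.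
have [c cx] : exists2 c, c \in `[0, x] & tan x - tan 0 = (cos c) ^- 2 * (x - 0).
  apply: MVT_segment => // [y yx|].
    by apply: is_derive_tan; rewrite gt_eqF// cpos// (subset_itvW _ _ _ _ yx).
  apply: continuous_in_subspaceT => y; rewrite inE/= => yx.
  by apply: continuous_tan; rewrite gt_eqF// cpos.
rewrite tan0 !subr0 -[sin x / cos x]/(tan x) => ->.
have c1 : cos c ^+ 2 <= 1 by rewrite expr_le1 ?cos_le1// ltW// cpos.
by rewrite -[leLHS]mul1r ler_wpM2r// invf_ge1// exprn_gt0// cpos.
Qed.

(** [exp (i t)]. *)
Definition expi t : R[i] := cos t +i* sin t.

Lemma expiD t x : expi (t + x) = expi t * expi x.
Proof.
rewrite /expi cosD sinD; apply/eqP; rewrite eq_complex /= eqxx /=.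
by apply/eqP; ring.
Qed.

Lemma expi0 : expi 0 = 1.
Proof. by rewrite /expi cos0 sin0. Qed.

Lemma expi_conj t : (expi t)^*%C = expi (- t).
Proof. by rewrite /expi cosN sinN. Qed.

Lemma expi_period (n : nat) : expi (2 * pi * n%:R) = 1.
Proof.
have := periodicn (@cosD2pi R) n 0; have := periodicn (@sinD2pi R) n 0.
rewrite !add0r cos0 sin0 -mulrnA mulnC mulrnA => hs hc.
rewrite /expi (_ : 2 * pi * n%:R = pi *+ n *+ 2) ?hs ?hc//.
by rewrite -mulrnA -[RHS]mulr_natr natrM; ring.
Qed.

Lemma expiMn t (k : nat) : expi (t * k%:R) = expi t ^+ k.
Proof.
elim: k => [|k IH]; first by rewrite mulr0 expi0 expr0.
by rewrite -natr1 mulrDr mulr1 expiD IH exprSr.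
Qed.

Lemma expi_neq1 t : 0 < t < 2 * pi -> expi t != 1.
Proof.
move=> /andP[t0 tpi]; apply/eqP => -[ct _].
have : 0 < sin (t / 2) by apply: sin_gt0_pi; rewrite divr_gt0//= ltr_pdivrMr// mulrC.
have := cos_mulr2n (t / 2); rewrite (_ : t / 2 *+ 2 = t) ?ct; last by rewrite mulr2n -splitr.
rewrite cos2sin2 mulr2n => h s0; have : 0 < sin (t / 2) ^+ 2 by rewrite exprn_gt0.
by lra.
Qed.

(** Half-angle form of the Cayley transform: the ratio of the symbols of the
   difference and of the mean of two consecutive samples is [i tan x]. *)
Lemma expi_cayley x : cos x != 0 ->
  expi (x *+ 2) - 1 = 'i%C * (sin x / cos x)%:C * (expi (x *+ 2) + 1).
Proof.
move=> cx; rewrite /expi cos_mulr2n sin_mulr2n.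
have s2 := sin2cos2 x.
apply/eqP; rewrite eq_complex /=; simpc => /=; apply/andP; split; apply/eqP.
  have -> : cos x ^+ 2 = 1 - sin x ^+ 2 by rewrite s2; ring.
  by field.
by field.
Qed.

End Trigonometry.

Section Dft.
Variables (R : realType) (M : nat).
Hypothesis M0 : (0 < M)%N.
Local Notation C := R[i].

(** The character [k |-> exp (2 pi i n k / M)] of [Z / M]. *)
Definition chi (n k : nat) : C := expi (2 * pi / M%:R * (n * k)%:R).

Lemma chiC n k : chi n k = chi k n. Proof. by rewrite /chi mulnC. Qed.

Lemma chiS n k : chi n k.+1 = expi (2 * pi / M%:R * n%:R) * chi n k.
Proof. by rewrite /chi mulnS natrD mulrDr expiD. Qed.

Lemma chi_M n : chi n M = 1.
Proof.
rewrite /chi (_ : _ * _ = 2 * pi * n%:R) ?expi_period//.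
by rewrite natrM; field; rewrite pnatr_eq0 -lt0n.
Qed.

Lemma chi_0 n : chi n 0 = 1.
Proof. by rewrite /chi muln0 mulr0 expi0. Qed.

Lemma chi_orth (n m : 'I_M) :
  \sum_(k < M) chi n k * (chi m k)^*%C = if n == m then M%:R else 0.
Proof.
pose z : C := expi (2 * pi / M%:R * (n%:R - m%:R)).
have zE (k : nat) : chi n k * (chi m k)^*%C = z ^+ k.
  rewrite /chi expi_conj -expiD -expiMn; congr (expi _).
  by rewrite !natrM; ring.
under eq_bigr do rewrite zE.
have [nm|nm] := eqVneq n m.
  rewrite /z nm subrr mulr0 expi0; under eq_bigr do rewrite expr1n.
  by rewrite sumr_const card_ord.
have Mn : M%:R != 0 :> R by rewrite pnatr_eq0 -lt0n.
have zM : z ^+ M = 1.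
  rewrite -zE (chi_M n) (chi_M m) mul1r; exact: conjc1.
have z1 : z != 1.
  have Mp : (0 : R) < M%:R by rewrite ltr0n.
  have h (a b : 'I_M) : (a < b)%N -> expi (2 * pi / M%:R * (b%:R - a%:R) : R) != 1.
    move=> ab; apply: expi_neq1; rewrite mulr_gt0 ?divr_gt0 ?mulr_gt0 ?pi_gt0//=; last first.
      by rewrite subr_gt0 ltr_nat.
    rewrite -mulrA gtr_pMr ?mulr_gt0 ?pi_gt0// ltr_pdivrMl// mulr1.
    by rewrite ltrBlDr (lt_le_trans (_ : _ < M%:R)) ?ltr_nat ?ltn_ord// lerDl.
  have [nltm|mltn|/val_inj/eqP] := ltngtP n m; last by rewrite (negbTE nm).
    rewrite /z -opprB mulrN -expi_conj; apply: contra (h _ _ nltm) => /eqP e.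
    by rewrite -(inj_eq (can_inj (@conjcK R))) e conjc1.
  exact: h.
have := subrX1 z M; rewrite zM subrr => /esym/eqP.
by rewrite mulf_eq0 subr_eq0 (negbTE z1) => /eqP.
Qed.

Section DftModule.
Variables (H : lmodType C) (dot : H -> H -> R).
Hypothesis D : is_dot dot.

Definition synth (c : 'I_M -> H) (k : nat) : H := \sum_(n < M) chi n k *: c n.

Definition dft (x : nat -> H) (n : 'I_M) : H :=
  (M%:R^-1 : R)%:C *: \sum_(k < M) (chi n k)^*%C *: x k.

Lemma dftK x (k : 'I_M) : synth (dft x) k = x k.
Proof.
rewrite /synth /dft.
under eq_bigr do rewrite scalerA mulrC -scalerA scaler_sumr.
rewrite -scaler_sumr exchange_big.
under eq_bigr => j _.
  under eq_bigr do rewrite scalerA (chiC _ k) (chiC _ j).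
  rewrite -scaler_suml chi_orth; over.
rewrite (bigD1 k)//= eqxx big1 ?addr0 => [|j jk]; last first.
  by rewrite eq_sym (negbTE jk) scale0r.
rewrite scalerA -(rmorph_nat (real_complex R)) -rmorphM/= mulVf ?scale1r//.
by rewrite pnatr_eq0 -lt0n.
Qed.

Lemma synthK c : dft (synth c) = c.
Proof.
apply/funext => n; rewrite /dft /synth.
under eq_bigr do rewrite scaler_sumr.
rewrite exchange_big /=.
under eq_bigr => j _.
  under eq_bigr do rewrite scalerA mulrC.
  rewrite -scaler_suml chi_orth; over.
rewrite (bigD1 n)//= eqxx big1 ?addr0 => [|j /negbTE->]; last by rewrite scale0r.
rewrite scalerA -(rmorph_nat (real_complex R)) -rmorphM/= mulVf ?scale1r//.
by rewrite pnatr_eq0 -lt0n.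
Qed.

Lemma synth_parseval c d :
  M%:R^-1 * \sum_(k < M) dot (synth c k) (synth d k) = \sum_n dot (c n) (d n).
Proof.
have e (k : 'I_M) : dot (synth c k) (synth d k) =
    \sum_(n < M) \sum_(m < M) dot ((chi n k * (chi m k)^*%C) *: c n) (d m).
  rewrite (dot_suml D); apply: eq_bigr => n _.
  rewrite (dot_sumr D); apply: eq_bigr => m _.
  by rewrite [RHS](dotC D) mulrC -scalerA (dotC D (d m)) (dotZ_adj D (_^*%C)) conjcK.
under eq_bigr do rewrite e.
rewrite exchange_big mulr_sumr; apply: eq_bigr => n _.
rewrite exchange_big /=.
under eq_bigr => m _ do rewrite -(dot_suml D) -scaler_suml chi_orth.
rewrite (bigD1 n)//= eqxx big1 ?addr0 => [|j jn]; last first.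
  by rewrite eq_sym (negbTE jn) scale0r (dot0l D).
rewrite -(rmorph_nat (real_complex R)) (dotZl D) mulrA mulVf ?mul1r//.
by rewrite pnatr_eq0 -lt0n.
Qed.

Lemma synth_lin (T : H -> H) c k : linear T -> T (synth c k) = synth (T \o c) k.
Proof.
by move=> linT; rewrite /synth (lin_sum linT); apply: eq_bigr => n _; rewrite (linZ linT).
Qed.

Lemma synthD c d k : synth c k + synth d k = synth (fun n => c n + d n) k.
Proof. by rewrite /synth -big_split; apply: eq_bigr => n _; rewrite scalerDr. Qed.

Lemma synthB c d k : synth c k - synth d k = synth (fun n => c n - d n) k.
Proof.
by rewrite /synth -sumrB; apply: eq_bigr => n _; rewrite scalerBr.
Qed.

End DftModule.
End Dft.

(** * Time discretization *)

(** The inner product of [L^2(0, tau; H)], normalized, for functions sampled at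
   [M] times. *)
Definition mean_dot (R : realType) (H : lmodType R[i]) (dot : H -> H -> R) (M : nat)
  (x y : 'I_M -> H) : R := M%:R^-1 * \sum_(k < M) dot (x k) (y k).

Lemma mean_dot_is_dot (R : realType) (H : lmodType R[i]) (dot : H -> H -> R) (M : nat) :
  is_dot dot -> (0 < M)%N -> is_dot (@mean_dot R H dot M).
Proof.
move=> D M0; have Mi : 0 < M%:R^-1 :> R by rewrite invr_gt0 ltr0n.
split; rewrite /mean_dot.
- by move=> x y; congr (_ * _); apply: eq_bigr => k _; rewrite (dotC D).
- move=> x y z; rewrite -mulrDr -big_split; congr (_ * _); apply: eq_bigr => k _.
  by rewrite fctE (dotDl D).
- move=> a x y; under eq_bigr do rewrite fctE (dotZl D).
  by rewrite -mulr_sumr mulrCA.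
- move=> x y; rewrite -mulrN -sumrN; congr (_ * _); apply: eq_bigr => k _.
  by rewrite !fctE (dotI D).
- by move=> x; rewrite mulr_ge0 ?(ltW Mi)// sumr_ge0// => k _; rewrite (dot_ge0 D).
- move=> x /eqP; rewrite mulf_eq0 gt_eqF//= psumr_eq0 => [/allP h|k _]; last exact: (dot_ge0 D).
  by apply/funext => k; apply: (dot_eq0 D); apply/eqP; apply: h; rewrite mem_index_enum.
Qed.

Section ApproximateEigenfunctions.
Variables (R : realType) (H : lmodType R[i]) (dot : H -> H -> R).
Hypothesis D : is_dot dot.
Variables (tau : R) (T : nat -> nat -> H -> H).
Hypothesis tau0 : 0 < tau.
Hypothesis linT : forall M k, linear (T M k).
Hypothesis symT : forall M k, selfadjoint dot (T M k).
Implicit Types (f g : R -> H) (l : R).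

Definition sample f (M k : nat) : H := f (k%:R * (tau / M%:R)).

Definition midpoint f (M k : nat) : H :=
  (2^-1 : R)%:C *: (sample f M k + sample f M k.+1).

(** The Crank-Nicolson form of [-i d/dt]: compared with values at midpoints, it is
   exactly symmetric, so that scalar products are conserved without error. *)
Definition time_difference f (M k : nat) : H :=
  (- 'i%C : R[i]) *: ((M%:R / tau)%:C *: (sample f M k.+1 - sample f M k)).

Definition defect l f (M k : nat) : H :=
  time_difference f M k + T M k (midpoint f M k) - l%:C *: midpoint f M k.

(** What remains of an eigenfunction of [-i d/dt + T] after discretization.  The
   defect is only [O(1 / sqrt M)] in norm, because the velocity is merely
   square-integrable in time. *)
Definition approx_eigenfunction l f : Prop :=
  [/\ f tau = f 0,
    exists C : R, forall s t, 0 <= s <= tau -> 0 <= t <= tau ->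
      dot (f s - f t) (f s - f t) <= C * `|s - t|
  & exists C : R, forall M k, (0 < M)%N -> (k < M)%N ->
      dot (defect l f M k) (defect l f M k) <= C / M%:R].

Lemma sample_in (M k : nat) : (0 < M)%N -> (k <= M)%N ->
  0 <= k%:R * (tau / M%:R) <= tau.
Proof.
move=> M0 kM; rewrite mulr_ge0 ?divr_ge0 ?(ltW tau0)//=.
rewrite mulrCA ger_pMr// ler_pdivrMr ?ltr0n// mul1r ler_nat//.
Qed.

Lemma sample_first f M : sample f M 0 = f 0.
Proof. by rewrite /sample mul0r. Qed.

Lemma sample_last f M : (0 < M)%N -> sample f M M = f tau.
Proof.
by move=> M0; rewrite /sample mulrCA divff ?mulr1// pnatr_eq0 -lt0n.
Qed.

Lemma midpoint_lin a f g M k :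
  midpoint (fun t => a *: f t + g t) M k = a *: midpoint f M k + midpoint g M k.
Proof.
rewrite /midpoint /sample addrACA -scalerDr.
by move: (f _ + f _) (g _ + g _) => x y; rewrite scalerDr !scalerA mulrC.
Qed.

Lemma time_difference_lin a f g M k :
  time_difference (fun t => a *: f t + g t) M k =
  a *: time_difference f M k + time_difference g M k.
Proof.
rewrite /time_difference /sample opprD addrACA -scalerBr.
move: (f _ - f _) (g _ - g _) => x y.
rewrite scalerDr scalerDr !scalerA; congr (_ *: x + _).
exact: mulrC.
Qed.

Lemma defect_lin l a f g M k :
  defect l (fun t => a *: f t + g t) M k = a *: defect l f M k + defect l g M k.
Proof.
rewrite /defect midpoint_lin time_difference_lin linT.
move: (midpoint f M k) (midpoint g M k) => x y.
move: (time_difference f M k) (time_difference g M k) (T _ _ _) (T _ _ _) => u v z w.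
rewrite scalerBr !scalerDr !scalerA (mulrC _ a) opprD -!scalerA.
by rewrite (addrACA (a *: u)) (addrACA (a *: u + _)).
Qed.

Lemma approx_eigenfunction_lin l a f g :
  approx_eigenfunction l f -> approx_eigenfunction l g ->
  approx_eigenfunction l (fun t => a *: f t + g t).
Proof.
move=> [pf [Cf hf] [Ef ef]] [pg [Cg hg] [Eg eg]]; split.
- by rewrite pf pg.
- exists (2 * (normc a ^+ 2 * Cf) + 2 * Cg) => s t sI tI.
  rewrite opprD addrACA -scalerBr; apply: le_trans (n2D_le D _ _) _.
  have := hg _ _ sI tI; have := ler_wpM2l (sqr_ge0 (normc a)) (hf _ _ sI tI).
  by rewrite (n2Z D); lra.
- exists (2 * (normc a ^+ 2 * Ef) + 2 * Eg) => M k M0 kM.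
  rewrite defect_lin; apply: le_trans (n2D_le D _ _) _.
  have := eg _ _ M0 kM; have := ler_wpM2l (sqr_ge0 (normc a)) (ef _ _ M0 kM).
  by rewrite (n2Z D); lra.
Qed.

Lemma sample_step l f M k : (0 < M)%N ->
  sample f M k.+1 - sample f M k = (tau / M%:R)%:C *:
    ('i%C *: (defect l f M k - T M k (midpoint f M k) + l%:C *: midpoint f M k)).
Proof.
move=> M0; rewrite /defect /time_difference.
rewrite -[_ - T M k _ + _]addrA [- T _ _ _ + _]addrC addrA subrK addrK.
rewrite !scalerA [X in X *: _](_ : _ = 1) ?scale1r//.
have M0' : M%:R != 0 :> R by rewrite pnatr_eq0 -lt0n.
apply/eqP; rewrite eq_complex /=; simpc => /=; apply/andP; split => //; apply/eqP; field.
by rewrite M0' gt_eqF.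
Qed.

Lemma symT_dotI M k x y : dot ('i%C *: T M k x) y = dot ('i%C *: x) (T M k y).
Proof. by rewrite -(linZ (linT M k)) symT. Qed.

(** Up to the defects the discrete evolution is unitary: [T] drops out by symmetry. *)
Lemma dot_sample_step l l' f g M k : (0 < M)%N ->
  dot (sample f M k.+1) (sample g M k.+1) - dot (sample f M k) (sample g M k) =
  tau / M%:R * ((l - l') * dot ('i%C *: midpoint f M k) (midpoint g M k)
    + dot ('i%C *: defect l f M k) (midpoint g M k)
    - dot ('i%C *: midpoint f M k) (defect l' g M k)).
Proof.
move=> M0.
have -> : dot (sample f M k.+1) (sample g M k.+1) - dot (sample f M k) (sample g M k) =
    dot (sample f M k.+1 - sample f M k) (midpoint g M k) +
    dot (midpoint f M k) (sample g M k.+1 - sample g M k).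
  rewrite /midpoint (dotZr D) (dotZl D) (dotBl D) (dotDl D) !(dotBr D) !(dotDr D).
  by field.
rewrite (sample_step l f) // (sample_step l' g)//.
move: (midpoint f M k) (midpoint g M k) (defect l f M k) (defect l' g M k) => x y u v.
rewrite (dotZl D) (dotZr D) -mulrDr; congr (_ * _).
rewrite (dotIr D) scalerDr scalerBr (dotDl D) (dotBl D) (dotDr D) (dotBr D) symT_dotI.
rewrite (dotZr D) scalerA mulrC -scalerA (dotZl D); ring.
Qed.

Lemma approx_eigenfunction_bounded l f : approx_eigenfunction l f ->
  exists2 B : R, 0 <= B & forall M k, (0 < M)%N -> (k < M)%N ->
    [/\ dot (midpoint f M k) (midpoint f M k) <= B,
        dot (defect l f M k) (defect l f M k) <= B / M%:R
      & dot (sample f M k.+1 - sample f M k) (sample f M k.+1 - sample f M k) <= B / M%:R].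
Proof.
move=> [_ [C hC] [E hE]].
pose B0 := 2 * (`|C| * tau) + 2 * dot (f 0) (f 0).
have B0_ge : 0 <= B0 by rewrite addr_ge0 ?mulr_ge0 ?(dot_ge0 D)// ltW.
have I0 : 0 <= (0 : R) <= tau by rewrite lexx ltW.
have bd t : 0 <= t <= tau -> dot (f t) (f t) <= B0.
  move=> tI; rewrite -[f t](subrK (f 0)); apply: le_trans (n2D_le D _ _) _.
  rewrite lerD2r ler_pM2l//; apply: le_trans (hC _ _ tI I0) _.
  case/andP: tI => t0 tt; rewrite subr0 ger0_norm//.
  by apply: (@le_trans _ _ (`|C| * t)); rewrite ?ler_wpM2r ?ler_norm// ler_wpM2l.
exists (B0 + `|E| + `|C| * tau).
  by rewrite addr_ge0 ?mulr_ge0 ?(ltW tau0)// addr_ge0.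
move=> M k M0 kM; have Mp : 0 < M%:R :> R by rewrite ltr0n.
have k1 := sample_in M0 (ltnW kM); have k2 := sample_in M0 kM.
have Ct : 0 <= `|C| * tau by rewrite mulr_ge0// ltW.
split.
- have := bd _ k1; have := bd _ k2; rewrite /midpoint /sample.
  move: (f _) (f _) => x y h1 h2.
  rewrite (n2Z D) normc_sqr /= expr0n addr0; have := n2D_le D x y.
  by have := normr_ge0 E; lra.
- apply: le_trans (hE _ _ M0 kM) _; rewrite ler_pM2r ?invr_gt0//.
  by have := ler_norm E; lra.
- apply: le_trans (hC _ _ k2 k1) _.
  rewrite -mulrBl -natr1 addrAC subrr add0r mul1r ger0_norm ?divr_ge0 ?(ltW tau0)//.
  rewrite mulrA ler_pM2r ?invr_gt0//.
  have : C * tau <= `|C| * tau by rewrite ler_wpM2r ?ler_norm// ltW.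
  by have := normr_ge0 E; lra.
Qed.

(** The defect is of size [1 / sqrt M] and each of the [M] steps has length
   [tau / M], so that the errors of all steps add up to [O(1 / sqrt M)]. *)
Lemma dot_sample_drift l l' f g :
  approx_eigenfunction l f -> approx_eigenfunction l' g ->
  exists2 C : R, 0 <= C & forall M k, (0 < M)%N -> (k < M)%N ->
    `|dot (sample f M k.+1) (sample g M k.+1) - dot (sample f M k) (sample g M k)
      - tau / M%:R * ((l - l') * dot ('i%C *: midpoint f M k) (midpoint g M k))|
    <= C / Num.sqrt M%:R / M%:R.
Proof.
move=> /approx_eigenfunction_bounded[Bf Bf0 hf] /approx_eigenfunction_bounded[Bg Bg0 hg].
exists (tau * (2 * (Bf + Bg))); first by rewrite !mulr_ge0 ?addr_ge0// ltW.
move=> M k M0 kM.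
have [f1 f2 _] := hf M k M0 kM; have [g1 g2 _] := hg M k M0 kM.
rewrite (dot_sample_step l l')//.
move: (midpoint f M k) (midpoint g M k) (defect l f M k) (defect l' g M k) f1 f2 g1 g2.
move=> x y u v f1 f2 g1 g2.
rewrite -mulrBr (_ : forall a p q : R, a + p - q - a = p - q); last by move=> *; ring.
pose s := Num.sqrt M%:R : R.
have Mp : 0 < M%:R :> R by rewrite ltr0n.
have s0 : 0 < s by rewrite sqrtr_gt0.
have s0' : 0 < s^-1 by rewrite invr_gt0.
have ss : M%:R = s * s by rewrite -expr2 sqr_sqrtr// ltW.
have sM (b : R) : s * (b / M%:R) = b / s by rewrite ss; field; rewrite gt_eqF.
have h1 : `|dot ('i%C *: u) y| <= (Bf + Bg) / s.
  apply: le_trans (dot_amgm D _ _ s0) _; rewrite (dotII D) mulrDl lerD//.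
    by rewrite -sM ler_pM2l.
  by rewrite ler_pM2r.
have h2 : `|dot ('i%C *: x) v| <= (Bf + Bg) / s.
  apply: le_trans (dot_amgm D _ _ s0') _; rewrite (dotII D) mulrDl lerD//.
    by rewrite mulrC ler_pM2r.
  by rewrite invrK mulrC -sM ler_pM2l.
rewrite normrM ger0_norm ?divr_ge0 ?(ltW tau0)// -/s.
rewrite (_ : _ / s / M%:R = tau / M%:R * (2 * ((Bf + Bg) / s))); last by ring.
rewrite ler_pM2l ?divr_gt0// mulr_natl mulr2n.
by apply: le_trans (ler_normB _ _) _; rewrite lerD.
Qed.

Lemma gram_same_level l f g :
  approx_eigenfunction l f -> approx_eigenfunction l g ->
  exists2 C : R, 0 <= C & forall M k, (0 < M)%N -> (k <= M)%N ->
    `|dot (sample f M k) (sample g M k) - dot (f 0) (g 0)| <= C / Num.sqrt M%:R.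
Proof.
move=> ef eg; have [C C0 hC] := dot_sample_drift ef eg.
exists C => // M k M0 kM.
have Mp : 0 < M%:R :> R by rewrite ltr0n.
suff h : `|dot (sample f M k) (sample g M k) - dot (f 0) (g 0)| <=
    k%:R * (C / Num.sqrt M%:R / M%:R).
  apply: le_trans h _; rewrite mulrA ler_pdivrMr// mulrC ler_wpM2l ?ler_nat//.
  by rewrite divr_ge0.
elim: k kM => [|k IH] kM; first by rewrite !sample_first subrr normr0 mul0r.
have := hC M k M0 kM; rewrite subrr mul0r mulr0 subr0 => h.
rewrite -natr1 mulrDl mul1r [leRHS]addrC.
apply: le_trans (ler_distD (dot (sample f M k) (sample g M k)) _ _) _.
by rewrite lerD// IH// ltnW.
Qed.

Definition mid f M (k : 'I_M) := midpoint f M k.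

Local Notation mdot M := (@mean_dot R H dot M).

Lemma mean_dot_le M (x y : 'I_M -> H) (a : R) : (0 < M)%N ->
  (forall k, `|dot (x k) (y k)| <= a) -> `|mdot M x y| <= a.
Proof.
move=> M0 h; have Mp : 0 < M%:R :> R by rewrite ltr0n.
rewrite normrM gtr0_norm ?invr_gt0// ler_pdivrMl//.
apply: le_trans (ler_norm_sum _ _ _) _.
apply: le_trans (ler_sum _ (fun k _ => h k)) _.
by rewrite sumr_const card_ord mulr_natl.
Qed.

(** At one level scalar products are constant in time, up to an error that vanishes
   with the mesh, so their mean tends to their initial value. *)
Lemma mean_gram_same_level l f g :
  approx_eigenfunction l f -> approx_eigenfunction l g ->
  exists2 C : R, 0 <= C & forall M, (0 < M)%N ->
    `|mdot M (mid f (M := M)) (mid g (M := M)) - dot (f 0) (g 0)| <= C / Num.sqrt M%:R.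
Proof.
move=> ef eg; have [C C0 hC] := gram_same_level ef eg.
have [Bf Bf0 hf] := approx_eigenfunction_bounded ef.
have [Bg Bg0 hg] := approx_eigenfunction_bounded eg.
exists (C + Bf + Bg) => [|M M0]; first by rewrite !addr_ge0.
have Mp : 0 < M%:R :> R by rewrite ltr0n.
have Mn : M%:R != 0 :> R by rewrite gt_eqF.
have -> : mdot M (mid f (M := M)) (mid g (M := M)) - dot (f 0) (g 0) =
    M%:R^-1 * \sum_(k < M) (dot (mid f k) (mid g k) - dot (f 0) (g 0)).
  rewrite big_split/= sumr_const card_ord mulrDr; congr (_ + _).
  by rewrite -[X in _ * X]mulr_natl mulrA mulVf// mul1r.
pose s := Num.sqrt M%:R : R.
have s1 : 1 <= s by rewrite -sqrtr1 ler_wsqrtr// ler1n.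
have s0 : 0 < s by rewrite (lt_le_trans ltr01).
have ss : M%:R = s * s by rewrite -expr2 sqr_sqrtr// ltW.
rewrite normrM gtr0_norm ?invr_gt0// ler_pdivrMl//.
apply: le_trans (ler_norm_sum _ _ _) _.
rewrite mulr_natl -[X in _ *+ X](card_ord M) -sumr_const; apply: ler_sum => k _.
have h0 := hC M k M0 (ltnW (ltn_ord k)); have h1 := hC M k.+1 M0 (ltn_ord k).
have [_ _ f1] := hf M k M0 (ltn_ord k); have [_ _ g1] := hg M k M0 (ltn_ord k).
have h2 := dot_amgm D (sample f M k.+1 - sample f M k)
  (sample g M k.+1 - sample g M k) ltr01.
have Ms (b : R) : 0 <= b -> b / M%:R <= b / s.
  by move=> b0; rewrite ler_wpM2l// lef_pV2 ?posrE// ss ler_peMr// ltW.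
have := Ms _ Bf0; have := Ms _ Bg0; move: h0 h1 h2 f1 g1; rewrite -/s divr1 mul1r.
have mE : dot (mid f k) (mid g k) =
   (dot (sample f M k) (sample g M k) + dot (sample f M k.+1) (sample g M k.+1)) / 2
   - dot (sample f M k.+1 - sample f M k) (sample g M k.+1 - sample g M k) / 4.
  rewrite /mid /midpoint (dotZr D) (dotZl D) !(dotDl D) !(dotBr D) !(dotNl D) !(dotDr D).
  by field.
rewrite mE !mulrDl; move: (dot (_ - _) (_ - _)) (dot (_ - _) (_ - _)) (dot (_ - _) (_ - _)).
move=> p q w; rewrite !ler_norml.
move: (C / s) (Bf / s) (Bg / s) (Bf / M%:R) (Bg / M%:R) => c bf bg bfM bgM.
move=> /andP[h1 h2] /andP[h3 h4] /andP[h5 h6] h7 h8 h9 h10.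
by apply/andP; split; lra.
Qed.

(** The increments of [dot f g] are proportional to the values of [dot (i f) g], with
   a nonzero factor at different levels, and by periodicity they add up to zero. *)
Lemma mean_gram_levels l l' f g : l != l' ->
  approx_eigenfunction l f -> approx_eigenfunction l' g ->
  exists2 C : R, 0 <= C & forall M, (0 < M)%N ->
    `|mdot M ('i%C *: mid f (M := M)) (mid g (M := M))| <= C / Num.sqrt M%:R.
Proof.
move=> ll ef eg; have [C C0 hC] := dot_sample_drift ef eg.
have pf : f tau = f 0 by case: ef.
have pg : g tau = g 0 by case: eg.
have ll0 : 0 < `|l - l'| by rewrite normr_gt0 subr_eq0.
exists (C / (tau * `|l - l'|)) => [|M M0].
  by rewrite divr_ge0// mulr_ge0// ltW.
have Mp : 0 < M%:R :> R by rewrite ltr0n.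
pose F k := dot (sample f M k) (sample g M k).
have tel : \sum_(k < M) (F k.+1 - F k) = 0.
  rewrite -(big_mkord xpredT (fun k => F k.+1 - F k)) telescope_sumr//.
  by rewrite /F !sample_last// !sample_first pf pg subrr.
have : `|\sum_(k < M) (F k.+1 - F k - tau / M%:R *
    ((l - l') * dot ('i%C *: midpoint f M k) (midpoint g M k)))| <= C / Num.sqrt M%:R.
  apply: le_trans (ler_norm_sum _ _ _) _.
  apply: (@le_trans _ _ (\sum_(k < M) (C / Num.sqrt M%:R / M%:R))).
    by apply: ler_sum => k _; apply: hC.
  by rewrite sumr_const card_ord -[leLHS]mulr_natr divfK// gt_eqF.
rewrite sumrB tel sub0r normrN -!mulr_sumr !normrM gtr0_norm// => h.
rewrite mulrAC ler_pdivlMr ?mulr_gt0//.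
by move: h; rewrite mulrACA [_ * _ * (_ * _)]mulrC.
Qed.

(** The norm is conserved in the limit of fine meshes: this allows linear
   independence to be checked at time zero. *)
Lemma approx_eigenfunction_initial0 l f t : approx_eigenfunction l f ->
  f 0 = 0 -> 0 <= t <= tau -> f t = 0.
Proof.
move=> ef f0 tI; have [C C0 hC] := gram_same_level ef ef.
have [_ [E hE] _] := ef.
apply: (dot_eq0 D); apply/eqP; rewrite eq_le (dot_ge0 D) andbT.
apply/ler_addgt0Pr => e e0; rewrite add0r.
pose b := 2 * (`|E| * tau) + 2 * C.
have b0 : 0 <= b by rewrite addr_ge0 ?mulr_ge0// ltW.
pose M := (Num.truncn ((b / e) ^+ 2)).+1.
have Mp : 0 < M%:R :> R by rewrite ltr0n.
pose s := Num.sqrt M%:R : R.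
have s1 : 1 <= s by rewrite -sqrtr1 ler_wsqrtr// ler1n.
have s0 : 0 < s by rewrite (lt_le_trans ltr01).
have ss : M%:R = s * s by rewrite -expr2 sqr_sqrtr// ltW.
have bs : b / s <= e.
  rewrite ler_pdivrMr// mulrC -ler_pdivrMr//.
  rewrite -(ler_sqr) ?nnegrE ?divr_ge0 ?(ltW e0) ?(ltW s0)// [leRHS]expr2 -ss.
  by rewrite ltW// Num.Theory.truncnS_gt.
pose k := Num.truncn (t / (tau / M%:R)).
have h0 : 0 < tau / M%:R by rewrite divr_gt0.
case/andP: (tI) => t0 tt.
have /andP[k1 k2] : k%:R <= t / (tau / M%:R) < k.+1%:R.
  by apply: Num.Theory.truncn_itv; rewrite divr_ge0// ltW.
have kM : (k <= M)%N.
  rewrite -(ler_nat R); apply: le_trans k1 _.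
  by rewrite ler_pdivrMr// mulrCA divff ?mulr1// gt_eqF.
have kI := @sample_in M k isT kM.
have tk : `|t - k%:R * (tau / M%:R)| <= tau / M%:R.
  move: k1 k2; rewrite ler_pdivlMr// ltr_pdivrMr// -natr1 mulrDl mul1r => k1 k2.
  by rewrite ger0_norm ?subr_ge0// lerBlDr addrC ltW.
apply: le_trans bs; rewrite -[f t](subrK (sample f M k)).
apply: le_trans (n2D_le D _ _) _; rewrite /b [leRHS]mulrDl.
have := hC M k isT kM; rewrite f0 (dot0l D) subr0 ger0_norm ?(dot_ge0 D)// => h1.
rewrite lerD// -mulrA ler_pM2l//.
apply: le_trans (hE _ _ tI kI) _.
apply: (@le_trans _ _ (`|E| * (tau / M%:R))).
  by apply: (@le_trans _ _ (`|E| * `|t - k%:R * (tau / M%:R)|));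
     rewrite ?ler_wpM2r ?ler_norm// ler_wpM2l.
by rewrite -mulrA ler_wpM2l// ler_wpM2l ?(ltW tau0)// lef_pV2 ?posrE// ss ler_peMr// ltW.
Qed.

End ApproximateEigenfunctions.

(** * Counting approximate eigenfunctions *)

(** A Gram matrix entrywise close to the identity defines almost the euclidean
   form on coefficients. *)
Lemma near_orthonormal (R : realType) (H : lmodType R[i]) (dot : H -> H -> R)
    (D : is_dot dot) (I : finType) (m : I -> H) (eps : R) :
  (forall i j, `|dot (m i) (m j) - (i == j)%:R| <= eps) ->
  (forall i j, `|dot ('i%C *: m i) (m j)| <= eps) ->
  forall d : I -> R[i],
  `|dot (\sum_i d i *: m i) (\sum_i d i *: m i) - \sum_i normc (d i) ^+ 2|
    <= 2 * eps * #|I|%:R * \sum_i normc (d i) ^+ 2.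
Proof.
move=> h1 h2 d.
have e1 : \sum_i normc (d i) ^+ 2 =
    \sum_i \sum_j complex.Re ((d j)^*%C * d i) * (i == j)%:R.
  apply: eq_bigr => i _; rewrite (bigD1 i)//= eqxx mulr1 big1 ?addr0 => [|j]; last first.
    by rewrite eq_sym => /negbTE ->; rewrite mulr0.
  by rewrite normc_sqr; case: (d i) => a b /=; ring.
have e2 : dot (\sum_i d i *: m i) (\sum_i d i *: m i) =
    \sum_i \sum_j dot (((d j)^*%C * d i) *: m i) (m j).
  rewrite (dot_suml D); apply: eq_bigr => i _; rewrite (dot_sumr D).
  by apply: eq_bigr => j _; rewrite -scalerA (dotZ_adj D _^*%C) conjcK.
rewrite [X in X - _]e2 [X in _ - X]e1 -sumrB.
have eps0 : 0 <= eps \/ #|I| = 0%N.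
  case: (pickP I) => [i _|I0]; last by right; rewrite (eq_card I0) card0.
  by left; apply: le_trans (h1 i i).
have [eps0'|I0] := eps0; last first.
  rewrite big1 ?normr0 ?I0 ?mulr0 ?mul0r// => i _.
  by move/card0_eq: I0 => /(_ i).
apply: le_trans (ler_norm_sum _ _ _) _.
apply: (@le_trans _ _ (\sum_(i : I) \sum_(j : I) eps * (normc (d i) ^+ 2 + normc (d j) ^+ 2))).
  apply: ler_sum => i _; rewrite -sumrB; apply: le_trans (ler_norm_sum _ _ _) _.
  apply: ler_sum => j _; rewrite (dotZRe D) addrAC -mulrBr.
  apply: le_trans (ler_normD _ _) _; rewrite !normrM.
  have ReIm : `|complex.Re ((d j)^*%C * d i)| + `|complex.Im ((d j)^*%C * d i)| <=
      normc (d i) ^+ 2 + normc (d j) ^+ 2.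
    rewrite !normc_sqr; case: (d i) (d j) => a b [a' b'] /=.
    move: (sqr_ge0 (a - a')) (sqr_ge0 (a + a')) (sqr_ge0 (b - b')) (sqr_ge0 (b + b')).
    move: (sqr_ge0 (a - b')) (sqr_ge0 (a + b')) (sqr_ge0 (b - a')) (sqr_ge0 (b + a')).
    by move=> *; do 2 (case: ler0P => _); nra.
  have := ler_wpM2l (normr_ge0 (complex.Re ((d j)^*%C * d i))) (h1 i j).
  have := ler_wpM2l (normr_ge0 (complex.Im ((d j)^*%C * d i))) (h2 i j).
  have := ler_wpM2l eps0' ReIm; lra.
under eq_bigr do rewrite -mulr_sumr big_split/= sumr_const.
rewrite -mulr_sumr big_split/= sumr_const sumrMnl.
rewrite -[#|xpredT|]/#|I| -mulr2n -mulrnA -[X in eps * X]mulr_natr natrM; lra.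
Qed.

(** The final contradiction.  [S] is the square norm of the coefficients, [a] that
   of the combination [m], [XX] that of the combination with coefficients
   multiplied by [l_i - c], and [XJ], [eJ] are the products of the latter and of the
   error, of square norm [e2], with [J m]. *)
Lemma index_arith (R : realType) (S eps r eta a XX Y XJ e2 eJ : R) :
  0 < S -> 0 < eps -> eps < 1 -> 0 <= r -> 0 < eta -> eps * (2 * r + eta + 4) <= eta ->
  `|a - S| <= eps * S -> `|XX - Y| <= eps * Y -> Y <= r ^+ 2 * S ->
  XJ <= Num.sqrt XX * Num.sqrt a -> e2 <= eps ^+ 2 * S ->
  eJ <= eps^-1 * e2 + a / eps^-1 -> (r + eta) * a <= XJ + eJ -> False.
Proof.
move=> S0 eps0 eps1 r0 eta0 epseta; rewrite !ler_norml => /andP[a1 a2] /andP[_ X2] YS.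
move=> hX he heJ fin.
have e1p : 0 < 1 + eps by lra.
have a3 : a <= (1 + eps) * S by lra.
have X3 : XX <= (1 + eps) * (r ^+ 2 * S).
  by have := ler_wpM2l (ltW e1p) YS; lra.
have J1 : XJ <= (1 + eps) * r * S.
  apply: le_trans hX _; apply: (@le_trans _ _
    (Num.sqrt ((1 + eps) * (r ^+ 2 * S)) * Num.sqrt ((1 + eps) * S))).
    by apply: ler_pM; rewrite ?sqrtr_ge0//; apply: ler_wsqrtr.
  rewrite -sqrtrM; last by rewrite mulr_ge0 ?(ltW e1p)// mulr_ge0 ?sqr_ge0// ltW.
  rewrite (_ : _ * (r ^+ 2 * S) * _ = ((1 + eps) * r * S) ^+ 2); last by ring.
  by rewrite sqrtr_sqr ger0_norm// mulr_ge0 ?(ltW S0)// mulr_ge0// ltW.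
have J2 : eJ <= eps * S + eps * ((1 + eps) * S).
  apply: le_trans heJ _; rewrite invrK lerD//.
    by rewrite ler_pdivrMl// mulrA -expr2.
  by rewrite mulrC ler_pM2l.
have : (r + eta) * ((1 - eps) * S) <= ((1 + eps) * r + eps + eps * (1 + eps)) * S.
  have : (r + eta) * ((1 - eps) * S) <= (r + eta) * a.
    by rewrite ler_wpM2l ?addr_ge0 ?(ltW eta0)//; lra.
  by lra.
by rewrite mulrA ler_pM2r//; nra.
Qed.

Lemma far_indexK (M n : nat) : (n < M)%N -> n = (M - (M - n).-1.+1)%N.
Proof. lia. Qed.

Lemma low_index_lt (K M k : nat) (b : bool) : (K.*2 < M)%N -> (k < K)%N ->
  ((if b then k else M - k.+1) < M)%N.
Proof. by case: b; lia. Qed.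

Section IndexBound.
Variables (R : realType) (H : lmodType R[i]) (dot : H -> H -> R).
Hypothesis D : is_dot dot.
Variables (tau : R) (A : H -> H) (V : nat -> nat -> H -> H) (Qa Qb : H -> H).
Hypothesis tau0 : 0 < tau.
Hypothesis linA : linear A.
Hypothesis symA : selfadjoint dot A.
Hypothesis linV : forall M k, linear (V M k).
Hypothesis symV : forall M k, selfadjoint dot (V M k).
Hypothesis linQa : linear Qa.
Hypothesis linQb : linear Qb.
Hypothesis VQa : forall M k x, - dot (Qa x) x <= dot (V M k x) x.
Hypothesis VQb : forall M k x, dot (V M k x) x <= dot (Qb x) x.

Let T M k x := A x + V M k x.
Local Notation om := (2 * pi / tau).
Local Notation ae := (approx_eigenfunction dot tau T).
Local Notation mdot M := (@mean_dot R H dot M).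

Let linT M k : linear (T M k).
Proof. by move=> a x y; rewrite /T linA linV scalerDr addrACA. Qed.

Let symT M k : selfadjoint dot (T M k).
Proof. by move=> x y; rewrite /T (dotDl D) (dotDr D) symA symV. Qed.

Lemma approx_eigenfunction0 l : ae l (fun=> 0).
Proof.
have z : forall M k, defect tau T l (fun=> 0) M k = 0.
  move=> M k; rewrite /defect /time_difference /midpoint /sample.
  by rewrite subrr addr0 !scaler0 (lin0 (@linT M k)) addr0 subrr.
split=> //; first by exists 0 => *; rewrite subrr (dot0l D) mul0r.
by exists 0 => *; rewrite z (dot0l D) mul0r.
Qed.

Lemma approx_eigenfunction_scale l a f : ae l f -> ae l (fun t => a *: f t).
Proof.
move=> aef; rewrite (_ : (fun t => _) = fun t => a *: f t + (fun=> 0) t).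
  exact: (approx_eigenfunction_lin D linT a aef (approx_eigenfunction0 l)).
by apply/funext => t; rewrite addr0.
Qed.

Lemma approx_eigenfunction_sum l (I : Type) (s : seq I) (c : I -> R[i]) (F : I -> R -> H) :
  (forall i, ae l (F i)) -> ae l (fun t => \sum_(i <- s) c i *: F i t).
Proof.
move=> aeF; elim: s => [|i s IH].
  rewrite (_ : (fun t => _) = fun=> 0); first exact: approx_eigenfunction0.
  by apply/funext => t; rewrite big_nil.
rewrite (_ : (fun t => _) = fun t => c i *: F i t + \sum_(i <- s) c i *: F i t).
  exact: (approx_eigenfunction_lin D linT (c i) (aeF i) IH).
by apply/funext => t; rewrite big_cons.
Qed.

(** Gram-Schmidt at time zero, each new vector being found by a dimension count. *)
Lemma orthonormal_initial l n (F : 'I_n -> R -> H) : (forall i, ae l (F i)) ->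
  (forall c : 'I_n -> R[i], \sum_i c i *: F i 0 = 0 -> forall i, c i = 0) ->
  exists G : nat -> R -> H, (forall i, (i < n)%N -> ae l (G i)) /\
    forall i j, (i < n)%N -> (j < n)%N -> cip dot (G i 0) (G j 0) = (i == j)%:R.
Proof.
move=> aeF indep.
suff : forall k, (k <= n)%N -> exists G : nat -> R -> H,
    (forall i, (i < k)%N -> ae l (G i)) /\
    forall i j, (i < k)%N -> (j < k)%N -> cip dot (G i 0) (G j 0) = (i == j)%:R.
  by move=> /(_ n (leqnn n)).
elim=> [_|k IH kn]; first by exists (fun _ _ => 0).
have [G [aeG orthG]] := IH (ltnW kn).
have [|c c0 cG] := @underdetermined_kernel R[i] 'I_n 'I_k
  (fun i j => cip dot (F i 0) (G j 0)); first by rewrite !card_ord.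
pose f t := \sum_i c i *: F i t.
have f0 : 0 < dot (f 0) (f 0).
  rewrite lt_neqAle (dot_ge0 D) andbT eq_sym; apply/eqP => /(dot_eq0 D)/indep c00.
  by case: c0 => i; rewrite c00 eqxx.
pose w t := ((Num.sqrt (dot (f 0) (f 0)))^-1)%:C *: f t.
have ww : cip dot (w 0) (w 0) = 1.
  rewrite (cip_self D) (n2Z D) normc_sqr /= expr0n addr0 exprVn sqr_sqrtr ?ltW//.
  by rewrite mulVf ?gt_eqF.
have wG i : (i < k)%N -> cip dot (w 0) (G i 0) = 0.
  move=> ik; rewrite (cipZl D) (cip_suml D).
  under eq_bigr do rewrite (cipZl D).
  by rewrite (cG (Ordinal ik)) mulr0.
exists (fun i => if i == k then w else G i); split=> [i|i j].
  rewrite ltnS leq_eqVlt; case: eqVneq => [_ _|_ /aeG//].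
  exact: (approx_eigenfunction_scale _ (approx_eigenfunction_sum (index_enum _) c aeF)).
rewrite !ltnS (leq_eqVlt i) (leq_eqVlt j).
have [-> _|/= ni ilt] := eqVneq i k; have [-> _|/= nj jlt] := eqVneq j k.
- exact: ww.
- exact: wG.
- by rewrite (cip_eq0C D (wG i ilt)) (negbTE ni).
- exact: orthG.
Qed.

Lemma node_near (M n : nat) : (n.*2 < M)%N -> 0 <= (pi / M%:R * n%:R : R) < pi / 2.
Proof.
move=> nM; have Mp : 0 < M%:R :> R by rewrite ltr0n (leq_ltn_trans _ nM).
rewrite mulr_ge0 ?divr_ge0 ?pi_ge0//= mulrAC ltr_pdivrMr// mulrAC ltr_pdivlMr//.
by rewrite -mulrA ltr_pM2l ?pi_gt0// -natrM muln2 ltr_nat.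
Qed.

Lemma node_far (M n : nat) : (n < M)%N ->
  pi / M%:R * n%:R = pi - pi / M%:R * (M - n)%:R :> R.
Proof.
move=> nM; have Mp : M%:R != 0 :> R by rewrite pnatr_eq0 -lt0n (leq_ltn_trans _ nM).
by rewrite natrB ?(ltnW nM)//; field.
Qed.

Lemma far_half (M n : nat) : (n < M)%N -> (M < n.*2)%N -> ((M - n).*2 < M)%N.
Proof. lia. Qed.

Lemma cos_piB (y : R) : cos (pi - y) = - cos y.
Proof. by rewrite cosB cospi sinpi mulN1r mul0r addr0. Qed.

Lemma sin_piB (y : R) : sin (pi - y) = sin y.
Proof. by rewrite sinB cospi sinpi mul0r mulN1r opprK add0r. Qed.

Lemma cos_node_gt0 (M n : nat) : (n.*2 < M)%N -> 0 < cos (pi / M%:R * n%:R) :> R.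
Proof.
move=> /node_near/andP[x0 x1]; apply: cos_gt0_pihalf; rewrite x1 andbT.
by rewrite (lt_le_trans _ x0)// oppr_lt0 divr_gt0// pi_gt0.
Qed.

Lemma odd_ltngt (M n : nat) : odd M -> (n.*2 < M)%N \/ (M < n.*2)%N.
Proof.
move=> oddM; have [h|h|h] := ltngtP n.*2 M; [by left|by right|].
by rewrite -h odd_double in oddM.
Qed.

(** [M] is odd so that the frequency [M / 2], where the symbol is infinite, does not
   occur. *)
Lemma cos_node_neq0 (M : nat) (n : 'I_M) : odd M -> cos (pi / M%:R * n%:R) != 0 :> R.
Proof.
move=> oddM; have [h|h] := odd_ltngt n oddM; first by rewrite gt_eqF// cos_node_gt0.
rewrite (node_far (ltn_ord n)) cos_piB oppr_eq0 gt_eqF// cos_node_gt0//; exact: far_half.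
Qed.

(** Frequencies are numbered from [0] to [M - 1]; the upper half stands for the
   negative ones, where the tangent is negative. *)
Definition time_symbol (M n : nat) : R :=
  2 * M%:R / tau * (sin (pi / M%:R * n%:R) / cos (pi / M%:R * n%:R)).

Lemma time_symbol_near (M n : nat) : (n.*2 < M)%N -> om * n%:R <= time_symbol M n.
Proof.
move=> nM; have Mp : 0 < M%:R :> R by rewrite ltr0n (leq_ltn_trans _ nM).
have := tan_ge_id (node_near nM) => h.
have h' : 0 < 2 * M%:R / tau by rewrite divr_gt0// mulr_gt0.
rewrite /time_symbol (_ : om * _ = 2 * M%:R / tau * (pi / M%:R * n%:R)).
  by rewrite ler_pM2l.
by field; rewrite !gt_eqF.
Qed.

Lemma time_symbol_far (M n : nat) : (n < M)%N -> (M < n.*2)%N ->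
  om * (M - n)%:R <= - time_symbol M n.
Proof.
move=> nM Mn; have := time_symbol_near (far_half nM Mn).
by rewrite /time_symbol (node_far nM) sin_piB cos_piB invrN !mulrN opprK.
Qed.

(** The symbol is computed against the transform of the midpoints, not of the
   samples, because the defect of an eigenfunction is expressed by midpoints. *)
Lemma time_difference_dft (f : R -> H) (M : nat) (k : 'I_M) : odd M -> f tau = f 0 ->
  time_difference tau f M k = synth (fun n : 'I_M =>
    (time_symbol M n)%:C *: dft (midpoint tau f M) n) k.
Proof.
move=> oddM pf; have M0 : (0 < M)%N by case: M oddM {k}.
have Mp : 0 < M%:R :> R by rewrite ltr0n.
pose F := dft (M := M) (sample tau f M).
pose z (n : 'I_M) : R[i] := expi (2 * pi / M%:R * n%:R).
have sE (j : nat) : (j <= M)%N -> sample tau f M j = synth F j.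
  rewrite leq_eqVlt => /predU1P[->|jM]; last first.
    by have := dftK M0 (sample tau f M) (Ordinal jM).
  rewrite sample_last// pf -(sample_first tau f M).
  have := dftK M0 (sample tau f M) (Ordinal M0) => <- /=.
  by apply: eq_bigr => n _; rewrite chi_0 chi_M.
have sE1 (j : 'I_M) : sample tau f M j.+1 = synth (fun n => z n *: F n) j.
  rewrite sE; last exact: ltn_ord.
  by apply: eq_bigr => n _; rewrite chiS scalerA mulrC.
have sE0 (j : 'I_M) : sample tau f M j = synth F j by rewrite sE// ltnW// ltn_ord.
have mE (j : 'I_M) : midpoint tau f M j =
    synth (fun n => ((2^-1 : R)%:C * (z n + 1)) *: F n) j.
  rewrite /midpoint sE0 sE1 synthD /synth scaler_sumr; apply: eq_bigr => n _.
  rewrite (_ : F n + z n *: F n = (z n + 1) *: F n); last by rewrite scalerDl scale1r addrC.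
  by rewrite !scalerA mulrCA mulrA.
have -> : dft (M := M) (midpoint tau f M) = fun n => ((2^-1 : R)%:C * (z n + 1)) *: F n.
  rewrite -[RHS](synthK M0); apply/funext => n; rewrite /dft; congr (_ *: _).
  by apply: eq_bigr => j _; rewrite mE.
rewrite /time_difference sE0 sE1 synthB /synth !scaler_sumr; apply: eq_bigr => n _.
rewrite /time_symbol; set x : R := pi / M%:R * n%:R; set t := sin x / cos x.
have zE : z n - 1 = 'i%C * t%:C * (z n + 1).
  have -> : z n = expi (x *+ 2) by congr expi; rewrite /x mulr2n; ring.
  exact/expi_cayley/cos_node_neq0.
rewrite (_ : z n *: F n - F n = (z n - 1) *: F n); last by rewrite scalerBl scale1r.
rewrite zE; move: (F n) (z n) (chi _ _ _ _) => v w a.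
rewrite !scalerA; congr (_ *: v).
rewrite (_ : (2 * M%:R / tau * t)%:C = 2 * ((M%:R / tau)%:C * t%:C)); last first.
  by rewrite -(rmorph_nat (real_complex R) 2) -!rmorphM/=; congr (_%:C); ring.
rewrite (_ : (2^-1)%:C = 2^-1); last by rewrite fmorphV/= rmorph_nat.
have ii : - 'i%C * 'i%C = 1 :> R[i] by rewrite mulNr -expr2 sqr_i opprK.
transitivity ((- 'i%C * 'i%C) * ((M%:R / tau)%:C * a * (t%:C * (w + 1)))); first ring.
rewrite ii; field.
by rewrite fmorph_eq0 gt_eqF.
Qed.

Variables (c r eta : R) (K N0 : nat) (e : nat -> H).
Hypothesis eta0 : 0 < eta.
Hypothesis near_bound : forall n x,
  ((n < K)%N -> forall i, (i < N0)%N -> cip dot x (e i) = 0) ->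
  (c + r + eta) * dot x x <= om * n%:R * dot x x + dot (A x) x - dot (Qa x) x.
Hypothesis far_bound : forall n x,
  ((n < K)%N -> forall i, (i < N0)%N -> cip dot x (e i) = 0) ->
  (- c + r + eta) * dot x x <= om * n.+1%:R * dot x x - dot (A x) x - dot (Qb x) x.

(** The discrete equation is tested against [J m], where [J] changes the sign of the
   negative frequencies: the cross terms of the potential between the two frequency
   ranges cancel, and the one-sided bounds suffice. *)
Lemma sign_form_bound (M : nat) (f : R -> H) : odd M -> f tau = f 0 ->
  let m := mid tau f (M := M) in
  let cf := dft (M := M) (midpoint tau f M) in
  let J (k : 'I_M) := synth (fun n : 'I_M => if (n.*2 < M)%N then cf n else - cf n) k in
  (forall n : 'I_M, ((if (n.*2 < M)%N then n : nat else (M - n).-1) < K)%N ->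
    forall i, (i < N0)%N -> cip dot (cf n) (e i) = 0) ->
  c * mdot M m J + (r + eta) * mdot M m m <=
  mdot M (fun k => time_difference tau f M k + T M k (midpoint tau f M k)) J.
Proof.
move=> oddM pf m cf J orth.
have M0 : (0 < M)%N by case: M oddM {m cf J orth}.
have Mi : 0 < M%:R^-1 :> R by rewrite invr_gt0 ltr0n.
pose near (n : 'I_M) := (n.*2 < M)%N.
pose s (n : 'I_M) : H := if near n then cf n else - cf n.
pose a (n : 'I_M) : H := if near n then cf n else 0.
pose b (n : 'I_M) : H := if near n then 0 else cf n.
have mE (k : 'I_M) : midpoint tau f M k = synth cf k by rewrite dftK.
have mab (k : 'I_M) : midpoint tau f M k = synth a k + synth b k.
  rewrite mE synthD; congr (synth _ _); apply/funext => n; rewrite /a /b.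
  by case: ifP; rewrite ?addr0 ?add0r.
have Jab (k : 'I_M) : J k = synth a k - synth b k.
  rewrite /J synthB; congr (synth _ _); apply/funext => n; rewrite /a /b /near.
  by case: ifP; rewrite ?subr0 ?sub0r.
have mmE : mdot M m m = \sum_n dot (cf n) (cf n).
  rewrite -(synth_parseval M0 D); congr (_ * _).
  by apply: eq_bigr => k _; rewrite /m /mid mE.
have mJE : mdot M m J = \sum_n dot (cf n) (s n).
  rewrite -(synth_parseval M0 D); congr (_ * _).
  by apply: eq_bigr => k _; rewrite /m /mid mE.
have tE : mdot M (fun k => time_difference tau f M k) J =
    \sum_(n < M) time_symbol M n * dot (cf n) (s n).
  transitivity (\sum_(n < M) dot ((time_symbol M n)%:C *: cf n) (s n)).
    rewrite -(synth_parseval M0 D); congr (_ * _).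
    by apply: eq_bigr => k _; rewrite time_difference_dft.
  by apply: eq_bigr => n _; rewrite (dotZl D).
have AE : mdot M (fun k => A (midpoint tau f M k)) J = \sum_n dot (A (cf n)) (s n).
  rewrite -(synth_parseval M0 D); congr (_ * _).
  by apply: eq_bigr => k _; rewrite mE (synth_lin _ _ linA).
have VE : - (\sum_n dot (Qa (a n)) (a n)) - (\sum_n dot (Qb (b n)) (b n)) <=
    mdot M (fun k => V M k (midpoint tau f M k)) J.
  rewrite -(synth_parseval M0 D (Qa \o a)) -(synth_parseval M0 D (Qb \o b)).
  rewrite -!mulrN -mulrDr ler_pM2l// -!sumrN -big_split; apply: ler_sum => k _ /=.
  rewrite mab Jab -!(synth_lin _ _ linQa) -!(synth_lin _ _ linQb).
  move: (synth a k) (synth b k) => x y.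
  have sxy : dot (V M k x) y = dot (V M k y) x by rewrite symV (dotC D).
  rewrite (linD (@linV M k)) (dotDl D) !(dotBr D) sxy.
  by have := VQa M k x; have := VQb M k y; lra.
have -> : mdot M (fun k => time_difference tau f M k + T M k (midpoint tau f M k)) J =
   mdot M (fun k => time_difference tau f M k) J
   + mdot M (fun k => A (midpoint tau f M k)) J
   + mdot M (fun k => V M k (midpoint tau f M k)) J.
  rewrite /mean_dot -!mulrDr -!big_split/=; congr (_ * _); apply: eq_bigr => k _.
  by rewrite /T !(dotDl D) addrA.
apply: le_trans (lerD (lexx _) VE); rewrite tE AE mJE mmE.
rewrite !mulr_sumr -!sumrN -!big_split/=; apply: ler_sum => n _.
have := orth n; rewrite /s /a /b /near; case: ifPn => [nM|nM] on.
  have := near_bound on; rewrite (lin0 linQb) (dot0l D).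
  have := time_symbol_near nM => h.
  have := ler_wpM2r (dot_ge0 D (cf n)) h; lra.
have nM' : (M < n.*2)%N by have [h|] := odd_ltngt n oddM; rewrite ?h// in nM.
have := far_bound on; rewrite (lin0 linQa) (dot0l D) !(dotNr D).
rewrite prednK ?subn_gt0//.
have := time_symbol_far (ltn_ord n) nM' => h.
have := ler_wpM2r (dot_ge0 D (cf n)) h; lra.
Qed.

Lemma midpoint_sum (I : finType) (d : I -> R[i]) (f : I -> R -> H) M k :
  midpoint tau (fun t => \sum_i d i *: f i t) M k = \sum_i d i *: midpoint tau (f i) M k.
Proof.
rewrite /midpoint /sample -big_split scaler_sumr; apply: eq_bigr => i _ /=.
by rewrite -scalerDr !scalerA mulrC.
Qed.

Lemma time_difference_sum (I : finType) (d : I -> R[i]) (f : I -> R -> H) M k :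
  time_difference tau (fun t => \sum_i d i *: f i t) M k =
  \sum_i d i *: time_difference tau (f i) M k.
Proof.
rewrite /time_difference /sample -sumrB !scaler_sumr; apply: eq_bigr => i _ /=.
rewrite -scalerBr; move: (f i _ - _) => v; rewrite !scalerA; congr (_ *: v).
by rewrite [LHS]mulrC mulrA.
Qed.

Lemma dft_sum (I : finType) (d : I -> R[i]) (M : nat) (g : I -> nat -> H) (n : 'I_M) :
  dft (fun k => \sum_i d i *: g i k) n = \sum_i d i *: dft (g i) n.
Proof.
rewrite /dft; under eq_bigr do rewrite scaler_sumr.
rewrite exchange_big scaler_sumr; apply: eq_bigr => i _.
under eq_bigr do rewrite scalerA mulrC -scalerA.
by rewrite -scaler_sumr !scalerA mulrC.
Qed.

(** Levels are replaced by their common centre [c'], at the price of a combination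
   with coefficients [a (l' - c')]. *)
Lemma shift_level (a : R[i]) (l' c' : R) (t u v : H) :
  a *: t + a *: u =
  c'%:C *: (a *: v) + ((a * (l' - c')%:C) *: v + a *: (t + u - l'%:C *: v)).
Proof.
rewrite scalerBr scalerDr !scalerA (mulrC c'%:C) rmorphB/= mulrBr scalerBl.
move: (a *: t + a *: u) ((a * c'%:C) *: v) ((a * l'%:C) *: v) => Y P L.
by rewrite addrA (addrCA P) subrr addr0 addrC subrK.
Qed.

(** Here the mesh is fixed and fine enough for the given [eps]; a combination that
   meets the [2 K N0] orthogonality conditions exists by the dimension count. *)
Lemma index_bound_step (I : finType) (l : I -> R) (f : I -> R -> H) (M : nat) :
  odd M -> (K.*2 < M)%N -> ((K * N0).*2 < #|I|)%N ->
  (forall i, `|l i - c| <= r) -> (forall i, f i tau = f i 0) ->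
  forall eps : R, 0 < eps -> eps < 1 -> eps * (2 * r + eta + 4) <= eta -> 
  (forall i j, `|mdot M (mid tau (f i) (M := M)) (mid tau (f j) (M := M)) - (i == j)%:R|
     <= eps / (2 * #|I|%:R)) ->
  (forall i j, `|mdot M ('i%C *: mid tau (f i) (M := M)) (mid tau (f j) (M := M))|
     <= eps / (2 * #|I|%:R)) ->
  (forall i (k : 'I_M), dot (defect tau T (l i) (f i) M k) (defect tau T (l i) (f i) M k)
     <= eps ^+ 2 / #|I|%:R) -> False.
Proof.
move=> oddM KM cardI lr pf eps eps0 eps1 epseta h1 h2 h3.
have M0 : (0 < M)%N by case: M oddM {KM h1 h2 h3}.
have DM := mean_dot_is_dot D M0.
have I0 : (0 < #|I|)%N by rewrite (leq_trans _ cardI).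
have Ip : 0 < #|I|%:R :> R by rewrite ltr0n.
(* Frequency [k], or [- (k + 1)] numbered as [M - (k + 1)]. *)
pose idx (b : bool) (k : nat) : nat := if b then k else (M - k.+1)%N.
have idxM b (k : 'I_K) : (idx b k < M)%N.
  exact: low_index_lt KM (ltn_ord k).
pose ix b k : 'I_M := Ordinal (idxM b k).
have [|d [i0 di0] dorth] := @underdetermined_kernel R[i] I (bool * ('I_K * 'I_N0))%type
  (fun i x => cip dot (dft (midpoint tau (f i) M) (ix x.1 x.2.1)) (e x.2.2)).
  by rewrite !card_prod card_bool !card_ord mul2n.
pose F t := \sum_i d i *: f i t.
pose m i := mid tau (f i) (M := M).
pose de i (k : 'I_M) := defect tau T (l i) (f i) M k.
pose S := \sum_i normc (d i) ^+ 2.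
have S0 : 0 < S.
  rewrite lt_neqAle sumr_ge0 ?andbT => [|i _]; last exact: sqr_ge0.
  rewrite eq_sym psumr_eq0 => [|i _]; last exact: sqr_ge0.
  apply/negP => /allP/(_ i0 (mem_index_enum _)) /=; rewrite sqrf_eq0 => /eqP.
  by move=> /ComplexField.Normc.eq0_normc/eqP; rewrite (negbTE di0).
have r0 : 0 <= r by rewrite (le_trans _ (lr i0)).
have pF : F tau = F 0 by rewrite /F; apply: eq_bigr => i _; rewrite pf.
have mFE : mid tau F (M := M) = \sum_i d i *: m i.
  by apply/funext => k; rewrite fct_sumE /mid midpoint_sum.
have no := near_orthonormal DM h1 h2.
have I2 : 2 * (eps / (2 * #|I|%:R)) * #|I|%:R = eps.
  by field; rewrite !gt_eqF.
rewrite I2 in no.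
pose cf := dft (M := M) (midpoint tau F M).
pose J (k : 'I_M) := synth (fun n : 'I_M => if (n.*2 < M)%N then cf n else - cf n) k.
have main := sign_form_bound oddM pF.
rewrite /= -/cf -/J mFE in main.
have cfE n : cf n = \sum_i d i *: dft (M := M) (midpoint tau (f i) M) n.
  by rewrite -dft_sum /cf; congr dft; apply/funext => k; rewrite midpoint_sum.
have JJ : mdot M J J = mdot M (\sum_i d i *: m i) (\sum_i d i *: m i).
  transitivity (\sum_(n < M) dot (cf n) (cf n)).
    rewrite /mean_dot (synth_parseval M0 D); apply: eq_bigr => n _.
    by case: ifP; rewrite ?(dotNl D) ?(dotNr D) ?opprK.
  rewrite -mFE -(synth_parseval M0 D); congr (_ * _); apply: eq_bigr => k _.
  by rewrite /mid /cf dftK.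
pose X := \sum_i (d i * (l i - c)%:C) *: m i.
pose er := \sum_i d i *: de i.
pose mm := \sum_i d i *: m i.
have hE : (fun k : 'I_M => time_difference tau F M k + T M k (midpoint tau F M k)) =
    c%:C *: mm + (X + er).
  rewrite /mm /X /er scaler_sumr -!big_split/=; apply/funext => k; rewrite fct_sumE.
  rewrite time_difference_sum midpoint_sum (lin_sum (@linT M k)) -big_split.
  apply: eq_bigr => i _ /=; rewrite (linZ (@linT M k)) /de /m /mid !fctE /defect.
  exact: shift_level.
rewrite hE (dotDl DM) (dotZl DM) (dotDl DM) in main.
have bm := no d; have bX := no (fun i => d i * (l i - c)%:C).
have XS : \sum_i normc (d i * (l i - c)%:C) ^+ 2 <= r ^+ 2 * S.
  rewrite mulr_sumr; apply: ler_sum => i _.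
  rewrite ComplexField.Normc.normcM exprMn mulrC ler_wpM2r ?sqr_ge0//.
  rewrite [leLHS]normc_sqr /= expr0n addr0 -real_normK ?num_real//.
  by rewrite ler_sqr ?nnegrE ?lr.
have erS : mdot M er er <= eps ^+ 2 * S.
  apply: le_trans (n2_sum_le DM _) _; rewrite mulrC -ler_pdivlMr//.
  rewrite mulrAC mulr_sumr; apply: ler_sum => i _; rewrite (n2Z DM).
  rewrite mulrC ler_wpM2r ?sqr_ge0//; apply: le_trans (ler_norm _) _.
  apply: (mean_dot_le M0) => k; rewrite ger0_norm ?(dot_ge0 D)//; exact: h3.
have : c * mdot M mm J + (r + eta) * mdot M mm mm <=
    c * mdot M mm J + (mdot M X J + mdot M er J).
  apply: main => n; have nM := ltn_ord n.
  pose b := (n.*2 < M)%N; pose k := if b then n : nat else (M - n).-1.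
  move=> kK i iN; rewrite cfE (cip_suml D).
  have := dorth (b, (Ordinal kK, Ordinal iN)) => /= h.
  under eq_bigr do rewrite (cipZl D); rewrite -[RHS]h.
  apply: eq_bigr => j _; congr (_ * cip dot (dft _ _) _); apply: val_inj => /=.
  by rewrite -/b /idx; case: (b) => //; exact: far_indexK nM.
rewrite lerD2l => fin.
have e1 : 0 < eps^-1 by rewrite invr_gt0.
have J1 := le_trans (ler_norm _) (dot_norm DM X J).
have J2 := le_trans (ler_norm _) (dot_amgm DM er J e1).
rewrite JJ in J1 J2.
exact: (index_arith S0 eps0 eps1 r0 eta0 epseta bm bX XS J1 erS J2 fin).
Qed.

(** Both components of the hermitian product are covered: replacing [f] by [i f]
   exchanges them. *)
Lemma gram_limit (l l' : R) (f g : R -> H) (delta : R) : ae l f -> ae l' g ->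
  (l = l' -> cip dot (f 0) (g 0) = delta%:C) -> (l != l' -> delta = 0) ->
  exists2 C : R, 0 <= C & forall M, (0 < M)%N ->
  `|mdot M (mid tau f (M := M)) (mid tau g (M := M)) - delta| <= C / Num.sqrt M%:R /\
  `|mdot M ('i%C *: mid tau f (M := M)) (mid tau g (M := M))| <= C / Num.sqrt M%:R.
Proof.
move=> aef aeg same diff.
have midZ a M : mid tau (fun t => a *: f t) (M := M) = a *: mid tau f (M := M).
  apply/funext => k; rewrite /mid /midpoint /sample !fctE -scalerDr.
  by move: (f _ + f _) => v; rewrite !scalerA mulrC.
have aefi := approx_eigenfunction_scale 'i%C aef.
have aefi' := approx_eigenfunction_scale (- 'i%C) aef.
have ii : 'i%C * - 'i%C = 1 :> R[i] by rewrite mulrN -expr2 sqr_i opprK.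
have [ll|ll] := eqVneq l l'.
  have aeg' : ae l g by rewrite ll.
  have [C1 C10 h1] := mean_gram_same_level D tau0 linT symT aef aeg'.
  have [C2 C20 h2] := mean_gram_same_level D tau0 linT symT aefi aeg'.
  have := same ll; rewrite /cip => -[d1 d2].
  exists (C1 + C2) => [|M M0]; first by rewrite addr_ge0.
  have := h1 M M0; have := h2 M M0; rewrite midZ d1 (dotI D) d2 oppr0 subr0 mulrDl.
  have s0 : 0 <= (Num.sqrt M%:R)^-1 :> R by rewrite invr_ge0 sqrtr_ge0.
  have := mulr_ge0 C10 s0; have := mulr_ge0 C20 s0.
  by move=> p1 p2 q1 q2; split; [apply: le_trans q2 _|apply: le_trans q1 _]; lra.
have [C1 C10 h1] := mean_gram_levels D tau0 linT symT ll aef aeg.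
have [C2 C20 h2] := mean_gram_levels D tau0 linT symT ll aefi' aeg.
exists (C1 + C2) => [|M M0]; first by rewrite addr_ge0.
have := h1 M M0; have := h2 M M0; rewrite midZ scalerA ii scale1r (diff ll) subr0 mulrDl.
have s0 : 0 <= (Num.sqrt M%:R)^-1 :> R by rewrite invr_ge0 sqrtr_ge0.
have := mulr_ge0 C10 s0; have := mulr_ge0 C20 s0.
by move=> p1 p2 q1 q2; split; [apply: le_trans q1 _|apply: le_trans q2 _]; lra.
Qed.

Lemma fine_mesh (C E d1 d2 : R) (K' : nat) : 0 < d1 -> 0 < d2 -> 0 <= C ->
  exists M, [/\ odd M, (K' < M)%N, C / Num.sqrt M%:R <= d1 & E / M%:R <= d2].
Proof.
move=> d10 d20 C0.
pose a := Num.truncn ((C / d1) ^+ 2); pose b := Num.truncn (E / d2).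
exists (a + b + K').*2.+1; set M := (_).+1.
have Mp : 0 < M%:R :> R by rewrite ltr0n.
have aM : (a < M)%N by rewrite /M; lia.
have bM : (b < M)%N by rewrite /M; lia.
split; [by rewrite /M /= odd_double|by rewrite /M; lia| |].
- have s0 : 0 < Num.sqrt M%:R :> R by rewrite sqrtr_gt0.
  rewrite ler_pdivrMr// mulrC -ler_pdivrMr//.
  rewrite -ler_sqr ?nnegrE ?divr_ge0 ?(ltW d10) ?(ltW s0)// sqr_sqrtr ?(ltW Mp)//.
  by apply: (le_trans (ltW (Num.Theory.truncnS_gt _))); rewrite ler_nat.
- rewrite ler_pdivrMr// mulrC -ler_pdivrMr//.
  by apply: (le_trans (ltW (Num.Theory.truncnS_gt _))); rewrite ler_nat.
Qed.

(** The Gram matrices converge to the identity and the defects to zero as the mesh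
   is refined, while the margin [eta] stays fixed, so that [index_bound_step]
   applies to a fine mesh. *)
Theorem index_bound (I : finType) (l : I -> R) (f : I -> R -> H) :
  (forall i, `|l i - c| <= r) -> (forall i, ae (l i) (f i)) ->
  (forall i j, l i = l j -> cip dot (f i 0) (f j 0) = (i == j)%:R) ->
  (#|I| <= (K * N0).*2)%N.
Proof.
move=> lr aef orth; rewrite leqNgt; apply/negP => cardI.
have I0 : (0 < #|I|)%N by rewrite (leq_trans _ cardI).
have Ip : 0 < #|I|%:R :> R by rewrite ltr0n.
have [i0 _] : exists i : I, i \in I by apply/card_gt0P.
have r0 : 0 <= r := le_trans (normr_ge0 _) (lr i0).
have den0 : 0 < 2 * r + eta + 4.
  by rewrite ltr_wpDl ?addr_ge0 ?mulr_ge0 ?(ltW eta0).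
pose eps := eta / (2 * r + eta + 4).
have eps0 : 0 < eps by rewrite divr_gt0.
have eps1 : eps < 1.
  rewrite /eps ltr_pdivrMr// mul1r addrAC ltrDr ltr_wpDl// mulr_ge0//.
have epseta : eps * (2 * r + eta + 4) <= eta by rewrite divfK// gt_eqF.
have /choice[Cg hCg] (ij : I * I) : exists C : R, 0 <= C /\ forall M, (0 < M)%N ->
    `|mdot M (mid tau (f ij.1) (M := M)) (mid tau (f ij.2) (M := M)) - (ij.1 == ij.2)%:R|
      <= C / Num.sqrt M%:R /\
    `|mdot M ('i%C *: mid tau (f ij.1) (M := M)) (mid tau (f ij.2) (M := M))|
      <= C / Num.sqrt M%:R.
  case: ij => i j /=.
  have h1 : l i = l j -> cip dot (f i 0) (f j 0) = ((i == j)%:R : R)%:C.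
    by move=> e'; rewrite orth// rmorph_nat.
  have h2 : l i != l j -> (i == j)%:R = 0 :> R.
    by move=> ll; have [ij|//] := eqVneq i j; rewrite ij eqxx in ll.
  by have [C C0 hC] := gram_limit (aef i) (aef j) h1 h2; exists C.
have /choice[Ce hCe] (i : I) : exists C : R, forall M k, (0 < M)%N -> (k < M)%N ->
    dot (defect tau T (l i) (f i) M k) (defect tau T (l i) (f i) M k) <= C / M%:R.
  by case: (aef i) => _ _ [C hC]; exists C.
pose C := \sum_ij Cg ij; pose E := \sum_i `|Ce i|.
have C0 : 0 <= C by apply: sumr_ge0 => ij _; case: (hCg ij).
have CgC ij : Cg ij <= C.
  by rewrite /C (bigD1 ij)//= lerDl sumr_ge0// => x _; case: (hCg x).
have CeE i : Ce i <= E.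
  apply: (le_trans (ler_norm _)).
  by rewrite /E (bigD1 i)//= lerDl sumr_ge0.
have d10 : 0 < eps / (2 * #|I|%:R) by rewrite divr_gt0// mulr_gt0.
have d20 : 0 < eps ^+ 2 / #|I|%:R by rewrite divr_gt0// exprn_gt0.
have [M [oddM KM h1 h2]] := fine_mesh E K.*2 d10 d20 C0.
have M0 : (0 < M)%N := leq_ltn_trans (leq0n _) KM.
have Mp : 0 < M%:R :> R by rewrite ltr0n.
have s0 : 0 < Num.sqrt M%:R :> R by rewrite sqrtr_gt0.
apply: (@index_bound_step I l f M oddM KM cardI lr _ eps eps0 eps1 epseta) => [i|i j|i j|i k].
- by case: (aef i).
- apply: le_trans ((hCg (i, j)).2 M M0).1 _; apply: le_trans h1.
  by rewrite ler_pM2r ?invr_gt0.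
- apply: le_trans ((hCg (i, j)).2 M M0).2 _; apply: le_trans h1.
  by rewrite ler_pM2r ?invr_gt0.
- apply: le_trans (hCe i M k M0 (ltn_ord k)) _; apply: le_trans h2.
  by rewrite ler_pM2r ?invr_gt0.
Qed.

End IndexBound.

(** * Absolutely convergent sums and square-summable functions *)

Section Sums.
Variables (R : realType) (T : choiceType).
Implicit Types (a b : T -> R).

Definition nnsum a : \bar R := (\esum_(x in [set: T]) (a x)%:E)%E.

(** A new inductive proposition, not an abbreviation, so that unification does not
   unfold it to an extended-real inequality. *)
Variant summ a : Prop := Summ of (nnsum (fun x => `|a x|%R) < +oo)%E.

(** Written with [|a| + a] and [|a|] rather than positive and negative parts, to
   avoid divisions by two. *)
Definition rsum a : R := fine (nnsum (fun x => `|a x| + a x)) - fine (nnsum (fun x => `|a x|)).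

Lemma nnsum_ge0 a : (forall x, 0 <= a x) -> (0 <= nnsum a)%E.
Proof. by move=> a0; apply: esum_ge0 => x _; rewrite lee_fin. Qed.

Lemma nnsumD a b : (forall x, 0 <= a x) -> (forall x, 0 <= b x) ->
  nnsum (fun x => a x + b x) = (nnsum a + nnsum b)%E.
Proof. by move=> a0 b0; rewrite /nnsum -esumD// => x _; rewrite lee_fin. Qed.

Lemma le_nnsum a b : (forall x, a x <= b x) -> (nnsum a <= nnsum b)%E.
Proof. by move=> h; apply: le_esum => x _; rewrite lee_fin. Qed.

Lemma nnsumZ (k : R) a : 0 <= k -> nnsum (fun x => k * a x) = (k%:E * nnsum a)%E.
Proof.
move=> k0; rewrite /nnsum /esum -ereal_supZl//; last first.
  by apply/set0P; exists 0%E; exists set0; [exact: fsets_set0|rewrite fsbig_set0].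
congr ereal_sup; apply/seteqP; split=> y /=.
  move=> [A [fA _] <-]; exists (\sum_(x \in A) (a x)%:E)%E; first by exists A.
  by rewrite !fsumEFin// -EFinM -mulr_fsumr.
move=> [_ [A [fA _] <-] <-]; exists A => //.
by rewrite !fsumEFin// -EFinM -mulr_fsumr.
Qed.

Lemma summ_le a b : (forall x, `|a x| <= b x) -> summ b -> summ a.
Proof.
move=> h [sb]; split; apply: le_lt_trans sb; apply: le_nnsum => x.
by rewrite (le_trans (h x))// ler_norm.
Qed.

Lemma summ_nneg a : (forall x, 0 <= a x) -> summ a <-> (nnsum a < +oo)%E.
Proof.
move=> a0; have e : (fun x => `|a x|) = a by apply/funext => x; rewrite ger0_norm.
by split=> [[]|h]; [rewrite e|split; rewrite e].
Qed.

Lemma summ_norm a : summ (fun x => `|a x|) <-> summ a.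
Proof. by rewrite summ_nneg => [|x//]; split=> [|[]]. Qed.

Lemma summD a b : summ a -> summ b -> summ (fun x => a x + b x).
Proof.
move=> sa sb; apply: (@summ_le _ (fun x => `|a x| + `|b x|)) => [x|].
  exact: ler_normD.
apply/summ_nneg => [x|]; first by rewrite addr_ge0.
by rewrite nnsumD//; case: sa sb => sa [sb]; exact: lte_add_pinfty.
Qed.

Lemma summZ (k : R) a : summ a -> summ (fun x => k * a x).
Proof.
move=> [sa]; split; rewrite (_ : (fun x => _) = fun x => `|k| * `|a x|); last first.
  by apply/funext => x; rewrite normrM.
by rewrite nnsumZ//; apply: lte_mul_pinfty; rewrite ?lee_fin.
Qed.

Lemma summN a : summ a -> summ (fun x => - a x).
Proof. by move=> sa; apply: (@summ_le _ (fun x => `|a x|)) => [x|]; [rewrite normrN|exact/summ_norm]. Qed.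

Lemma summ_fin a : (forall x, 0 <= a x) -> summ a -> nnsum a \is a fin_num.
Proof.
by move=> a0 /(summ_nneg a0).1 sa; rewrite ge0_fin_numE// nnsum_ge0.
Qed.

Lemma fine_nnsumD a b : (forall x, 0 <= a x) -> (forall x, 0 <= b x) ->
  summ a -> summ b ->
  fine (nnsum (fun x => a x + b x)) = fine (nnsum a) + fine (nnsum b).
Proof.
by move=> a0 b0 sa sb; rewrite nnsumD// fineD//; exact: summ_fin.
Qed.

Lemma normD_ge0 (z : R) : 0 <= `|z| + z.
Proof. by rewrite -lerBlDr sub0r -normrN ler_norm. Qed.

Lemma summ_pos a : summ a -> summ (fun x => `|a x| + a x).
Proof. by move=> sa; apply: summD => //; exact/summ_norm. Qed.

(** Any two summable nonnegative functions may replace the canonical ones: all the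
   algebra of [rsum] follows from this. *)
Lemma rsum_diff a p n : (forall x, 0 <= p x) -> (forall x, 0 <= n x) ->
  summ p -> summ n -> (forall x, a x = p x - n x) ->
  rsum a = fine (nnsum p) - fine (nnsum n).
Proof.
move=> p0 n0 sp sn aE.
have sa : summ a.
  apply: (@summ_le _ (fun x => p x + n x)); last exact: summD.
  move=> x; rewrite aE; apply: le_trans (ler_normB _ _) _.
  by rewrite !ger0_norm.
have sna := (summ_norm a).2 sa; have spa := summ_pos sa.
have pa x := normD_ge0 (a x); have na x := normr_ge0 (a x).
rewrite /rsum; apply/eqP; rewrite subr_eq addrAC eq_sym subr_eq.
rewrite -(fine_nnsumD p0 na sp sna) -(fine_nnsumD pa n0 spa sn).
by apply/eqP; congr (fine (nnsum _)); apply/funext => x; rewrite aE; ring.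
Qed.

Lemma rsum_nneg a : (forall x, 0 <= a x) -> summ a -> rsum a = fine (nnsum a).
Proof.
move=> a0 sa; have z0 : nnsum (fun=> 0 : R) = 0%E by rewrite /nnsum esum1.
have sz : summ (fun=> 0) by apply/summ_nneg => [//|]; rewrite z0 ltry.
by rewrite (rsum_diff a0 _ sa sz (fun x => esym (subr0 _)))// z0 subr0.
Qed.

Lemma rsum_nnegE a : (forall x, 0 <= a x) -> summ a -> (rsum a)%:E = nnsum a.
Proof. by move=> a0 sa; rewrite rsum_nneg// fineK// summ_fin. Qed.

Lemma rsumD a b : summ a -> summ b -> rsum (fun x => a x + b x) = rsum a + rsum b.
Proof.
move=> sa sb.
have sna := (summ_norm a).2 sa; have spa := summ_pos sa.
have snb := (summ_norm b).2 sb; have spb := summ_pos sb.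
have pa x := normD_ge0 (a x); have na x := normr_ge0 (a x).
have pb x := normD_ge0 (b x); have nb x := normr_ge0 (b x).
rewrite (rsum_diff (fun x => addr_ge0 (pa x) (pb x)) (fun x => addr_ge0 (na x) (nb x))
  (summD spa spb) (summD sna snb)); last by move=> x; ring.
rewrite (fine_nnsumD pa pb spa spb) (fine_nnsumD na nb sna snb) /rsum.
by rewrite opprD addrACA.
Qed.

Lemma rsumN a : summ a -> rsum (fun x => - a x) = - rsum a.
Proof.
move=> sa; have sna := (summ_norm a).2 sa; have spa := summ_pos sa.
have pa x := normD_ge0 (a x); have na x := normr_ge0 (a x).
by rewrite (rsum_diff na pa sna spa) ?/rsum ?opprB// => x; ring.
Qed.

Lemma eq_rsum a b : (forall x, a x = b x) -> rsum a = rsum b.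
Proof. by move=> ab; congr rsum; exact/funext. Qed.

Lemma rsumB a b : summ a -> summ b -> rsum (fun x => a x - b x) = rsum a - rsum b.
Proof. by move=> sa sb; rewrite rsumD ?rsumN//; exact: summN. Qed.

Lemma rsumZ (k : R) a : summ a -> rsum (fun x => k * a x) = k * rsum a.
Proof.
move=> sa; wlog k0 : k / 0 <= k => [hw|].
  have [/hw//|k0] := leP 0 k.
  have := hw (- k); rewrite oppr_ge0 ltW// => /(_ isT).
  rewrite mulNr => h; apply: oppr_inj; rewrite -h -rsumN; last exact: summZ.
  by apply: eq_rsum => x; rewrite mulNr.
have sna := (summ_norm a).2 sa; have spa := summ_pos sa.
have pa x := normD_ge0 (a x); have na x := normr_ge0 (a x).
have f1 := summ_fin pa spa; have f2 := summ_fin na sna.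
rewrite (rsum_diff (fun x => mulr_ge0 k0 (pa x)) (fun x => mulr_ge0 k0 (na x))
  (summZ k spa) (summZ k sna)); last by move=> x; ring.
by rewrite !nnsumZ// !fineM// /rsum mulrBr.
Qed.

Lemma rsum_ge0 a : (forall x, 0 <= a x) -> 0 <= rsum a.
Proof.
move=> a0; rewrite /rsum (_ : (fun x => `|a x| + a x) = fun x => 2 * `|a x|); last first.
  by apply/funext => x; rewrite ger0_norm// mulr_natl mulr2n.
rewrite nnsumZ// (_ : (fun x => `|a x|) = a); last by apply/funext => x; rewrite ger0_norm.
have := nnsum_ge0 a0; case: (nnsum a) => [r| |]//=; rewrite ?lee_fin => r0.
  by lra.
Qed.

Lemma le_rsum a b : summ a -> summ b -> (forall x, a x <= b x) -> rsum a <= rsum b.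
Proof.
move=> sa sb ab; rewrite -subr_ge0 -rsumB//; apply: rsum_ge0 => x.
by rewrite subr_ge0.
Qed.

Lemma rsum_ge a x : (forall x, 0 <= a x) -> summ a -> a x <= rsum a.
Proof.
move=> a0 sa; rewrite -lee_fin rsum_nnegE// /nnsum (esumID [set x])//=.
  by rewrite setTI esum_set1 ?lee_fin// leeDl// esum_ge0// => y _; rewrite lee_fin.
by move=> y _; rewrite lee_fin.
Qed.

Lemma rsum_eq0 a : (forall x, 0 <= a x) -> summ a -> rsum a = 0 -> forall x, a x = 0.
Proof.
by move=> a0 sa s0 x; apply/eqP; rewrite eq_le a0 andbT -s0 rsum_ge.
Qed.

Lemma summ_single (x0 : T) a : (forall x, x != x0 -> a x = 0) -> summ a.
Proof.
move=> h; split; rewrite /nnsum (esumID [set x0])//= setTI esum_set1//.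
by rewrite esum1 ?adde0 ?ltry// => x [_ /= xx0]; rewrite h ?normr0//; apply/eqP.
Qed.

Lemma rsum_single (x0 : T) a : (forall x, x != x0 -> a x = 0) -> rsum a = a x0.
Proof.
move=> h; have sa := summ_single h.
have e b : (forall x, x != x0 -> b x = 0) -> (forall x, 0 <= b x) -> nnsum b = (b x0)%:E.
  move=> hb b0; rewrite /nnsum (esumID [set x0])//= ?setTI ?esum_set1 ?lee_fin//.
    by rewrite esum1 ?adde0// => x /= xx0; rewrite hb//; apply/eqP.
  by move=> x _; rewrite lee_fin.
rewrite /rsum !e//=; first by ring.
- by move=> x xx0; rewrite h// normr0.
- by move=> x xx0; rewrite h// normr0 addr0.
- by move=> x; exact: normD_ge0.
Qed.

End Sums.

Section Reindexing.
Variables (R : realType) (T E : choiceType).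

Lemma rsum_reindex (s : E -> E) (a : E -> R) : bijective s -> rsum (a \o s) = rsum a.
Proof.
move=> bs; have sb : set_bij [set: E] [set: E] s.
  case: bs => s' sK s'K; split=> // [x y _ _ /(can_inj sK)//|y _].
  by exists (s' y).
have e (b : E -> R) : nnsum (b \o s) = nnsum b.
  by apply/esym; exact: (@reindex_esum _ _ _ _ _ _ (fun x => (b x)%:E) sb).
by rewrite /rsum -(e (fun x => `|a x| + a x)) -(e (fun x => `|a x|)).
Qed.

Variable pi : E -> T.
Hypothesis fin_fiber : forall x, finite_set [set e | pi e = x].
Local Notation fiber x := [set e | pi e = x].

(** Edges are summed by their initial vertex; this is how quadratic forms on edges
   turn into forms on vertices. *)
Lemma nnsum_fiber (b : E -> R) : (forall e, 0 <= b e) ->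
  nnsum b = nnsum (fun x => \sum_(e \in fiber x) b e).
Proof.
move=> b0; rewrite /nnsum.
transitivity (\esum_(x in [set: T]) \esum_(e in fiber x) (b e)%:E)%E; last first.
  apply: eq_esum => x _; rewrite esum_fset ?fsumEFin// => e _.
  by rewrite lee_fin.
rewrite esum_esum => [|x e _ _]; last by rewrite lee_fin.
rewrite (@reindex_esum _ _ _ [set: E] _ (fun e => (pi e, e)))//=.
split=> [e _|e e' _ _ [_ ->]|[x e] [_ /= <-]]//=.
by exists e.
Qed.

Lemma summ_fiber (b : E -> R) : summ b -> summ (fun x => \sum_(e \in fiber x) `|b e|).
Proof.
move=> sb; apply/summ_nneg => [x|]; first exact: fsumr_ge0.
by rewrite -nnsum_fiber//; case: sb.
Qed.

Lemma rsum_fiber (b : E -> R) : summ b ->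
  rsum b = rsum (fun x => \sum_(e \in fiber x) b e).
Proof.
move=> sb; have sb' := summ_fiber sb; have spb := summ_pos sb.
have pb x := normD_ge0 (b x); have nb x := normr_ge0 (b x).
have spb' : summ (fun x => \sum_(e \in fiber x) (`|b e| + b e)).
  have := summ_fiber spb; congr summ; apply/funext => x.
  by apply: eq_fsbigr => e _; rewrite ger0_norm.
rewrite (rsum_diff _ _ spb' sb').
- by rewrite /rsum -!nnsum_fiber.
- by move=> x; apply: fsumr_ge0.
- by move=> x; apply: fsumr_ge0.
- by move=> x; rewrite fsbig_split//= addrAC subrr add0r.
Qed.

End Reindexing.

Section SquareSummable.
Variables (R : realType) (T : choiceType).
Local Notation C := R[i].
Local Notation U := (T -> C^o).
Implicit Types f g : U.

Definition sqsumm : {pred U} := [pred f : U | `[< summ (fun x => normc (f x) ^+ 2) >]].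

Lemma sqsummP f : reflect (summ (fun x => normc (f x) ^+ 2)) (f \in sqsumm).
Proof. exact: asboolP. Qed.

Lemma normcD_sqr (z w : C) : normc (z + w) ^+ 2 <= 2 * normc z ^+ 2 + 2 * normc w ^+ 2.
Proof.
rewrite !normc_sqr; case: z w => a b [a' b'] /=.
by have := sqr_ge0 (a - a'); have := sqr_ge0 (b - b'); nra.
Qed.

Fact sqsumm_submod : submod_closed sqsumm.
Proof.
split=> [|a f g /sqsummP sf /sqsummP sg]; apply/sqsummP.
  apply: (@summ_le _ _ _ (fun=> 0)) => [x|].
    by rewrite normc_sqr /= expr0n addr0 normr0.
  by apply/summ_nneg => //; rewrite /nnsum esum1.
apply: (@summ_le _ _ _ (fun x => 2 * normc a ^+ 2 * normc (f x) ^+ 2 + 2 * normc (g x) ^+ 2)).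
  move=> x; rewrite ger0_norm ?sqr_ge0//; apply: le_trans (normcD_sqr _ _) _.
  by rewrite -[(a *: f) x]/(a * f x) ComplexField.Normc.normcM exprMn mulrA.
by apply: summD; exact: summZ.
Qed.

HB.instance Definition _ := GRing.isSubmodClosed.Build C U sqsumm sqsumm_submod.

Record ell2 := Ell2 { ell2_val :> U; ell2P : ell2_val \in sqsumm }.
HB.instance Definition _ := [isSub for ell2_val].
HB.instance Definition _ := [Choice of ell2 by <:].
HB.instance Definition _ := [SubChoice_isSubLmodule of ell2 by <:].

Lemma ell2_inj (f g : ell2) : (forall x, f x = g x) -> f = g.
Proof. by move=> fg; apply: val_inj; apply/funext. Qed.

Lemma ell2D (f g : ell2) x : (f + g) x = f x + g x.
Proof. by []. Qed.

Lemma ell2Z a (f : ell2) x : (a *: f) x = a * f x.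
Proof. by []. Qed.

Lemma ell2N (f : ell2) x : (- f) x = - f x.
Proof. by []. Qed.

Lemma ell2_0 x : (0 : ell2) x = 0.
Proof. by []. Qed.

Lemma ell2_sum (I : Type) (r : seq I) (P : pred I) (F : I -> ell2) x :
  (\sum_(i <- r | P i) F i) x = \sum_(i <- r | P i) F i x.
Proof. by apply: (big_morph (fun f : ell2 => f x)). Qed.

(** [Re (z * conj w)]. *)
Definition rdot (z w : C) : R := complex.Re z * complex.Re w + complex.Im z * complex.Im w.

Definition dot2 (f g : ell2) : R := rsum (fun x => rdot (f x) (g x)).

Lemma rdot_le z w : `|rdot z w| <= normc z ^+ 2 + normc w ^+ 2.
Proof.
rewrite !normc_sqr /rdot; case: z w => a b [a' b'] /=.
have := sqr_ge0 (a - a'); have := sqr_ge0 (b - b').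
have := sqr_ge0 (a + a'); have := sqr_ge0 (b + b').
by move=> *; rewrite ler_norml; apply/andP; split; nra.
Qed.

Lemma rdot_self z : rdot z z = normc z ^+ 2.
Proof. by rewrite normc_sqr /rdot -!expr2. Qed.

Lemma ell2_summ (f : ell2) : summ (fun x => normc (f x) ^+ 2).
Proof. exact/sqsummP/ell2P. Qed.

Lemma dot2_summ (f g : ell2) : summ (fun x => rdot (f x) (g x)).
Proof.
apply: (@summ_le _ _ _ (fun x => normc (f x) ^+ 2 + normc (g x) ^+ 2)) => [x|].
  exact: rdot_le.
by apply: summD; exact: ell2_summ.
Qed.

Lemma dot2_self (f : ell2) : dot2 f f = rsum (fun x => normc (f x) ^+ 2).
Proof. by apply: eq_rsum => x; rewrite rdot_self. Qed.

Lemma dot2_nnsum (f : ell2) : (dot2 f f)%:E = nnsum (fun x => normc (f x) ^+ 2).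
Proof.
by rewrite dot2_self rsum_nnegE => [//|x|]; [exact: sqr_ge0|exact: ell2_summ].
Qed.

Lemma dot2_is_dot : is_dot dot2.
Proof.
split.
- by move=> f g; apply: eq_rsum => x; rewrite /rdot mulrC [X in _ + X]mulrC.
- move=> f g h; rewrite /dot2 -rsumD; try exact: dot2_summ.
  by apply: eq_rsum => x; rewrite /rdot ell2D; case: (f x) (g x) => a b [a' b'] /=; ring.
- move=> a f g; rewrite /dot2 -rsumZ; last exact: dot2_summ.
  by apply: eq_rsum => x; rewrite /rdot ell2Z; case: (f x) => b c /=; ring.
- move=> f g; rewrite /dot2 -rsumN; last exact: dot2_summ.
  by apply: eq_rsum => x; rewrite /rdot !ell2Z; case: (f x) (g x) => a b [a' b'] /=; ring.
- by move=> f; rewrite dot2_self; apply: rsum_ge0 => x; exact: sqr_ge0.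
- move=> f; rewrite dot2_self => f0; apply: ell2_inj => x.
  have := rsum_eq0 (fun x => sqr_ge0 (normc (f x))) (ell2_summ f) f0 x.
  by move=> /eqP; rewrite sqrf_eq0 => /eqP/ComplexField.Normc.eq0_normc.
Qed.

Lemma mult_sqsumm (q : T -> R) (B : R) (f : ell2) : (forall x, `|q x| <= B) ->
  (fun x => (q x)%:C * f x : C^o) \in sqsumm.
Proof.
move=> qB; apply/sqsummP.
apply: (@summ_le _ _ _ (fun x => B ^+ 2 * normc (f x) ^+ 2)) => [x|]; last first.
  by apply: summZ; exact: ell2_summ.
rewrite ger0_norm ?sqr_ge0// ComplexField.Normc.normcM exprMn ler_wpM2r ?sqr_ge0//.
rewrite [leLHS]normc_sqr /= expr0n addr0 -real_normK ?num_real//.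
by rewrite ler_sqr ?nnegrE ?(le_trans _ (qB x)).
Qed.

(** [insubd] makes this total; it is the product exactly for bounded [q]. *)
Definition mult (q : T -> R) (f : ell2) : ell2 :=
  insubd 0 (fun x => (q x)%:C * f x : C^o).

Definition bounded_potential (q : T -> R) := exists B : R, forall x, `|q x| <= B.

Lemma mult_apply (q : T -> R) (f : ell2) x : bounded_potential q -> mult q f x = (q x)%:C * f x.
Proof. by move=> [B qB]; rewrite /mult insubdK//; exact: mult_sqsumm qB. Qed.

Lemma mult_linear q : bounded_potential q -> linear (mult q).
Proof.
move=> bq a f g; apply: ell2_inj => x; rewrite mult_apply// !ell2D !ell2Z !mult_apply//; ring.
Qed.

Lemma mult_dot q (f g : ell2) : bounded_potential q ->
  dot2 (mult q f) g = rsum (fun x => q x * rdot (f x) (g x)).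
Proof.
move=> bq; apply: eq_rsum => x; rewrite mult_apply// /rdot.
by case: (f x) => a b /=; ring.
Qed.

Lemma mult_selfadjoint q : bounded_potential q -> selfadjoint dot2 (mult q).
Proof.
move=> bq f g; rewrite (dotC dot2_is_dot f) !mult_dot//; apply: eq_rsum => x.
by rewrite /rdot; ring.
Qed.

Lemma mult_summ q (f : ell2) : bounded_potential q -> summ (fun x => q x * normc (f x) ^+ 2).
Proof.
move=> [B qB]; apply: (@summ_le _ _ _ (fun x => B * normc (f x) ^+ 2)) => [x|].
  by rewrite normrM [`|normc _ ^+ 2|]ger0_norm ?sqr_ge0// ler_wpM2r ?sqr_ge0.
by apply: summZ; exact: ell2_summ.
Qed.

Lemma mult_form q (f : ell2) : bounded_potential q ->
  dot2 (mult q f) f = rsum (fun x => q x * normc (f x) ^+ 2).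
Proof. by move=> bq; rewrite mult_dot//; apply: eq_rsum => x; rewrite rdot_self. Qed.

Lemma le_mult_form q q' (f : ell2) : bounded_potential q -> bounded_potential q' ->
  (forall x, q x <= q' x) -> dot2 (mult q f) f <= dot2 (mult q' f) f.
Proof.
move=> bq bq' qq'; rewrite !mult_form//; apply: le_rsum; try exact: mult_summ.
by move=> x; rewrite ler_wpM2r ?sqr_ge0.
Qed.

Lemma mult_cst (b : R) (f : ell2) : dot2 (mult (fun=> b) f) f = b * dot2 f f.
Proof.
rewrite mult_form ?dot2_self ?rsumZ//; first exact: ell2_summ.
by exists `|b|.
Qed.

Definition basis_vec (x0 : T) : ell2 := insubd 0 (fun x => (x == x0)%:R : C^o).

Lemma basis_vecE x0 x : basis_vec x0 x = (x == x0)%:R.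
Proof.
rewrite /basis_vec insubdK//; apply/sqsummP; apply: (@summ_single _ _ x0) => y /negbTE ->.
by rewrite normc_sqr /= expr0n addr0.
Qed.

Lemma cip_basis_vec (f : ell2) x0 : cip dot2 f (basis_vec x0) = f x0.
Proof.
have e (g : ell2) : dot2 f g = rsum (fun x => rdot (f x) (g x)) by [].
rewrite /cip !e !(@rsum_single _ _ x0); last 2 first.
- by move=> x /negbTE xx0; rewrite /rdot ell2Z basis_vecE xx0 mulr0 /= !mulr0 addr0.
- by move=> x /negbTE xx0; rewrite /rdot basis_vecE xx0 /= !mulr0 addr0.
rewrite /rdot ell2Z basis_vecE eqxx mulr1; case: (f x0) => a b /=.
by congr (_ +i* _); ring.
Qed.

End SquareSummable.

(** * The Schroedinger operator on square-summable functions *)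

Section GraphOperator.
Variables (R : realType) (d : nat) (G : periodic_graph R d).
Local Notation C := R[i].
Local Notation T := (vert G).
Local Notation H := (ell2 R (vert G)).
Local Notation fiber x := [set e : edge G | src e = x].

Lemma vert_inhabited : exists x : T, True.
Proof.
have /infinite_setN0[x vx] := @vert_infinite R d G.
by exists (exist _ x (mem_set vx)).
Qed.

(** A periodic function takes finitely many values, one for each orbit. *)
Lemma periodic_bounded (g : T -> R) : periodic_potential g -> bounded_potential g.
Proof.
move=> perg; have [F0 [finF FV cov]] := finite_quotient G.
have [x0 _] := vert_inhabited.
pose h (y : 'rV[R]_d) := `|g (insubd x0 y)|.
exists (\sum_(y \in F0) h y) => x.
have [y [a [Fy La xE]]] := cov (val x) (set_mem (valP x)).
have yV : y \in vert G by rewrite inE; exact: FV.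
have -> : g x = g (insubd x0 y).
  by apply: perg; rewrite insubdK// xE addrC addKr.
by rewrite (fsbigD1 y)//= lerDl fsumr_ge0// => z _; exact: normr_ge0.
Qed.

Definition degree (x : T) : R := \sum_(e \in fiber x) (1 : R).

(** The translation of the graph maps the edges at [x] to those at its image. *)
Lemma degree_periodic : periodic_potential degree.
Proof.
move=> x y Lxy; have [phi [bphi hphi]] := @edge_periodic R d G _ Lxy.
have yE : val y = val x + (val y - val x) by rewrite addrC subrK.
rewrite /degree (@reindex_fsbig _ _ _ _ _ phi (fiber x) (fiber y))//.
split=> [e /= ex|e e' _ _|e /= ey].
- by apply: val_inj; case: (hphi e) => -> _ _; rewrite ex -yE.
- by move/(bij_inj bphi).
- have [psi psiK phiK] := bphi; exists (psi e) => /=; last exact: phiK.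
  apply: val_inj; apply: (addIr (val y - val x)).
  by case: (hphi (psi e)) => <- _ _; rewrite phiK ey -yE.
Qed.

Lemma degree_bounded : exists2 D : R, 0 <= D & forall x, 0 <= degree x <= D.
Proof.
have [D hD] := periodic_bounded degree_periodic.
have d0 x : 0 <= degree x by apply: fsumr_ge0.
have [x0 _] := vert_inhabited.
exists D => [|x]; first by rewrite (le_trans _ (hD x0)).
by rewrite d0 (le_trans (ler_norm _)).
Qed.

Lemma fiber_cst x (c : R) : \sum_(e \in fiber x) c = degree x * c.
Proof.
by rewrite /degree mulr_fsuml; apply: eq_fsbigr => e _; rewrite mul1r.
Qed.

Lemma rdot_fsuml x (z : edge G -> C^o) (w : C) :
  rdot (\sum_(e \in fiber x) z e) w = \sum_(e \in fiber x) rdot (z e) w.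
Proof.
have fin := locally_finite x.
rewrite !fsbig_finite//=; apply: (big_morph (fun z : C => rdot z w)).
  by move=> [a b] [a' b']; rewrite /rdot /=; ring.
by rewrite /rdot /= !mul0r addr0.
Qed.

Lemma normc_fsum x (z : edge G -> C^o) :
  normc (\sum_(e \in fiber x) z e) ^+ 2 <= degree x * \sum_(e \in fiber x) normc (z e) ^+ 2.
Proof.
have fin := locally_finite x.
rewrite -rdot_self rdot_fsuml.
have e1 e : rdot (z e) (\sum_(e' \in fiber x) z e') = \sum_(e' \in fiber x) rdot (z e') (z e).
  by rewrite -rdot_fsuml /rdot; ring.
under eq_fsbigr do rewrite e1.
apply: (@le_trans _ _ (\sum_(e \in fiber x) \sum_(e' \in fiber x)
    ((normc (z e') ^+ 2 + normc (z e) ^+ 2) / 2))).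
  rewrite !fsbig_finite//=; apply: ler_sum => e _.
  rewrite !fsbig_finite//=; apply: ler_sum => e' _.
  rewrite -!rdot_self /rdot; case: (z e) (z e') => a b [a' b'] /=.
  by have := sqr_ge0 (a - a'); have := sqr_ge0 (b - b'); lra.
under eq_fsbigr => e _.
  rewrite -mulr_fsuml fsbig_split//= fiber_cst; over.
rewrite -mulr_fsuml fsbig_split//= fiber_cst -mulr_fsumr.
by lra.
Qed.

Lemma summ_src (f : H) : summ (fun e : edge G => normc (f (src e)) ^+ 2).
Proof.
have [D D0 hD] := degree_bounded.
apply/summ_nneg => [e|]; first exact: sqr_ge0.
rewrite (nnsum_fiber (@locally_finite R d G))//= => [|e]; last exact: sqr_ge0.
have h : (nnsum (fun x => (D * normc (f x) ^+ 2)%R) < +oo)%E.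
  apply/summ_nneg => [x|]; first by rewrite mulr_ge0 ?sqr_ge0.
  by apply: summZ; exact: ell2_summ.
apply: le_lt_trans h; apply: le_nnsum => x.
rewrite (_ : \sum_(e \in fiber x) _ = \sum_(e \in fiber x) normc (f x) ^+ 2).
  by rewrite fiber_cst ler_wpM2r ?sqr_ge0//; case/andP: (hD x).
by apply: eq_fsbigr => e; rewrite inE => <-.
Qed.

Lemma rev_bij : bijective (@Defs.rev R d G).
Proof. by exists (@Defs.rev R d G); exact: Defs.revK. Qed.

Lemma tgt_rev (e : edge G) : tgt (Defs.rev e) = src e.
Proof. by rewrite -src_rev Defs.revK. Qed.

Lemma summ_rev (b : edge G -> R) : (forall e, 0 <= b e) -> summ b -> summ (b \o @Defs.rev R d G).
Proof.
move=> b0 /summ_nneg sb; apply/summ_nneg => [e|] //=.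
have sbij : set_bij [set: edge G] [set: edge G] (@Defs.rev R d G).
  split=> // [x y _ _ /(can_inj (@Defs.revK R d G))//|y _].
  by exists (Defs.rev y) => //; rewrite Defs.revK.
have -> : nnsum (b \o @Defs.rev R d G) = nnsum b.
  by apply/esym; exact: (@reindex_esum _ _ _ _ _ _ (fun x => (b x)%:E) sbij).
exact: sb.
Qed.

Lemma summ_tgt (f : H) : summ (fun e : edge G => normc (f (tgt e)) ^+ 2).
Proof.
have := summ_rev (fun e => sqr_ge0 _) (summ_src f).
by congr summ; apply/funext => e /=; rewrite src_rev.
Qed.

Lemma rsum_tgt (f : H) : rsum (fun e : edge G => normc (f (tgt e)) ^+ 2) =
  rsum (fun e : edge G => normc (f (src e)) ^+ 2).
Proof.
rewrite -(rsum_reindex (fun e => normc (f (src e)) ^+ 2) rev_bij).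
by apply: eq_rsum => e /=; rewrite src_rev.
Qed.

Lemma rsum_src_le (f : H) (D : R) : (forall x, 0 <= degree x <= D) ->
  rsum (fun e : edge G => normc (f (src e)) ^+ 2) <= D * dot2 f f.
Proof.
move=> hD; rewrite (rsum_fiber (@locally_finite R d G) (summ_src f)) dot2_self -rsumZ; last exact: ell2_summ.
have e x : \sum_(e \in fiber x) normc (f (src e)) ^+ 2 = degree x * normc (f x) ^+ 2.
  by rewrite -fiber_cst; apply: eq_fsbigr => e; rewrite inE => <-.
rewrite (eq_rsum e); apply: le_rsum => [||x].
- apply: (@summ_le _ _ _ (fun x => D * normc (f x) ^+ 2)) => [x|].
    case/andP: (hD x) => h0 h1.
    rewrite ger0_norm; last by rewrite mulr_ge0 ?sqr_ge0.
    by rewrite ler_wpM2r ?sqr_ge0.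
  by apply: summZ; exact: ell2_summ.
- by apply: summZ; exact: ell2_summ.
- by case/andP: (hD x) => _ h1; rewrite ler_wpM2r ?sqr_ge0.
Qed.

Variable p : T -> R.
Hypothesis perp : periodic_potential p.

Definition edge_square (f : H) (e : edge G) := 2 * normc (f (src e)) ^+ 2 + 2 * normc (f (tgt e)) ^+ 2.

Lemma summ_edge_square f : summ (edge_square f).
Proof. by apply: summD; apply: summZ; [exact: summ_src|exact: summ_tgt]. Qed.

Lemma schrodinger_bound : exists2 c : R, 0 <= c & forall (f : H) x,
  normc (schrodinger p f x) ^+ 2 <= c * (\sum_(e \in fiber x) edge_square f e) + c * normc (f x) ^+ 2.
Proof.
have [D D0 hD] := degree_bounded; have [B hB] := periodic_bounded perp.
exists (2 * D + 2 * B ^+ 2) => [|f x].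
  by apply: addr_ge0; apply: mulr_ge0 => //; exact: sqr_ge0.
apply: le_trans (normcD_sqr _ _) _.
have es0 : 0 <= \sum_(e \in fiber x) edge_square f e.
  by apply: fsumr_ge0 => e _; rewrite addr_ge0// mulr_ge0// sqr_ge0.
have h1 : normc (laplacian f x) ^+ 2 <= D * \sum_(e \in fiber x) edge_square f e.
  apply: le_trans (normc_fsum _ _) _.
  have fs0 : 0 <= \sum_(e \in fiber x) normc (f x - f (tgt e)) ^+ 2.
    by apply: fsumr_ge0 => e _; exact: sqr_ge0.
  case/andP: (hD x) => h0 h1; apply: ler_pM => //.
  have fin := locally_finite x; rewrite !fsbig_finite//= big_seq [leRHS]big_seq.
  apply: ler_sum => e; rewrite in_fset_set// inE => /= ex.
  rewrite /edge_square ex; apply: le_trans (normcD_sqr _ _) _.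
  by rewrite !normc_sqr; case: (f (tgt e)) => a b /=; lra.
have h2 : normc ((p x)%:C * f x) ^+ 2 <= B ^+ 2 * normc (f x) ^+ 2.
  rewrite ComplexField.Normc.normcM exprMn ler_wpM2r ?sqr_ge0//.
  rewrite [leLHS]normc_sqr /= expr0n addr0 -real_normK ?num_real//.
  by rewrite ler_sqr ?nnegrE ?(le_trans _ (hB x)).
have := mulr_ge0 D0 (sqr_ge0 (normc (f x))).
have := mulr_ge0 (sqr_ge0 B) es0; lra.
Qed.

Lemma schrodinger_sqsumm (f : H) : schrodinger p f \in @sqsumm R T.
Proof.
have [c c0 hc] := schrodinger_bound.
apply/sqsummP; apply: (summ_le (b := fun x =>
  c * (\sum_(e \in fiber x) edge_square f e) + c * normc (f x) ^+ 2)) => [x|].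
  by rewrite ger0_norm ?sqr_ge0//.
apply: summD; last by apply: summZ; exact: ell2_summ.
apply: summZ; have := summ_fiber (@locally_finite R d G) (summ_edge_square f).
congr summ; apply/funext => x; apply: eq_fsbigr => e _.
by rewrite ger0_norm// addr_ge0// mulr_ge0// sqr_ge0.
Qed.

Definition hop (f : H) : H := Ell2 (schrodinger_sqsumm f).

Lemma hopE f x : hop f x = schrodinger p f x. Proof. by []. Qed.

Lemma schrodinger_lin (a : C) (f g : T -> C^o) x :
  schrodinger p (fun y => a * f y + g y) x = a * schrodinger p f x + schrodinger p g x.
Proof.
rewrite /schrodinger /laplacian.
have fin := locally_finite x; rewrite !fsbig_finite//=.
rewrite (eq_bigr (fun e => a * (f x - f (tgt e)) + (g x - g (tgt e)))) => [|e _].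
  by rewrite big_split /= -mulr_sumr; ring.
by ring.
Qed.

Lemma hop_linear : linear hop.
Proof. move=> a f g; apply: ell2_inj => x; exact: schrodinger_lin. Qed.

(** The Laplacian summed over oriented edges; exchanging the orientations of all
   edges then shows the symmetry. *)
Lemma hop_dot (f g : H) : dot2 (hop f) g =
  rsum (fun e : edge G => rdot (f (src e)) (g (src e)))
  - rsum (fun e : edge G => rdot (f (tgt e)) (g (src e)))
  + rsum (fun x => p x * rdot (f x) (g x)).
Proof.
have ss : summ (fun e : edge G => rdot (f (src e)) (g (src e))).
  apply: summ_le (summD (summ_src f) (summ_src g)) => e; exact: rdot_le.
have st : summ (fun e : edge G => rdot (f (tgt e)) (g (src e))).
  apply: summ_le (summD (summ_tgt f) (summ_src g)) => e; exact: rdot_le.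
have [B hB] := periodic_bounded perp.
have sp : summ (fun x => p x * rdot (f x) (g x)).
  apply: (@summ_le _ _ _ (fun x => B * `|rdot (f x) (g x)|)) => [x|].
    by rewrite normrM ler_wpM2r.
  by apply: summZ; apply/summ_norm; exact: dot2_summ.
have sd := summD ss (summN st).
rewrite -rsumB// (rsum_fiber (@locally_finite R d G) sd) -rsumD//; last first.
  apply: summ_le (summ_fiber (@locally_finite R d G) sd) => x.
  have fin := locally_finite x; rewrite !fsbig_finite//=; exact: ler_norm_sum.
apply: eq_rsum => x; rewrite hopE /schrodinger.
rewrite (_ : rdot (_ + _) _ = rdot (laplacian f x) (g x) + p x * rdot (f x) (g x)); last first.
  by rewrite /rdot; case: (laplacian _ _) (f x) => a b [a' b'] /=; ring.
congr (_ + _); rewrite rdot_fsuml; apply: eq_fsbigr => e; rewrite inE => /= ->.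
by rewrite /rdot; case: (f x) (f (tgt e)) => a b [a' b'] /=; ring.
Qed.

Lemma hop_selfadjoint : selfadjoint (@dot2 R T) hop.
Proof.
move=> f g; rewrite (dotC (@dot2_is_dot R T) f) !hop_dot.
have rC (z w : C) : rdot z w = rdot w z by rewrite /rdot; ring.
congr (_ - _ + _); try by apply: eq_rsum => x; rewrite rC.
rewrite -[RHS](rsum_reindex _ rev_bij); apply: eq_rsum => e /=.
by rewrite tgt_rev src_rev rC.
Qed.

Lemma hop_bounded : exists2 c : R, 0 <= c &
  forall f : H, dot2 (hop f) (hop f) <= c * dot2 f f.
Proof.
have [c c0 hc] := schrodinger_bound; have [D D0 hD] := degree_bounded.
exists (c * (4 * D) + c) => [|f]; first by rewrite addr_ge0 ?mulr_ge0.
have se := summ_edge_square f.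
have sfe : summ (fun x => \sum_(e \in fiber x) edge_square f e).
  have := summ_fiber (@locally_finite R d G) se.
  congr summ; apply/funext => x; apply: eq_fsbigr => e _.
  by rewrite ger0_norm// addr_ge0// mulr_ge0// sqr_ge0.
rewrite dot2_self; apply: (@le_trans _ _ (rsum (fun x =>
   c * (\sum_(e \in fiber x) edge_square f e) + c * normc (f x) ^+ 2))).
  apply: le_rsum => //; first exact: ell2_summ.
    by apply: summD; apply: summZ => //; exact: ell2_summ.
  by move=> x; exact: hc.
rewrite rsumD; [|exact: summZ|by apply: summZ; exact: ell2_summ].
rewrite rsumZ; last exact: sfe.
rewrite rsumZ; last exact: ell2_summ.
rewrite -dot2_self -(rsum_fiber (@locally_finite R d G) se) mulrDl lerD2r -mulrA.
rewrite ler_wpM2l// /edge_square rsumD; [|by apply: summZ; exact: summ_src|by apply: summZ; exact: summ_tgt].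
rewrite rsumZ; last exact: summ_src.
rewrite rsumZ; last exact: summ_tgt.
by rewrite rsum_tgt; have := rsum_src_le f hD; lra.
Qed.

(** A pointwise smallness [|v|^2 <= k |phi|^2] survives nearest-neighbour couplings
   with the same constant [k].  It is used with [phi^2] the energy of an
   eigenfunction at each vertex and [k] the mesh size. *)
Lemma hop_local : exists b : H -> T -> R, (forall phi, summ (b phi)) /\
  forall (v phi : H) (k : R), 0 <= k -> (forall x, normc (v x) ^+ 2 <= k * normc (phi x) ^+ 2) ->
  forall x, normc (hop v x) ^+ 2 <= k * b phi x.
Proof.
have [c c0 hc] := schrodinger_bound.
exists (fun phi x => c * (\sum_(e \in fiber x) edge_square phi e) + c * normc (phi x) ^+ 2).
split=> [phi|v phi k k0 vphi x].
  apply: summD; last by apply: summZ; exact: ell2_summ.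
  apply: summZ; have := summ_fiber (@locally_finite R d G) (summ_edge_square phi).
  congr summ; apply/funext => x; apply: eq_fsbigr => e _.
  by rewrite ger0_norm// addr_ge0// mulr_ge0// sqr_ge0.
apply: le_trans (hc _ _) _; rewrite mulrDr; apply: lerD; last first.
  by rewrite [leRHS]mulrCA ler_wpM2l.
rewrite [leRHS]mulrCA ler_wpM2l// mulr_fsumr.
have fin := locally_finite x; rewrite !fsbig_finite//=; apply: ler_sum => e _.
by rewrite /edge_square; have := vphi (src e); have := vphi (tgt e); lra.
Qed.

Lemma hop_form_bounded : form_bounded (@dot2 R T) hop.
Proof.
have [c c0 hc] := hop_bounded; exists (c + 1) => f.
have := dot_amgm (@dot2_is_dot R T) (hop f) f ltr01; rewrite mul1r divr1 => h.
by apply: le_trans h _; have := hc f; lra.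
Qed.

End GraphOperator.

(** * Spectrum of the unperturbed operator *)

Section Resolvent.
Variables (R : realType) (d : nat) (G : periodic_graph R d) (p : vert G -> R) (sp : R).
Hypothesis perp : periodic_potential p.
Hypothesis spec_p : spectrum (schrodinger p) `<=` [set r%:C | r in `[0, sp]].
Local Notation C := R[i].
Local Notation H := (ell2 R (vert G)).
Local Notation dot := (@dot2 R (vert G)).
Local Notation h := (hop perp).
Let D := @dot2_is_dot R (vert G).

Lemma l2_sqsumm (f : vert G -> C^o) : l2 f <-> f \in @sqsumm R (vert G).
Proof.
have e := summ_nneg (fun x => sqr_ge0 (normc (f x))).
by split=> [lf|/sqsummP /e.1//]; apply/sqsummP; exact: (e.2 lf).
Qed.

Lemma l2sq_dot (f : H) : l2sq f = (dot f f)%:E.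
Proof. by rewrite dot2_nnsum. Qed.

(** Bounded below and onto: outside the spectrum, the arguments on quadratic forms use
   only this. *)
Lemma hop_resolvent (l : R) : ~ (0 <= l <= sp) ->
  bounded_below dot h l /\ forall y, exists x, h x - l%:C *: x = y.
Proof.
move=> lI; have [T [M hT]] : resolvent_set (schrodinger p) l%:C.
  apply: contrapT => nres; have [r /= rI [rl]] := spec_p nres.
  by apply: lI; rewrite -rl; move: rI; rewrite in_itv.
split.
  exists M => f.
  have lf : l2 f by apply/l2_sqsumm; exact: ell2P.
  have lg : l2 (h f - l%:C *: f : H) by apply/l2_sqsumm; exact: ell2P.
  have [_ _ Tf] := hT _ lf; have [+ _ _] := hT _ lg.
  have -> : T (h f - l%:C *: f : H) = f by exact: Tf.
  by rewrite !l2sq_dot -EFinM lee_fin.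
move=> y; have ly : l2 y by apply/l2_sqsumm; exact: ell2P.
have [bT Ty _] := hT _ ly.
have lT : T y \in @sqsumm R (vert G).
  by apply/l2_sqsumm; apply: le_lt_trans bT _; rewrite l2sq_dot -EFinM ltry.
by exists (Ell2 lT); apply: ell2_inj => x; exact: (congr1 (fun g => g x) Ty).
Qed.

Lemma hop_ge0 (f : H) : 0 <= dot (h f) f.
Proof.
rewrite -[leLHS](mul0r (dot f f)).
apply: (form_lower_bound D) => [|||m m0]; [exact: hop_linear|exact: hop_selfadjoint|exact: hop_form_bounded|].
by apply: (hop_resolvent _).1; rewrite leNgt m0.
Qed.

(** The unperturbed operator seen from the top of its spectrum: the second half of
   the gap is treated like the first, with [s - h] in place of [h]. *)
Definition cohop (f : H) : H := sp%:C *: f - h f.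

Lemma cohop_linear : linear cohop.
Proof.
move=> a f g; rewrite /cohop hop_linear scalerDr scalerBr !scalerA mulrC opprD.
by rewrite addrACA.
Qed.

Lemma cohop_dot f g : dot (cohop f) g = sp * dot f g - dot (h f) g.
Proof. by rewrite /cohop (dotBl D) (dotZl D). Qed.

Lemma cohop_selfadjoint : selfadjoint dot cohop.
Proof.
by move=> f g; rewrite (dotC D f) !cohop_dot hop_selfadjoint (dotC D f) (dotC D f (h g)).
Qed.

Lemma cohop_form_bounded : form_bounded dot cohop.
Proof.
have [c hc] := hop_form_bounded perp; exists (`|sp| + c) => f.
rewrite cohop_dot mulrDl; apply: le_trans (ler_normB _ _) _.
by rewrite normrM (ger0_norm (dot_ge0 D f)) lerD2l.
Qed.

Lemma cohop_resolvent (m : R) : m < 0 ->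
  bounded_below dot cohop m /\ forall y, exists x, cohop x - m%:C *: x = y.
Proof.
move=> m0; have e (f : H) : cohop f - m%:C *: f = - (h f - (sp - m)%:C *: f).
  by rewrite /cohop rmorphB/= scalerBl !opprB addrAC.
have [|[M hM] surj] := @hop_resolvent (sp - m).
  by move=> /andP[_]; rewrite lerBlDr lerDl leNgt m0.
split; first by exists M => f; rewrite e (dotNl D) (dotNr D) opprK.
by move=> y; have [x xy] := surj (- y); exists x; rewrite e xy opprK.
Qed.

Lemma hop_le (f : H) : dot (h f) f <= sp * dot f f.
Proof.
rewrite -subr_ge0 -cohop_dot -[leLHS](mul0r (dot f f)).
apply: (form_lower_bound D) => [|||m m0]; [exact: cohop_linear|exact: cohop_selfadjoint|exact: cohop_form_bounded|].
exact: (cohop_resolvent m0).1.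
Qed.

End Resolvent.

(** * Truncated potentials *)

Section Truncation.
Variables (R : realType) (T : choiceType).
Local Notation H := (ell2 R T).
Local Notation dot := (@dot2 R T).
Let D := @dot2_is_dot R T.

Definition truncation (q : T -> R) (eps : R) x := if eps < q x then q x else 0.

Lemma truncation_bounded (q : T -> R) eps : bounded_potential q -> bounded_potential (truncation q eps).
Proof.
move=> [B hB]; exists B => x; rewrite /truncation; case: ifP => // _.
by rewrite normr0 (le_trans _ (hB x)).
Qed.

Lemma mult_finite_rank (q : T -> R) (eps : R) : bounded_potential q ->
  finite_set [set x | eps < q x] -> exists n (k : 'I_n -> R) (g : 'I_n -> H),
  forall f, finite_rank dot k g f = - mult (truncation q eps) f.
Proof.
move=> bq fin; have bt := truncation_bounded eps bq.
pose s : seq T := finmap.enum_fset (fset_set [set x | eps < q x]).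
pose n := size s; pose g (j : 'I_n) := tnth (in_tuple s) j.
exists n, (fun j => - q (g j)), (fun j => basis_vec R (g j)) => f.
apply: ell2_inj => x; rewrite ell2N mult_apply// /finite_rank ell2_sum.
under eq_bigr => j _.
  rewrite cip_basis_vec ell2Z basis_vecE; over.
have us : uniq s := finmap.fset_uniq _.
have gI : injective g.
  by move=> i j; rewrite /g !(tnth_nth x)/= => /eqP; rewrite nth_uniq// => /eqP /val_inj.
rewrite /truncation; case: ifPn => [qx|qx].
  have xs : x \in s by rewrite /s in_fset_set// inE.
  have /tnthP[j xj] : x \in in_tuple s by [].
  rewrite (bigD1 j)//= big1 ?addr0 => [|i ij]; last first.
    rewrite xj -/(g j) -/(g i) (inj_eq gI) eq_sym (negbTE ij); exact: mulr0.
  by rewrite xj -/(g j) eqxx mulr1 rmorphN mulNr.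
rewrite big1 ?mul0r ?oppr0// => j _.
have : g j \in s by exact: mem_tnth.
rewrite in_fset_set// inE /= => qj.
have [xj|_] := eqVneq x (g j); first by rewrite xj qj in qx.
exact: mulr0.
Qed.

(** A truncation at height [eps] costs [eps] in the quadratic form and leaves a
   finite-rank perturbation, to which [negative_spectrum] applies. *)
Lemma negative_directions (A : H -> H) (q : T -> R) (eps : R) (N : nat) :
  linear A -> selfadjoint dot A -> form_bounded dot A ->
  (forall m, m < 0 -> bounded_below dot A m /\ forall y, exists x, A x - m%:C *: x = y) ->
  bounded_potential q -> 0 < eps -> finite_set [set x | eps < q x] ->
  (forall n e l, eigenfamily dot (fun f => A f - mult (truncation q eps) f) (- eps) n e l ->
    (n <= N)%N) ->
  exists n (e : nat -> H), (n <= N)%N /\ forall f,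
    (forall i, (i < n)%N -> cip dot f (e i) = 0) ->
    - (2 * eps) * dot f f <= dot (A f) f - dot (mult q f) f.
Proof.
move=> linA symA bdA resA bq eps0 fin maxN.
have [n [k [g kg]]] := mult_finite_rank bq fin.
have BE : (fun f => A f + finite_rank dot k g f) = fun f => A f - mult (truncation q eps) f.
  by apply/funext => f; rewrite kg.
have [||n' [e [n'N he]]] := @negative_spectrum R H dot D A (- eps) n k g N linA symA bdA _ resA.
- by rewrite oppr_le0 ltW.
- by move=> n' e l; rewrite BE; exact: maxN.
exists n', e; split=> // f /he; rewrite kg (dotDl D) (dotNl D) => h1.
have bt := truncation_bounded eps bq.
have h2 : dot (mult q f) f <= dot (mult (truncation q eps) f) f + eps * dot f f.
  have s1 := mult_summ f bq; have s2 := mult_summ f bt; have s3 := ell2_summ f.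
  rewrite !mult_form// dot2_self.
  rewrite -(rsumZ eps s3) -(rsumD s2 (summZ eps s3)).
  apply: le_rsum => // [|x]; first exact: summD s2 (summZ eps s3).
  rewrite -mulrDl ler_wpM2r ?sqr_ge0// /truncation.
  by case: ltP => [_|qe]; rewrite ?add0r// lerDl ltW.
lra.
Qed.

End Truncation.

(** * Counting eigenvalues *)

Section EigenCount.
Variables (R : realType) (W : lmodType R[i]) (E : R -> set W) (A : set R).

Lemma dimension_ge0 (S : set W) : (0 <= dimension S)%E.
Proof.
apply: ereal_sup_ubound => /=; exists 0%N => //.
by exists (fun _ => 0); split=> [[]//|c _ []].
Qed.

Lemma eigen_count_ge0 : (0 <= eigen_count E A)%E.
Proof. by apply: esum_ge0 => l _; exact: dimension_ge0. Qed.

(** An independent family of eigenvectors is independent within each level. *)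
Lemma eigen_count_ge (n : nat) (f : 'I_n -> W) (l : 'I_n -> R) :
  (forall i, A (l i)) -> (forall i, E (l i) (f i)) ->
  (forall c : 'I_n -> R[i], \sum_i c i *: f i = 0 -> forall i, c i = 0) ->
  (n%:R%:E <= eigen_count E A)%E.
Proof.
move=> Al El indep.
pose m x := #|[pred i | l i == x]|.
have dimF x : ((m x)%:R%:E <= dimension (E x))%E.
  apply: ereal_sup_ubound => /=; exists (m x) => //.
  exists (fun j => f (enum_val j)); split=> [j|c c0 j].
    have /eqP e : l (enum_val j) == x := enum_valP j.
    by have := El (enum_val j); rewrite e.
  have lj : enum_val j \in [pred i | l i == x] := enum_valP j.
  pose c' i := if l i == x then c (enum_rank_in lj i) else 0.
  have /eqP ej := enum_valP j.
  have := indep c' _ (enum_val j); rewrite /c' enum_valK_in ej eqxx; apply.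
  rewrite (bigID [pred i | l i == x])/= [X in _ + X]big1 ?addr0 => [|i /negbTE ->]; last exact: scale0r.
  rewrite -[RHS]c0 (reindex_omap (@enum_val _ _) (fun i => Some (enum_rank_in lj i))) /=; last first.
    by move=> i ix; rewrite enum_rankK_in.
  apply: eq_big => [i|i ix]; first by rewrite enum_valK_in eqxx andbT; apply/eqP; exact: (eqP (enum_valP i)).
  by rewrite enum_valK_in; case/andP: ix => ->.
pose s := undup [seq l i | i : 'I_n].
apply: (@le_trans _ _ (\sum_(x <- s) dimension (E x))%E).
  have <- : (\sum_(x <- s) (m x)%:R%:E = n%:R%:E :> \bar R)%E.
    rewrite sumEFin -natr_sum; congr (_%:R%:E).
    rewrite -[RHS]card_ord -sum1_card.
    under eq_bigr do rewrite /m -sum1_card big_mkcond.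
    rewrite exchange_big; apply: eq_bigr => i _ /=.
    rewrite -big_mkcond sum1_count -(@eq_count _ (pred1 (l i))) => [|x]; last by rewrite /= inE eq_sym.
    by rewrite count_uniq_mem ?undup_uniq// mem_undup map_f// mem_enum.
  by apply: lee_sum => x _.
apply: esum_ge; exists [set` s].
  split=> [|x /=]; first exact: finite_seq.
  by rewrite mem_undup => /mapP[i _ ->].
by rewrite fsbig_seq ?undup_uniq.
Qed.

(** A finite bound makes every dimension finite, hence attained by a family; so it
   is enough to bound finitely many levels with one family in each. *)
Lemma eigen_count_le (X : \bar R) :
  (forall k (s : 'I_k -> R) (n : 'I_k -> nat) (f : forall j, 'I_(n j) -> W),
    injective s -> (forall j, A (s j)) -> (forall j i, E (s j) (f j i)) ->
    (forall j (c : 'I_(n j) -> R[i]), \sum_i c i *: f j i = 0 -> forall i, c i = 0) ->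
    ((\sum_j n j)%:R%:E <= X)%E) ->
  (eigen_count E A <= X)%E.
Proof.
move=> bound.
have [->|Xfin] := eqVneq X +oo%E; first exact: leey.
have X0 : (0 <= X)%E.
  have := bound 0%N (fun _ => 0) (fun _ => 0%N) (fun _ _ => 0) _ _ _ _.
  by rewrite big_ord0; apply; case.
have [x Xx] : exists x : R, X = x%:E by case: X X0 Xfin {bound} => [x||]//; exists x.
have dims y : A y -> exists m : nat, dimension (E y) = m%:R%:E /\ exists f : 'I_m -> W,
    (forall j, E y (f j)) /\ (forall c : 'I_m -> R[i], \sum_j c j *: f j = 0 -> forall j, c j = 0).
  move=> Ay; pose P m := `[< exists f : 'I_m -> W, (forall j, E y (f j)) /\
    (forall c : 'I_m -> R[i], \sum_j c j *: f j = 0 -> forall j, c j = 0) >].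
  have P0 : exists m, P m by exists 0%N; apply/asboolP; exists (fun _ => 0); split=> [[]//|c _ []].
  have Pub m : P m -> (m <= Num.bound x)%N.
    move=> /asboolP[f [Ef indf]].
    have := bound 1%N (fun _ => y) (fun _ => m) (fun _ => f) _ _ _ _.
    rewrite big_ord1 Xx lee_fin => h.
    rewrite -(ler_nat R) (le_trans (h _ _ _ _))//.
      by move=> i j _; rewrite !ord1.
    by apply/ltW/archi_boundP; rewrite -lee_fin -Xx.
  have [m /asboolP Pm mmax] := ex_maxnP P0 Pub.
  exists m; split=> //; apply/eqP; rewrite eq_le; apply/andP; split.
    by apply: ge_ereal_sup => _ [m' Pm' <-]; rewrite lee_fin ler_nat mmax//; apply/asboolP.
  by apply: ereal_sup_ubound => /=; exists m.
apply: ge_ereal_sup => _ [F [finF FA] <-].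
rewrite fsbig_finite//=; set s := finmap.enum_fset (fset_set F).
have us : uniq s := finmap.fset_uniq _.
have sA j : A (tnth (in_tuple s) j).
  have := mem_tnth j (in_tuple s); rewrite /= /s in_fset_set// inE; exact: FA.
have /choice[n hn] (j : 'I_(size s)) := dims _ (sA j).
pose f j := sval (cid (hn j).2).
have hf j : (forall i, E (tnth (in_tuple s) j) (f j i)) /\
    (forall c : 'I_(n j) -> R[i], \sum_i c i *: f j i = 0 -> forall i, c i = 0).
  exact: (svalP (cid (hn j).2)).
rewrite (big_tnth _ _ s).
under eq_bigr do rewrite (hn _).1.
rewrite sumEFin -natr_sum; apply: (bound _ (tnth (in_tuple s)) n f) => //.
- by move=> i j; rewrite !(tnth_nth 0)/= => /eqP; rewrite nth_uniq// => /eqP /val_inj.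
- by move=> j; exact: (hf j).1.
- by move=> j; exact: (hf j).2.
Qed.

Lemma eigen_count_sub (B : set R) : A `<=` B -> (eigen_count E A <= eigen_count E B)%E.
Proof.
move=> AB; apply: ge_ereal_sup => _ [X [finX XA] <-]; apply: ereal_sup_ubound.
by exists X => //; split=> //; exact: subset_trans AB.
Qed.

End EigenCount.

Lemma eigen_count_split (R : realType) (W : lmodType R[i]) (E : R -> set W) (a b c : R) :
  (eigen_count E [set` `]a, c[ ] <= eigen_count E [set` `]a, b] ] + eigen_count E [set` `[b, c[ ])%E.
Proof.
rewrite {1}/eigen_count (esumID [set` `]a, b]]) => [|l _]; last exact: dimension_ge0.
apply: leeD; apply: eigen_count_sub => l /=; rewrite !in_itv/=; first by case.
case=> /andP[al lc] /negP; rewrite al /= -ltNge => bl.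
by rewrite lc (ltW bl).
Qed.

(** * Power-summable potentials *)

Section LpPotential.
Variables (R : realType) (d : nat) (G : periodic_graph R d) (r : R).
Hypothesis r0 : 0 < r.
Implicit Types q : vert G -> R.

Let pow_ge0 q x : 0 <= `|q x| `^ r. Proof. exact: powR_ge0. Qed.

Lemma lp_norm_pow q : poweR (lp_norm r q) r = nnsum (fun x => `|q x| `^ r).
Proof.
by rewrite /lp_norm -poweRrM mulVf ?gt_eqF// poweRe1//; apply: nnsum_ge0.
Qed.

Lemma lp_spaceP q : lp_space r q <-> summ (fun x => `|q x| `^ r).
Proof.
rewrite summ_nneg// -lp_norm_pow; split=> [|h]; first exact: poweR_lty.
rewrite /lp_space /= ltey; apply: contraTneq h => ->.
by rewrite poweRyr ?gt_eqF// ltxx.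
Qed.

Lemma lp_le q q' : (forall x, `|q x| <= `|q' x|) -> lp_space r q' -> lp_space r q.
Proof.
move=> le /lp_spaceP s'; apply/lp_spaceP; apply: (summ_le _ s') => x.
by rewrite ger0_norm// ge0_ler_powR// ?ltW// nnegrE.
Qed.

Lemma lpZ (k : R) q : lp_space r q -> lp_space r (fun x => k * q x).
Proof.
move=> /lp_spaceP s; apply/lp_spaceP; have := summZ (`|k| `^ r) s.
by congr summ; apply/funext => x; rewrite normrM powRM.
Qed.

Lemma lpD q q' : lp_space r q -> lp_space r q' -> lp_space r (fun x => q x + q' x).
Proof.
move=> /lp_spaceP s /lp_spaceP s'; apply/lp_spaceP.
apply: (@summ_le _ _ _ (fun x => 2 `^ r * (`|q x| `^ r + `|q' x| `^ r))); last first.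
  by apply: summZ; exact: summD.
move=> x; rewrite ger0_norm ?powR_ge0//.
apply: (@le_trans _ _ ((2 * Num.max `|q x| `|q' x|) `^ r)).
  rewrite ge0_ler_powR ?nnegrE ?mulr_ge0 ?le_max ?normr_ge0 ?(ltW r0)//.
  apply: le_trans (ler_normD _ _) _; rewrite [2]mulr2n mulrDl mul1r.
  by apply: lerD; rewrite le_max lexx ?orbT.
rewrite powRM ?le_max ?normr_ge0// ler_wpM2l ?powR_ge0//.
by case: (leP `|q x| `|q' x|) => _; rewrite ?lerDl ?lerDr powR_ge0.
Qed.

Lemma lp_bounded q : lp_space r q -> bounded_potential q.
Proof.
move=> /lp_spaceP s; exists (rsum (fun x => `|q x| `^ r) `^ r^-1) => x.
have h := rsum_ge x (pow_ge0 q) s.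
rewrite -[leLHS](@powRr1 _ `|q x|)// -(mulfV (lt0r_neq0 r0)) powRrM.
by rewrite ge0_ler_powR// ?invr_ge0 ?ltW// nnegrE ?powR_ge0// rsum_ge0.
Qed.

(** Chebyshev: [n] vertices of the level set contribute at least [n eps^r]. *)
Lemma lp_level_finite q (eps : R) : 0 < eps -> lp_space r q -> finite_set [set x | eps < q x].
Proof.
move=> e0 /lp_spaceP s; apply: contrapT => inf.
pose S := rsum (fun x => `|q x| `^ r).
have S0 : 0 <= S by exact: rsum_ge0.
have er : 0 < eps `^ r by exact: powR_gt0.
have [B BA nB] := infinite_set_fset (Num.bound (S / eps `^ r)).+1 inf.
have : ((Num.bound (S / eps `^ r)).+1%:R * eps `^ r <= S).
  rewrite -lee_fin /S rsum_nnegE//; apply: esum_ge; pose b : seq (vert G) := finmap.enum_fset B.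
  exists [set` b]; first by split=> //; exact: finite_seq.
  rewrite -fsbig_seq ?finmap.fset_uniq// sumEFin lee_fin.
  apply: (@le_trans _ _ (\sum_(x <- b) eps `^ r)).
    rewrite big_const_seq count_predT iter_addr_0 -[leRHS]mulr_natl ler_wpM2r ?(ltW er)// ler_nat.
    exact: nB.
  rewrite big_seq [leRHS]big_seq; apply: ler_sum => x xB.
  have /= h := BA x xB.
  by rewrite ge0_ler_powR ?nnegrE ?(ltW r0) ?(ltW e0)// (le_trans (ltW h))// ler_norm.
apply/negP; rewrite -ltNge -ltr_pdivrMr//.
apply: lt_le_trans (archi_boundP _) _; first by rewrite divr_ge0// ltW.
by rewrite ler_nat.
Qed.

End LpPotential.

(** * Eigenvalue bounds for time-independent perturbations *)

Section SignedParts.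
Variable R : realType.
Implicit Type z : R.

Lemma neg_partN z : neg_part (- z) = pos_part z.
Proof. by rewrite /neg_part normrN opprK. Qed.

Lemma neg_part_ge z : 0 <= neg_part z /\ - neg_part z <= z.
Proof.
rewrite /neg_part; have [z0|z0] := leP 0 z; first by rewrite ger0_norm// subrr mul0r oppr0.
by rewrite ltr0_norm//; split; lra.
Qed.

Lemma pos_part_ge z : 0 <= pos_part z /\ z <= pos_part z.
Proof.
rewrite /pos_part; have [z0|z0] := leP 0 z; first by rewrite ger0_norm//; split; lra.
by rewrite ltr0_norm// addNr mul0r; split=> //; exact: ltW.
Qed.

End SignedParts.

Section StationaryCount.
Variables (R : realType) (d : nat) (G : periodic_graph R d) (p : vert G -> R) (sp : R).
Hypothesis perp : periodic_potential p.
Hypothesis d0 : (0 < d)%N.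
Local Notation C := R[i].
Local Notation H := (ell2 R (vert G)).
Local Notation dot := (@dot2 R (vert G)).
Local Notation h := (hop perp).
Local Notation r := (d%:R / 2 : R).
Let D := @dot2_is_dot R (vert G).

Let r0 : 0 < r. Proof. by rewrite divr_gt0// ltr0n. Qed.

Lemma orthonormal_independent n (e : nat -> H) :
  (forall i j, (i < n)%N -> (j < n)%N -> cip dot (e i) (e j) = (i == j)%:R) ->
  forall c : 'I_n -> C, \sum_i c i *: (e i : vert G -> C^o) = 0 -> forall i, c i = 0.
Proof.
move=> eo c c0 j.
have s0 : \sum_i c i *: e i = 0.
  apply: ell2_inj => x; rewrite ell2_sum ell2_0.
  by have := congr1 (fun g => g x) c0; rewrite fct_sumE.
have := congr1 (fun f => cip dot f (e j)) s0.
rewrite (cip_suml D) (cip0l D) (bigD1 j)//= (cipZl D) eo// eqxx mulr1 big1 ?addr0// => i ij.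
by rewrite (cipZl D) eo// (_ : (i == j :> nat) = false) ?mulr0//; exact: negbTE.
Qed.

Lemma eigenspace_hop (q : vert G -> R) (l : R) (f : H) : bounded_potential q ->
  h f + mult q f = l%:C *: f -> eigenspace_l2 p q l f.
Proof.
move=> bq e; split; first by apply/l2_sqsumm; exact: ell2P.
apply/funext => x; have := congr1 (fun g : H => g x) e.
rewrite ell2D mult_apply// hopE => e1; apply: etrans e1.
by rewrite /schrodinger rmorphD mulrDl addrA.
Qed.

Lemma truncation_le (q : vert G -> R) eps : (forall x, 0 <= q x) -> forall x, `|truncation q eps x| <= `|q x|.
Proof. by move=> q0 x; rewrite /truncation; case: ifP => // _; rewrite normr0. Qed.

(* For this potential, or its opposite, the sums in the two estimates at [mu = s + 1]
   and [mu = - 1] are equal to 1, so that the estimates give [0 <= K]. *)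
Let bump (x0 x : vert G) : R := 2 * (x == x0)%:R.

Let bump_lp x0 : lp_space r (bump x0).
Proof.
apply/(lp_spaceP r0)/(@summ_single _ _ x0) => x /negbTE xx0.
by rewrite /bump xx0 mulr0 normr0 powR0// gt_eqF.
Qed.

Let bump_sum x0 : nnsum (fun x => pos_part (bump x0 x - 1) `^ r) = 1%E.
Proof.
rewrite -rsum_nnegE => [|x|]; last 1 first.
- apply: (@summ_single _ _ x0) => x /negbTE xx0.
  by rewrite /bump xx0 /pos_part mulr0 add0r normrN normr1 subrr mul0r powR0// gt_eqF.
- rewrite (@rsum_single _ _ x0) => [|x /negbTE xx0].
    rewrite /bump eqxx mulr1 /pos_part (_ : 2 - 1 = 1 :> R); last by ring.
    by rewrite normr1 (_ : (1 + 1) / 2 = 1 :> R) ?powR1//; field.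
  by rewrite /bump xx0 /pos_part mulr0 add0r normrN normr1 subrr mul0r powR0// gt_eqF.
- exact: powR_ge0.
Qed.

Lemma ks_minus_ge0 K : ks_minus p K -> 0 <= K.
Proof.
move=> ks; have [x0 _] := vert_inhabited G.
have := ks (fun x => - 1 * bump x0 x) (-1) (lpZ r0 (-1) (bump_lp x0)) (ltrN10 R).
have -> : (\esum_(x in [set: vert G]) (neg_part (- 1 * bump x0 x - -1) `^ r)%:E = 1)%E.
  rewrite -(bump_sum x0); congr nnsum; apply/funext => x; congr (_ `^ _).
  by rewrite -neg_partN; congr neg_part; ring.
by rewrite mule1 => hK; rewrite -lee_fin (le_trans _ hK)// eigen_count_ge0.
Qed.

Lemma ks_plus_ge0 K : ks_plus p sp K -> 0 <= K.
Proof.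
move=> ks; have [x0 _] := vert_inhabited G.
have sp1 : sp < sp + 1 by rewrite ltrDl.
have := ks (bump x0) (sp + 1) (bump_lp x0) sp1.
have -> : (\esum_(x in [set: vert G]) (pos_part (bump x0 x - (sp + 1) + sp) `^ r)%:E = 1)%E.
  rewrite -(bump_sum x0); congr nnsum; apply/funext => x; congr (pos_part _ `^ _).
  by ring.
by rewrite mule1 => hK; rewrite -lee_fin (le_trans _ hK)// eigen_count_ge0.
Qed.

Let part_le (q : vert G -> R) (eps : R) x : (forall x, 0 <= q x) -> 0 < eps ->
  pos_part (truncation q eps x - eps) `^ r <= `|q x| `^ r.
Proof.
move=> q0 e0; have := q0 x; rewrite /truncation /pos_part => qx.
have h : 0 <= (`|(if eps < q x then q x else 0) - eps| + ((if eps < q x then q x else 0) - eps)) / 2 <= q x.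
  case: ifPn => eq; first by rewrite gtr0_norm ?subr_gt0//; apply/andP; split; lra.
  by rewrite ltr0_norm ?sub0r ?oppr_lt0//; apply/andP; split; lra.
case/andP: h => h1 h2.
by apply: ge0_ler_powR; rewrite ?nnegrE ?(ltW r0)// (ger0_norm (q0 x)).
Qed.

(** Eigenvectors of [h - q'] below [- eps], for the truncation [q' <= q], are counted
   by the estimate at [mu = - eps], where [(q' - eps)_+ <= q]. *)
Lemma ks_minus_family K (q : vert G -> R) (eps : R) n e l : ks_minus p K ->
  (forall x, 0 <= q x) -> lp_space r q -> 0 < eps ->
  eigenfamily dot (fun f => h f - mult (truncation q eps) f) (- eps) n e l ->
  (n%:R%:E <= K%:E * nnsum (fun x => (`|q x| `^ r)%R))%E.
Proof.
move=> ks q0 lq e0 [eo eB].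
have lt : lp_space r (truncation q eps) := lp_le r0 (truncation_le eps q0) lq.
have bt := lp_bounded r0 lt.
have lmt : lp_space r (fun x => -1 * truncation q eps x) := lpZ r0 (-1) lt.
have bmt := lp_bounded r0 lmt.
apply: (@le_trans _ _ (eigen_count (eigenspace_l2 p (fun x => -1 * truncation q eps x)) [set m | m < - eps])).
  apply: (@eigen_count_ge _ _ _ _ _ (fun i : 'I_n => e i : vert G -> C^o) (fun i : 'I_n => l i)).
  - by move=> i; exact: (eB i (ltn_ord i)).1.
  - move=> i; apply: eigenspace_hop => //; rewrite -(eB i (ltn_ord i)).2; congr (_ + _).
    by apply: ell2_inj => x; rewrite ell2N !mult_apply// rmorphM rmorphN1 mulN1r mulNr.
  - exact: orthonormal_independent.
apply: le_trans (ks _ _ lmt _) _; first by rewrite oppr_lt0.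
apply: lee_wpmul2l; first by rewrite lee_fin; exact: ks_minus_ge0 ks.
apply: le_nnsum => x; apply: le_trans (part_le x q0 e0).
rewrite -neg_partN (_ : -1 * _ - - eps = - (truncation q eps x - eps)) //; ring.
Qed.

(** [(s - h - q') e = l e] means [(h + q') e = (s - l) e]. *)
Lemma ks_plus_family K (q : vert G -> R) (eps : R) n e l : ks_plus p sp K ->
  (forall x, 0 <= q x) -> lp_space r q -> 0 < eps ->
  eigenfamily dot (fun f => cohop sp perp f - mult (truncation q eps) f) (- eps) n e l ->
  (n%:R%:E <= K%:E * nnsum (fun x => (`|q x| `^ r)%R))%E.
Proof.
move=> ks q0 lq e0 [eo eB].
have lt : lp_space r (truncation q eps) := lp_le r0 (truncation_le eps q0) lq.
have bt := lp_bounded r0 lt.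
apply: (@le_trans _ _ (eigen_count (eigenspace_l2 p (truncation q eps)) [set m | sp + eps < m])).
  apply: (@eigen_count_ge _ _ _ _ _ (fun i : 'I_n => e i : vert G -> C^o) (fun i : 'I_n => sp - l i)).
  - by move=> i /=; rewrite ltrD2l ltrNr; exact: (eB i (ltn_ord i)).1.
  - move=> i; apply: eigenspace_hop => //; rewrite rmorphB scalerBl -(eB i (ltn_ord i)).2.
    by rewrite /cohop -[_ - _ - mult _ _]addrA -opprD subKr.
  - exact: orthonormal_independent.
apply: le_trans (ks _ _ lt _) _; first by rewrite ltrDl.
apply: lee_wpmul2l; first by rewrite lee_fin; exact: ks_plus_ge0 ks.
apply: le_nnsum => x; apply: le_trans (part_le x q0 e0).
by rewrite opprD addrA addrAC subrK.
Qed.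

End StationaryCount.

(** * Integrals over time intervals *)

Section IntervalIntegrals.
Variables (R : realType).
Local Notation leb := (@lebesgue_measure R).
Implicit Types (u w : R -> R) (a b : R).

Lemma lebesgue_itvcc a b : a <= b -> leb `[a, b] = (b - a)%:E.
Proof.
move=> ab; rewrite lebesgue_measure_itv /= lte_fin; case: ltP => // ba.
by rewrite (le_anti (_ : a <= b <= a)) ?ab// subrr.
Qed.

Lemma integrable_cst_itv a b (c : R) : leb.-integrable `[a, b] (EFin \o (fun=> c)).
Proof.
apply: measurable_bounded_integrable => //.
- have [ab|ba] := leP a b; first by rewrite [ltLHS](lebesgue_itvcc ab) ltry.
  by rewrite set_itv_ge ?measure0// bnd_simp -ltNge.
- by exists `|c|; split=> // M cM x _ /=; exact: ltW.
Qed.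

Lemma Rintegral_cst_itv a b (c : R) : a <= b -> (\int[leb]_(t in `[a, b]) c)%R = c * (b - a).
Proof. 
move=> ab; rewrite Rintegral_cst//; congr (_ * _).
by have /= := lebesgue_itvcc ab; rewrite /leb => ->. Qed.

Lemma integrable_of_square u a b : measurable_fun setT u ->
  leb.-integrable `[a, b] (EFin \o (fun t => u t ^+ 2)) ->
  leb.-integrable `[a, b] (EFin \o u).
Proof.
move=> mu iu; apply: (@le_integrable _ _ _ leb `[a, b] _ _ (EFin \o (fun t => 1 + u t ^+ 2))) => //.
- by apply/measurable_EFinP; exact: measurable_funS mu.
- move=> t _ /=; rewrite lee_fin.
  rewrite [leRHS]ger0_norm; last by rewrite addr_ge0 ?sqr_ge0.
  have := sqr_ge0 (`|u t| - 1); rewrite -(real_normK (num_real (u t))).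
  have := normr_ge0 (u t); move: `|u t| => z; nra.
- apply: eq_integrable (integrableD _ (integrable_cst_itv a b 1) iu) => //.
Qed.

(** The square of [u] minus its mean has a nonnegative integral. *)
Lemma Rintegral_cauchy_schwarz u a b : a <= b -> measurable_fun setT u ->
  leb.-integrable `[a, b] (EFin \o (fun t => u t ^+ 2)) ->
  (\int[leb]_(t in `[a, b]) u t)%R ^+ 2 <= (b - a) * (\int[leb]_(t in `[a, b]) (u t ^+ 2))%R.
Proof.
move=> ab mu iu2; have iu := integrable_of_square mu iu2.
set I1 := (\int[leb]_(t in _) _)%R; set I2 := (\int[leb]_(t in _) _)%R.
have [ab1|ab'] := eqVneq a b.
  by rewrite /I1 ab1 set_itv1 Rintegral_set1 expr0n subrr mul0r.
have L0 : 0 < b - a by rewrite subr_gt0 lt_neqAle ab'.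
pose m := I1 / (b - a).
have : 0 <= (\int[leb]_(t in `[a, b]) (u t ^+ 2 - (2 * m * u t - m ^+ 2)))%R.
  by apply: Rintegral_ge0 => t _; have := sqr_ge0 (u t - m); lra.
have iZ : leb.-integrable `[a, b] (EFin \o (fun t => 2 * m * u t)).
  by apply: eq_integrable (integrableZl _ _ iu) => //.
have ic := integrable_cst_itv a b (m ^+ 2).
rewrite RintegralB//; last by apply: eq_integrable (integrableB _ iZ ic) => //.
rewrite RintegralB// RintegralZl// Rintegral_cst_itv// -/I1 -/I2 /m.
move: {m iZ ic} I1 I2 (b - a) L0 => I1 I2 L L0.
have -> : 2 * (I1 / L) * I1 - (I1 / L) ^+ 2 * L = I1 ^+ 2 / L by field; rewrite gt_eqF.
by rewrite subr_ge0 ler_pdivrMr// mulrC.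
Qed.

Lemma Rintegral_le_cst w a b (B : R) : a <= b -> 0 <= B -> leb.-integrable `[a, b] (EFin \o w) ->
  {ae leb, forall t, `[a, b]%classic t -> `|w t| <= B} ->
  `|(\int[leb]_(t in `[a, b]) w t)%R| <= B * (b - a).
Proof.
move=> ab B0 iw wB; have [mw _] := integrableP _ _ _ iw.
apply: le_trans (le_normr_Rintegral _ iw) _ => //.
have iN : leb.-integrable `[a, b] (EFin \o (fun t => `|w t|)) := integrable_norm iw.
have [mN _] := integrableP _ _ _ iN.
have ic := integrable_cst_itv a b B; have [mc _] := integrableP _ _ _ ic.
rewrite -Rintegral_cst_itv// -lee_fin /Rintegral !fineK; last 2 first.
- exact: integrable_fin_num ic.
- exact: integrable_fin_num iN.
exact: ae_ge0_le_integral.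
Qed.

Lemma integrable_sub u a b a' b' : a <= a' -> b' <= b ->
  leb.-integrable `[a, b] (EFin \o u) -> leb.-integrable `[a', b'] (EFin \o u).
Proof.
move=> aa bb; apply: integrableS => //.
by apply: subset_itv; rewrite bnd_simp.
Qed.

Lemma Rintegral_split u a b c : a <= b -> b <= c -> leb.-integrable `[a, c] (EFin \o u) ->
  (\int[leb]_(t in `[a, c]) u t)%R - (\int[leb]_(t in `[a, b]) u t)%R =
  (\int[leb]_(t in `[b, c]) u t)%R.
Proof.
move=> ab bc iu; rewrite Rintegral_itvB ?bnd_simp//; apply: Rintegral_itv_obnd_cbnd.
apply: integrableS iu => //; apply: subset_itv; rewrite bnd_simp//.
Qed.

Lemma Rintegral_mono u a b a' b' : a <= a' -> b' <= b -> (forall t, 0 <= u t) ->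
  leb.-integrable `[a, b] (EFin \o u) ->
  (\int[leb]_(t in `[a', b']) u t)%R <= (\int[leb]_(t in `[a, b]) u t)%R.
Proof.
move=> aa bb u0 iu; have [mu _] := integrableP _ _ _ iu.
rewrite -lee_fin /Rintegral !fineK; last 2 first.
- exact: integrable_fin_num iu.
- exact: integrable_fin_num (integrable_sub aa bb iu).
apply: ge0_subset_integral => //; first by move=> t _; rewrite lee_fin.
by apply: subset_itv; rewrite bnd_simp.
Qed.

(** With [u] the velocity and [v] the potential, this compares a solution with the
   same state frozen during a time step. *)
Lemma Rintegral_near_affine u v a b (a0 a1 B : R) : a <= b -> 0 <= B ->
  leb.-integrable `[a, b] (EFin \o u) -> leb.-integrable `[a, b] (EFin \o v) ->
  {ae leb, forall t, `[a, b]%classic t -> `|u t - (a0 + a1 * v t)| <= B} ->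
  `|(\int[leb]_(t in `[a, b]) u t)%R
     - (a0 * (b - a) + a1 * (\int[leb]_(t in `[a, b]) v t)%R)| <= B * (b - a).
Proof.
move=> ab B0 iu iv near_uv.
have ic := integrable_cst_itv a b a0.
have iZ : leb.-integrable `[a, b] (EFin \o (fun t => a1 * v t)).
  by apply: eq_integrable (integrableZl _ _ iv) => //.
have iA : leb.-integrable `[a, b] (EFin \o (fun t => a0 + a1 * v t)).
  by apply: eq_integrable (integrableD _ ic iZ) => //.
have iB : leb.-integrable `[a, b] (EFin \o (fun t => u t - (a0 + a1 * v t))).
  by apply: eq_integrable (integrableB _ iu iA) => //.
have := Rintegral_le_cst ab B0 iB near_uv.
by rewrite RintegralB// RintegralD// RintegralZl// Rintegral_cst_itv.
Qed.

End IntervalIntegrals.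

(** * Eigenfunctions of the time-periodic operator *)

Section Energy.
Variables (R : realType) (d : nat) (G : periodic_graph R d) (tau : R).
Hypothesis tau0 : 0 < tau.
Local Notation C := R[i].
Local Notation X := (R -> vert G -> C^o).
Local Notation leb := (@lebesgue_measure R).
Implicit Types (f g : X).

Definition energy g x : R := (\int[leb]_(t in `[0%R, tau]) (normc (g t x : C) ^+ 2))%R.

Lemma L2_per_energy g : L2_per tau g -> summ (energy g) /\
  forall x, leb.-integrable `[0, tau] (EFin \o (fun t => normc (g t x : C) ^+ 2)).
Proof.
move=> [_ mg fin].
have ige x : (0 <= \int[leb]_(t in `[0%R, tau]) (normc (g t x : C) ^+ 2)%:E)%E.
  by apply: integral_ge0 => t _; rewrite lee_fin sqr_ge0.
have ifin x : (\int[leb]_(t in `[0%R, tau]) (normc (g t x : C) ^+ 2)%:E < +oo)%E.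
  apply: le_lt_trans fin; apply: esum_ge; exists [set x]; last by rewrite fsbig_set1.
  by split=> //; exact: finite_set1.
have ig x : leb.-integrable `[0, tau] (EFin \o (fun t => normc (g t x : C) ^+ 2)).
  apply/integrableP; split.
    apply/measurable_EFinP; have [mr mi] := mg x.
    rewrite (_ : (fun t => _) = fun t => complex.Re (g t x : C) ^+ 2 + complex.Im (g t x : C) ^+ 2).
      by apply: measurable_funD; apply: measurable_funX;
        exact: measurable_funS mr || exact: measurable_funS mi.
    by apply/funext => t; rewrite normc_sqr.
  by under eq_integral => t _ do rewrite /= ger0_norm ?sqr_ge0//; exact: ifin.
split=> //; apply/summ_nneg => [x|]; first by apply: Rintegral_ge0 => t _; exact: sqr_ge0.
rewrite /nnsum; apply: le_lt_trans fin; apply: le_esum => x _.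
by rewrite /energy /Rintegral fineK// ge0_fin_numE.
Qed.

Lemma L2_per_integrable g x : L2_per tau g ->
  [/\ leb.-integrable `[0, tau] (EFin \o (fun t => complex.Re (g t x : C) ^+ 2)),
      leb.-integrable `[0, tau] (EFin \o (fun t => complex.Im (g t x : C) ^+ 2)),
      leb.-integrable `[0, tau] (EFin \o (fun t => complex.Re (g t x : C)))
    & leb.-integrable `[0, tau] (EFin \o (fun t => complex.Im (g t x : C)))].
Proof.
move=> Lg; have [_ /(_ x) ig] := L2_per_energy Lg; have [_ /(_ x)[mr mi] _] := Lg.
have ir : leb.-integrable `[0, tau] (EFin \o (fun t => complex.Re (g t x : C) ^+ 2)).
  apply: le_integrable ig => //.
    by apply/measurable_EFinP; apply: measurable_funX; exact: measurable_funS mr.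
  by move=> t _ /=; rewrite lee_fin !ger0_norm ?sqr_ge0// normc_sqr lerDl sqr_ge0.
have ii : leb.-integrable `[0, tau] (EFin \o (fun t => complex.Im (g t x : C) ^+ 2)).
  apply: le_integrable ig => //.
    by apply/measurable_EFinP; apply: measurable_funX; exact: measurable_funS mi.
  by move=> t _ /=; rewrite lee_fin !ger0_norm ?sqr_ge0// normc_sqr lerDr sqr_ge0.
by split=> //; exact: integrable_of_square.
Qed.

Lemma increment f g s t x : time_derivative tau f g -> 0 <= s -> s <= t -> t <= tau ->
  f t x - f s x = cintegral `[s, t] (fun r => g r x).
Proof.
move=> [_ Lg fg] s0 st tt; have [_ _ ir ii] := L2_per_integrable x Lg.
rewrite (fg t) ?(le_trans s0 st)// (fg s) ?s0 ?(le_trans st tt)//.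
rewrite opprD addrACA subrr add0r /cintegral.
rewrite -(Rintegral_split s0 st (integrable_sub (lexx _) tt ir)).
by rewrite -(Rintegral_split s0 st (integrable_sub (lexx _) tt ii)).
Qed.

Lemma energy_ge0 g x : 0 <= energy g x.
Proof. by apply: Rintegral_ge0 => t _; exact: sqr_ge0. Qed.

(** Square-integrable velocity gives Hoelder continuity with exponent 1/2. *)
Lemma increment_le f g s t x : time_derivative tau f g -> 0 <= s <= tau -> 0 <= t <= tau ->
  normc (f s x - f t x) ^+ 2 <= `|s - t| * energy g x.
Proof.
move=> fg; have [_ Lg _] := fg.
have [ir2 ii2 ir ii] := L2_per_integrable x Lg; have [_ /(_ x)[mr mi] _] := Lg.
have [_ /(_ x) ig] := L2_per_energy Lg.
wlog st : s t / s <= t => [wl sI tI|/andP[s0 _] /andP[_ tt]].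
  have [st|/ltW ts] := leP s t; first exact: wl.
  by have := wl _ _ ts tI sI; rewrite distrC normc_distC.
rewrite distrC (ger0_norm (_ : 0 <= t - s)) ?subr_ge0//.
rewrite normc_distC (increment x fg s0 st tt) normc_sqr /=.
have h1 := Rintegral_cauchy_schwarz st mr (integrable_sub s0 tt ir2).
have h2 := Rintegral_cauchy_schwarz st mi (integrable_sub s0 tt ii2).
apply: le_trans (lerD h1 h2) _; rewrite -mulrDr ler_wpM2l ?subr_ge0//.
rewrite -RintegralD//; [|exact: integrable_sub ir2|exact: integrable_sub ii2].
apply: (@le_trans _ _ (\int[leb]_(r in `[s, t]) (normc (g r x : C) ^+ 2))%R).
  by rewrite le_eqVlt; apply/orP; left; apply/eqP; apply: eq_Rintegral => r _; rewrite normc_sqr.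
apply: Rintegral_mono => // r; exact: sqr_ge0.
Qed.

(** The value at one time is controlled by the mean over the period and by the
   energy of the velocity, both summable over vertices. *)
Lemma time_derivative_sqsumm f g t : time_derivative tau f g -> 0 <= t <= tau ->
  f t \in @sqsumm R (vert G).
Proof.
move=> fg tI; have [Lf Lg _] := fg.
have [sf iff_] := L2_per_energy Lf; have [sg _] := L2_per_energy Lg.
apply/sqsummP; apply: (@summ_le _ _ _ (fun x => 2 / tau * energy f x + 2 * tau * energy g x)); last first.
  by apply: summD; exact: summZ.
move=> x; rewrite ger0_norm ?sqr_ge0//.
pose c := normc (f t x : C) ^+ 2 - 2 * tau * energy g x.
have ic := integrable_cst_itv 0 tau c.
have i2 : leb.-integrable `[0, tau] (EFin \o (fun s => 2 * normc (f s x : C) ^+ 2)).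
  by apply: eq_integrable (integrableZl _ _ (iff_ x)) => //.
have h : (\int[leb]_(s in `[0%R, tau]) c)%R <= (\int[leb]_(s in `[0%R, tau]) (2 * normc (f s x : C) ^+ 2))%R.
  apply: le_Rintegral => // s; rewrite /= in_itv/= => sI; rewrite /c.
  have h1 := increment_le x fg tI sI.
  have h2 : `|t - s| * energy g x <= tau * energy g x.
    rewrite ler_wpM2r ?energy_ge0// ler_norml; case/andP: tI sI => ? ? /andP[? ?].
    by apply/andP; split; lra.
  have := normcD_sqr (f t x - f s x) (f s x); rewrite subrK; lra.
move: h; rewrite RintegralZl// (Rintegral_cst_itv _ (ltW tau0)) subr0 -/(energy f x) /c => h.
rewrite -subr_ge0 in h; rewrite -subr_ge0 -(pmulr_rge0 _ tau0).
apply: le_trans h _; rewrite le_eqVlt; apply/orP; left; apply/eqP; field.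
exact: lt0r_neq0.
Qed.

End Energy.

Section Discretization.
Variables (R : realType) (d : nat) (G : periodic_graph R d) (tau : R) (p : vert G -> R).
Variables (V : R -> vert G -> R) (B : R).
Hypothesis tau0 : 0 < tau.
Hypothesis perp : periodic_potential p.
Hypothesis V_meas : forall x, measurable_fun setT (fun t => V t x).
Hypothesis V_bounded : forall t x, `|V t x| <= B.
Local Notation C := R[i].
Local Notation T := (vert G).
Local Notation H := (ell2 R (vert G)).
Local Notation dot := (@dot2 R (vert G)).
Local Notation X := (R -> vert G -> C^o).
Local Notation leb := (@lebesgue_measure R).
Let D := @dot2_is_dot R (vert G).

(** The potential is merely measurable in time; averaging it over each time step
   keeps its one-sided bounds. *)
Definition step_potential (M k : nat) (x : T) : R :=
  M%:R / tau * (\int[leb]_(t in `[(k%:R * (tau / M%:R))%R, (k.+1%:R * (tau / M%:R))%R]) V t x)%R.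

Lemma V_integrable a b x : leb.-integrable `[a, b] (EFin \o (fun t => V t x)).
Proof.
apply: (le_integrable _ _ _ (integrable_cst_itv a b B)) => //.
  by apply/measurable_EFinP; exact: measurable_funS (V_meas x).
by move=> t _ /=; rewrite lee_fin (le_trans (V_bounded t x))// ler_norm.
Qed.

Let step_le M k : k%:R * (tau / M%:R) <= k.+1%:R * (tau / M%:R).
Proof. by rewrite ler_wpM2r ?divr_ge0 ?(ltW tau0)// ler_nat. Qed.

Let step_size (M k : nat) : k.+1%:R * (tau / M%:R) - k%:R * (tau / M%:R) = tau / M%:R.
Proof. by rewrite -mulrBl -natrB// subSnn mul1r. Qed.

Let step_cancel (M : nat) (b : R) : M.+1%:R / tau * (b * (tau / M.+1%:R)) = b.
Proof.
have m0 : M.+1%:R != 0 :> R by rewrite pnatr_eq0.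
have t0 := lt0r_neq0 tau0.
by move: (M.+1%:R : R) m0 => m m0; field; rewrite m0 t0.
Qed.

Lemma step_potential_le M k x b : 0 <= b -> (forall t, V t x <= b) -> step_potential M k x <= b.
Proof.
move=> b0 Vb; rewrite /step_potential; case: M => [|M]; first by rewrite mul0r mul0r.
rewrite -[leRHS](step_cancel M) ler_wpM2l ?divr_ge0 ?(ltW tau0)//.
have := Rintegral_cst_itv b (step_le M.+1 k); rewrite step_size => <-.
apply: le_Rintegral => //; [exact: V_integrable|exact: integrable_cst_itv].
Qed.

Lemma step_potential_ge M k x b : 0 <= b -> (forall t, - b <= V t x) -> - b <= step_potential M k x.
Proof.
move=> b0 Vb; rewrite /step_potential; case: M => [|M]; first by rewrite mul0r mul0r oppr_le0.
rewrite -[leLHS](step_cancel M) ler_wpM2l ?divr_ge0 ?(ltW tau0)//.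
have := Rintegral_cst_itv (- b) (step_le M.+1 k); rewrite step_size => <-.
apply: le_Rintegral => //; [exact: integrable_cst_itv|exact: V_integrable].
Qed.

Lemma step_potential_bounded M k : bounded_potential (step_potential M k).
Proof.
have [x0 _] := vert_inhabited G.
have B0 : 0 <= B by rewrite (le_trans _ (V_bounded 0 x0)).
exists B => x; rewrite ler_norml; apply/andP; split.
  by apply: step_potential_ge => // t; have := V_bounded t x; rewrite ler_norml => /andP[].
by apply: step_potential_le => // t; have := V_bounded t x; rewrite ler_norml => /andP[].
Qed.

Definition floquet_step (M k : nat) (f : H) : H := hop perp f + mult (step_potential M k) f.

(** [insubd] makes this total; square-summability of [f t] is proved, and needed,
   during the first period only. *)
Definition trajectory (f : X) (t : R) : H := insubd 0 (f t).

Lemma trajectoryE f g t : time_derivative tau f g -> 0 <= t <= tau -> trajectory f t = f t :> (T -> C^o).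
Proof. by move=> fg tI; rewrite /trajectory insubdK//; exact: (time_derivative_sqsumm tau0 fg tI). Qed.

Lemma floquet_velocity f g (l : R) x :
  {ae leb, forall t, (l%:C *: f) t x = - ('i%C * g t x) + schrodinger p (f t) x + (V t x)%:C * f t x} ->
  {ae leb, forall t, g t x = 'i%C * (l%:C * f t x - schrodinger p (f t) x - (V t x)%:C * f t x)}.
Proof.
have FF : Filter (nbhs (almost_everywhere leb)) by exact: ae_filter_ringOfSetsType.
apply: filterS => t e.
have {}e : l%:C * f t x = - ('i%C * g t x) + schrodinger p (f t) x + (V t x)%:C * f t x by [].
rewrite e (_ : _ - _ - _ = - ('i%C * g t x)); last by ring.
case: (g t x) => a b; apply/eqP.
by rewrite eq_complex /= ; apply/andP; split; apply/eqP; ring.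
Qed.

(** On a short time interval the velocity is, up to the oscillation of [f], that of
   the frozen state [m] in the potential [V t]. *)
Lemma velocity_near f g (l : R) x (a c b : R) (m : H) : 0 <= a -> c <= tau -> 0 <= b ->
  time_derivative tau f g ->
  {ae leb, forall t, (l%:C *: f) t x = - ('i%C * g t x) + schrodinger p (f t) x + (V t x)%:C * f t x} ->
  (forall t v, a <= t <= c -> v = trajectory f t - m ->
    normc (l%:C * v x - hop perp v x - (V t x)%:C * v x) ^+ 2 <= b) ->
  {ae leb, forall t, `[a, c]%classic t ->
    normc (g t x - 'i%C * (l%:C * m x - hop perp m x - (V t x)%:C * m x)) <= Num.sqrt b}.
Proof.
move=> a0 ctau b0 fg eqf near_mid.
have FF : Filter (nbhs (almost_everywhere leb)) by exact: ae_filter_ringOfSetsType.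
apply: filterS (floquet_velocity eqf) => t e tI.
have {}tI : a <= t <= c by move: tI; rewrite /= in_itv.
have tau_t : 0 <= t <= tau by case/andP: tI => h1 h2; rewrite (le_trans a0 h1) (le_trans h2 ctau).
have h := near_mid t _ tI erefl.
rewrite -ler_sqr ?nnegrE ?normc_ge0 ?sqrtr_ge0// sqr_sqrtr//; apply: le_trans h.
have -> : hop perp (trajectory f t - m) x = schrodinger p (f t) x - hop perp m x.
  by rewrite (linBr (hop_linear perp)) ell2D ell2N hopE (trajectoryE fg tau_t).
have -> : (trajectory f t - m) x = f t x - m x by rewrite ell2D ell2N (trajectoryE fg tau_t).
rewrite e -mulrBr ComplexField.Normc.normcM (_ : normc 'i%C = 1); last first.
  by rewrite /normc expr0n expr1n add0r sqrtr1.
by rewrite mul1r le_eqVlt; apply/orP; left; apply/eqP; congr (normc _ ^+ 2); ring.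
Qed.

Let affine_rate (M : nat) (a c s v b : R) : (0 < M)%N -> 0 <= b ->
  `|a - (c * (tau / M%:R) + s * v)| <= Num.sqrt b * (tau / M%:R) ->
  (M%:R / tau * a - c - s * (M%:R / tau * v)) ^+ 2 <= b.
Proof.
move=> M0 b0; have Mt0 : 0 < M%:R / tau by rewrite divr_gt0 ?ltr0n.
have e : M%:R / tau * (tau / M%:R) = 1 by rewrite mulrA divfK ?divff ?pnatr_eq0 -?lt0n ?lt0r_neq0.
move: (M%:R / tau) (tau / M%:R) Mt0 e => al be al0 e.
rewrite -(ler_pM2l al0) -{1}(gtr0_norm al0) -normrM.
have -> : al * (a - (c * be + s * v)) = al * a - c * (al * be) - s * (al * v) by ring.
rewrite [leRHS]mulrCA e !mulr1.
by rewrite -ler_sqr ?nnegrE ?sqrtr_ge0// sqr_sqrtr// real_normK ?num_real.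
Qed.

(** Integrating [velocity_near] over a time step, the mean of the velocity is the
   difference quotient, and the mean of the potential is [step_potential]; what is
   left is the defect. *)
Lemma step_defect_le f g (l : R) (M k : nat) x (b : R) : (0 < M)%N -> (k < M)%N -> 0 <= b ->
  time_derivative tau f g ->
  {ae leb, forall t, (l%:C *: f) t x = - ('i%C * g t x) + schrodinger p (f t) x + (V t x)%:C * f t x} ->
  (forall t v, k%:R * (tau / M%:R) <= t <= k.+1%:R * (tau / M%:R) ->
    v = trajectory f t - midpoint tau (trajectory f) M k ->
    normc (l%:C * v x - hop perp v x - (V t x)%:C * v x) ^+ 2 <= b) ->
  normc (defect tau floquet_step l (trajectory f) M k x) ^+ 2 <= 2 * b.
Proof.
move=> M0 kM b0 fg eqf near_mid; have [_ Lg _] := fg.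
have [_ _ ir ii] := L2_per_integrable x Lg.
have t0 : 0 <= k%:R * (tau / M%:R) by rewrite mulr_ge0 ?divr_ge0 ?(ltW tau0).
have tt : k.+1%:R * (tau / M%:R) <= tau.
  by rewrite mulrCA ger_pMr// ler_pdivrMr ?ltr0n// mul1r ler_nat.
have := velocity_near t0 tt b0 fg eqf near_mid.
have defE : defect tau floquet_step l (trajectory f) M k x =
    (- 'i%C) * ((M%:R / tau)%:C * (sample tau (trajectory f) M k.+1 x - sample tau (trajectory f) M k x))
    - (l%:C * midpoint tau (trajectory f) M k x - hop perp (midpoint tau (trajectory f) M k) x)
    + (step_potential M k x)%:C * midpoint tau (trajectory f) M k x.
  rewrite /defect /floquet_step; move: (midpoint _ _ _ _) => m.
  rewrite /time_difference !(ell2D, ell2N, ell2Z).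
  by rewrite mult_apply; [ring|exact: step_potential_bounded].
have sE j : (j <= M)%N -> sample tau (trajectory f) M j x = f (j%:R * (tau / M%:R)) x.
  by move=> jM; rewrite /sample (trajectoryE fg)// sample_in.
rewrite {}defE !sE// ?(ltnW kM)// (increment x fg t0 (step_le M k) tt) /step_potential.
move: (midpoint _ _ _ _) => m; set z := l%:C * m x - _; set w := m x.
clearbody z w => vel {near_mid sE eqf fg}.
move: t0 tt vel (step_le M k) (step_size M k).
set lo := k%:R * _; set hi := k.+1%:R * _; clearbody lo hi => t0 tt vel lohi size_step.
pose vI := (\int[leb]_(t in `[lo, hi]) V t x)%R.
have ir' := integrable_sub t0 tt ir; have ii' := integrable_sub t0 tt ii.
have FF : Filter (nbhs (almost_everywhere leb)) by exact: ae_filter_ringOfSetsType.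
have hre : `|(\int[leb]_(t in `[lo, hi]) complex.Re (g t x : C))%R
    - (- complex.Im z * (tau / M%:R) + complex.Im w * vI)| <= Num.sqrt b * (tau / M%:R).
  rewrite -size_step.
  apply: (Rintegral_near_affine lohi (sqrtr_ge0 b) ir' (V_integrable lo hi x)).
  apply: filterS vel => t h tI; apply: le_trans (h tI).
  apply: le_trans (ge_normc_Re _); rewrite le_eqVlt; apply/orP; left; apply/eqP; congr `|_|.
  by move: (g t x) => y; case: y z w {h} => [y1 y2] [z1 z2] [w1 w2] /=; ring.
have him : `|(\int[leb]_(t in `[lo, hi]) complex.Im (g t x : C))%R
    - (complex.Re z * (tau / M%:R) + - complex.Re w * vI)| <= Num.sqrt b * (tau / M%:R).
  rewrite -size_step.
  apply: (Rintegral_near_affine lohi (sqrtr_ge0 b) ii' (V_integrable lo hi x)).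
  apply: filterS vel => t h tI; apply: le_trans (h tI).
  apply: le_trans (ge_normc_Im _); rewrite le_eqVlt; apply/orP; left; apply/eqP; congr `|_|.
  by move: (g t x) => y; case: y z w {h hre} => [y1 y2] [z1 z2] [w1 w2] /=; ring.
rewrite /cintegral normc_sqr -/vI.
move: hre him; set Ir := (Rintegral _ _ _); set Ii := (Rintegral _ _ _).
clearbody Ir Ii vI => /(affine_rate M0 b0) hre /(affine_rate M0 b0) him.
rewrite (_ : complex.Re _ = M%:R / tau * Ii - complex.Re z - - complex.Re w * (M%:R / tau * vI)); last first.
  by case: z w {vel hre him} => [z1 z2] [w1 w2] /=; ring.
rewrite (_ : complex.Im _ = - (M%:R / tau * Ir - - complex.Im z - complex.Im w * (M%:R / tau * vI))); last first.
  by case: z w {vel hre him} => [z1 z2] [w1 w2] /=; ring.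
by rewrite sqrrN; lra.
Qed.

Let normcB_sqr (z w : C) : normc (z - w) ^+ 2 <= 2 * normc z ^+ 2 + 2 * normc w ^+ 2.
Proof.
have := normcD_sqr z (- w); rewrite (_ : normc (- w) = normc w)//.
by rewrite -[w in RHS]subr0 normc_distC sub0r.
Qed.

Let normc_real (a : R) (z : C) : normc (a%:C * z) ^+ 2 = a ^+ 2 * normc z ^+ 2.
Proof.
by rewrite ComplexField.Normc.normcM exprMn [normc a%:C ^+ 2]normc_sqr /= expr0n addr0.
Qed.

Let midpoint_close (z0 z1 z2 : C) (e : R) :
  normc (z0 - z1) ^+ 2 <= e -> normc (z0 - z2) ^+ 2 <= e ->
  normc (z0 - (2^-1)%:C * (z1 + z2)) ^+ 2 <= e.
Proof.
move=> h1 h2; have -> : z0 - (2^-1)%:C * (z1 + z2) = (2^-1)%:C * (z0 - z1) + (2^-1)%:C * (z0 - z2).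
  have half : (2^-1)%:C + (2^-1)%:C = 1 :> C.
    have h : 2^-1 + 2^-1 = 1 :> R by field.
    by rewrite -rmorphD h.
  have {1}-> : z0 = ((2^-1)%:C + (2^-1)%:C) * z0 by rewrite half mul1r.
  by ring.
have := normcD_sqr ((2^-1)%:C * (z0 - z1)) ((2^-1)%:C * (z0 - z2)).
rewrite !normc_real; lra.
Qed.

(** At each vertex [|f(t) - f(s)|^2 <= |t - s| E], with [E] the energy of the velocity
   there.  So within a step of length [tau / M] the distance to the midpoint is
   controlled by [E tau / M] at each vertex, and by [hop_local] the defect is so too,
   with a summable factor. *)
Lemma floquet_approx_eigenfunction (l : R) f : floquet_graph tau p V f (l%:C *: f) ->
  approx_eigenfunction dot tau floquet_step l (trajectory f).
Proof.
move=> [_ [g fg eqf]]; have [Lf Lg _] := fg; have [sE _] := L2_per_energy Lg.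
have rE0 : 0 <= rsum (energy tau g) by apply: rsum_ge0 => x; exact: energy_ge0.
have [b [sb hb]] := hop_local perp.
split.
- have [per _ _] := Lf; rewrite /trajectory; congr (insubd 0 _); apply/funext => x.
  by have := per 0 x; rewrite add0r.
- exists (rsum (energy tau g)) => s t sI tI.
  rewrite dot2_self mulrC -(rsumZ _ sE); apply: le_rsum => [||x]; first exact: ell2_summ.
    exact: summZ.
  rewrite ell2D ell2N (trajectoryE fg sI) (trajectoryE fg tI).
  exact: increment_le.
have phiP : (fun x => (Num.sqrt (energy tau g x))%:C : C^o) \in @sqsumm R T.
  apply/sqsummP; move: sE; congr summ; apply/funext => x.
  by rewrite normc_sqr /= expr0n addr0 sqr_sqrtr// energy_ge0.
pose phi : H := Ell2 phiP.
have phiE x : normc (phi x) ^+ 2 = energy tau g x.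
  by rewrite normc_sqr /= expr0n addr0 sqr_sqrtr// energy_ge0.
have [x0 _] := vert_inhabited G.
have B0 : 0 <= B by rewrite (le_trans _ (V_bounded 0 x0)).
pose c := 4 * l ^+ 2 + 2 * B ^+ 2.
pose K x := c * energy tau g x + 4 * b phi x.
have sK : summ K by apply: summD; exact: summZ.
exists (2 * tau * rsum K) => M k M0 kM.
have step0 : 0 <= tau / M%:R by rewrite divr_ge0 ?(ltW tau0).
rewrite (_ : 2 * tau * rsum K / M%:R = 2 * (tau / M%:R) * rsum K); last by ring.
rewrite dot2_self -(rsumZ _ sK); apply: le_rsum => [||x]; first exact: ell2_summ.
  exact: summZ.
have [lo0 hi0] : 0 <= k%:R * (tau / M%:R) <= tau /\ 0 <= k.+1%:R * (tau / M%:R) <= tau.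
  by split; apply: sample_in => //; exact: ltnW.
have near_mid t v y : k%:R * (tau / M%:R) <= t <= k.+1%:R * (tau / M%:R) ->
    v = trajectory f t - midpoint tau (trajectory f) M k ->
    normc (v y) ^+ 2 <= tau / M%:R * normc (phi y) ^+ 2.
  move=> tI ->; rewrite phiE.
  have tau_t : 0 <= t <= tau.
    by move: lo0 hi0 tI => /andP[h1 _] /andP[_ h2] /andP[h3 h4]; rewrite (le_trans h1 h3) (le_trans h4 h2).
  rewrite /midpoint /sample !(ell2D, ell2N, ell2Z) (trajectoryE fg tau_t) (trajectoryE fg lo0) (trajectoryE fg hi0).
  have := increment_le y fg tau_t lo0; have := increment_le y fg tau_t hi0.
  have d1 : `|t - k%:R * (tau / M%:R)| <= tau / M%:R.
    rewrite -(step_size M k) ler_norml; move: tI => /andP[]; lra.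
  have d2 : `|t - k.+1%:R * (tau / M%:R)| <= tau / M%:R.
    rewrite -(step_size M k) ler_norml; move: tI => /andP[]; lra.
  have := ler_wpM2r (energy_ge0 tau g y) d1; have := ler_wpM2r (energy_ge0 tau g y) d2.
  by move=> h1 h2 h3 h4; apply: midpoint_close; [exact: le_trans h4 h2|exact: le_trans h3 h1].
rewrite -mulrA; apply: step_defect_le fg (eqf x) _ => // [|t v tI vE].
  have bphi0 : 0 <= b phi x.
    rewrite -[b phi x]mul1r; apply: le_trans (sqr_ge0 _) (hb phi phi 1 ler01 _ x) => y.
    by rewrite mul1r.
  rewrite mulr_ge0// addr_ge0// mulr_ge0 ?energy_ge0//.
  by rewrite addr_ge0// mulr_ge0// sqr_ge0.
have hv := near_mid t v x tI vE.
have hhop := hb v phi _ step0 (fun y => near_mid t v y tI vE) x.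
have VB : V t x ^+ 2 <= B ^+ 2.
  by rewrite -real_normK ?num_real// ler_sqr ?nnegrE.
have := normcB_sqr (l%:C * v x - hop perp v x) ((V t x)%:C * v x).
have := normcB_sqr (l%:C * v x) (hop perp v x).
rewrite !normc_real /K /c -phiE.
have := ler_wpM2r (sqr_ge0 (normc (v x))) VB.
have := ler_wpM2l (sqr_ge0 l) hv; have := ler_wpM2l (sqr_ge0 B) hv.
lra.
Qed.

End Discretization.

(** * Families of eigenfunctions in the gap *)

Section Families.
Variables (R : realType) (d : nat) (G : periodic_graph R d) (tau : R) (p : vert G -> R).
Variables (V : R -> vert G -> R) (B : R).
Hypothesis tau0 : 0 < tau.
Hypothesis perp : periodic_potential p.
Hypothesis V_meas : forall x, measurable_fun setT (fun t => V t x).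
Hypothesis V_bounded : forall t x, `|V t x| <= B.
Local Notation C := R[i].
Local Notation T := (vert G).
Local Notation H := (ell2 R (vert G)).
Local Notation dot := (@dot2 R (vert G)).
Local Notation X := (R -> vert G -> C^o).
Local Notation approx := (approx_eigenfunction dot tau (floquet_step tau V perp)).
Let D := @dot2_is_dot R (vert G).

Let linV M k : linear (mult (step_potential tau V M k)).
Proof. by apply: mult_linear; exact: step_potential_bounded V_bounded M k. Qed.

Let symV M k : selfadjoint dot (mult (step_potential tau V M k)).
Proof. by apply: mult_selfadjoint; exact: step_potential_bounded V_bounded M k. Qed.

Let linT M k : linear (floquet_step tau V perp M k).
Proof.
by move=> a f g; rewrite /floquet_step hop_linear linV scalerDr addrACA.
Qed.

Let symT M k : selfadjoint dot (floquet_step tau V perp M k).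
Proof.
by move=> f g; rewrite /floquet_step (dotDl D) (dotDr D) hop_selfadjoint symV.
Qed.

Lemma periodic_eq0 (h : R -> C^o) : (forall t, h (t + tau) = h t) ->
  (forall t, 0 <= t <= tau -> h t = 0) -> forall t, h t = 0.
Proof.
move=> per h0 t.
have perN (n : nat) s : h (s + n%:R * tau) = h s.
  elim: n s => [|n IH] s; first by rewrite mul0r addr0.
  by rewrite -natr1 mulrDl mul1r addrA per IH.
have perZ (z : int) s : h (s + z%:~R * tau) = h s.
  case: z => n; first exact: perN.
  by rewrite NegzE rmorphN mulNr -[in LHS](perN n.+1) subrK.
have := floor_itv (t / tau); set z := Num.floor _ => /andP[].
rewrite ler_pdivlMr// ltr_pdivrMr// rmorphD mulrDl mul1r => z1 z2.
rewrite -(perZ (- z) t) h0// rmorphN mulNr; apply/andP; split; lra.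
Qed.

(** A combination that vanishes at time zero vanishes during one period, hence
   always. *)
Lemma initial_independent (l : R) n (f : 'I_n -> X) :
  (forall i, floquet_graph tau p V (f i) (l%:C *: f i)) ->
  (forall c : 'I_n -> C, \sum_i c i *: f i = 0 -> forall i, c i = 0) ->
  forall c : 'I_n -> C, \sum_i c i *: trajectory (f i) 0 = 0 -> forall i, c i = 0.
Proof.
move=> ef indep c c0; apply: indep; apply/funext => t; apply/funext => x.
have ->  : (\sum_i c i *: f i) t x = \sum_i c i * f i t x.
  by rewrite !fct_sumE.
move: t; apply: periodic_eq0 => [t|t tI].
  by apply: eq_bigr => i _; have [_ [g [[per _ _] _ _] _]] := ef i; rewrite per.
have aF i := floquet_approx_eigenfunction tau0 perp V_meas V_bounded (ef i).
have := approx_eigenfunction_initial0 D tau0 linT symT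
  (approx_eigenfunction_sum D (hop_linear perp) linV (index_enum 'I_n) c aF) c0 tI.
move=> /(congr1 (fun h : H => h x)); rewrite ell2_sum ell2_0 => e0; rewrite -[RHS]e0.
apply: eq_bigr => i _; rewrite ell2Z; have [_ [g fg _]] := ef i.
by rewrite (trajectoryE tau0 fg tI).
Qed.

(** The counting bound for the discretized problem, applied to eigenfunctions
   orthonormalized at time zero level by level. *)
Lemma floquet_family_le (Qa Qb : T -> R) (c r eta : R) (K N0 : nat) (e : nat -> H) :
  bounded_potential Qa -> bounded_potential Qb ->
  (forall x, 0 <= Qa x) -> (forall x, 0 <= Qb x) ->
  (forall t x, - Qa x <= V t x) -> (forall t x, V t x <= Qb x) ->
  0 < eta ->
  (forall (n : nat) (x : H),
    ((n < K)%N -> forall i : nat, (i < N0)%N -> cip dot x (e i) = 0) ->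
    (c + r + eta) * dot x x <=
    2 * pi / tau * n%:R * dot x x + dot (hop perp x) x - dot (mult Qa x) x) ->
  (forall (n : nat) (x : H),
    ((n < K)%N -> forall i : nat, (i < N0)%N -> cip dot x (e i) = 0) ->
    (- c + r + eta) * dot x x <=
    2 * pi / tau * n.+1%:R * dot x x - dot (hop perp x) x - dot (mult Qb x) x) ->
  forall k (s : 'I_k -> R) (n : 'I_k -> nat) (f : forall j, 'I_(n j) -> X),
    injective s -> (forall j, `|s j - c| <= r) ->
    (forall j i, floquet_graph tau p V (f j i) ((s j)%:C *: f j i)) ->
    (forall j (a : 'I_(n j) -> C), \sum_i a i *: f j i = 0 -> forall i, a i = 0) ->
    (\sum_j n j <= (K * N0).*2)%N.
Proof.
move=> bQa bQb Qa0 Qb0 VQa VQb eta0 near far k s n f sinj sI ef indep.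
have onF j : exists F : nat -> R -> H, (forall i, (i < n j)%N -> approx (s j) (F i)) /\
    (forall i i', (i < n j)%N -> (i' < n j)%N -> cip dot (F i 0) (F i' 0) = (i == i')%:R).
  apply: (orthonormal_initial D (hop_linear perp) linV (F := fun i => trajectory (f j i))).
    by move=> i; exact: (floquet_approx_eigenfunction tau0 perp V_meas V_bounded (ef j i)).
  exact: (initial_independent (ef j) (indep j)).
have /choice[F hF] := onF.
pose I : finType := {j : 'I_k & 'I_(n j)}.
have cardI : #|I| = (\sum_j n j)%N.
  rewrite card_tagged sumnE big_map big_enum /=.
  by apply: eq_bigr => j _; rewrite card_ord.
rewrite -cardI.
apply: (index_bound D tau0 (hop_linear perp) (hop_selfadjoint perp) linV symV
  (mult_linear bQa) (mult_linear bQb) _ _ eta0 near far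
  (l := fun i : I => s (tag i)) (f := fun i : I => F (tag i) (tagged i))).
- move=> M j x; have bV := step_potential_bounded tau0 V_meas V_bounded M j.
  rewrite !mult_form// -rsumN; last exact: mult_summ.
  apply: le_rsum => [||y]; [by apply: summN; exact: mult_summ|exact: mult_summ|].
  rewrite -mulNr ler_wpM2r ?sqr_ge0//; exact: (step_potential_ge tau0 V_meas V_bounded).
- move=> M j x; apply: le_mult_form => // [|y]; first exact: (step_potential_bounded tau0 V_meas V_bounded).
  by apply: (step_potential_le tau0 V_meas V_bounded).
- by move=> i.
- by move=> i; apply: (hF (tag i)).1.
- move=> [j i] [j' i'] /= /sinj jj; subst j'.
  by rewrite (hF j).2// eq_Tagged.
Qed.

End Families.

(** * Quadratic forms in the gap *)

Section GapForms.
Variables (R : realType) (T : choiceType).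
Local Notation H := (ell2 R T).
Local Notation dot := (@dot2 R T).
Let D := @dot2_is_dot R T.
Variables (om sp sg : R) (A : H -> H) (q u : T -> R).
Hypothesis sp0 : 0 <= sp.
Hypothesis om0 : 0 < om.
Hypothesis sgE : sg = om - sp.
Hypothesis sg0 : 0 < sg.
Hypothesis A0 : forall x, 0 <= dot (A x) x.
Hypothesis As : forall x, dot (A x) x <= sp * dot x x.
Hypothesis bq : bounded_potential q.
Hypothesis bu : bounded_potential u.
Hypothesis q_ge : forall x, 16 * om / sg ^+ 2 * u x ^+ 2 <= q x.

(** Frequencies [n >= K] dominate the potential; the others are covered by the
   orthogonality conditions. *)
Lemma near_form (Q eps : R) (K N : nat) (e : nat -> H) : 0 <= eps ->
  (forall x, q x <= Q) -> Q <= om * K%:R ->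
  (forall x, (forall i, (i < N)%N -> cip dot x (e i) = 0) ->
    - (2 * eps) * dot x x <= dot (A x) x - dot (mult q x) x) ->
  forall n x, ((n < K)%N -> forall i, (i < N)%N -> cip dot x (e i) = 0) ->
    - (2 * eps) * dot x x <= om * n%:R * dot x x + dot (A x) x - dot (mult q x) x.
Proof.
move=> eps0 qQ QK orth n x xe; have x0 := dot_ge0 D x.
have epsx : 0 <= 2 * eps * dot x x by rewrite !mulr_ge0.
have [nK|Kn] := ltnP n K.
  have := orth x (xe nK); have : 0 <= om * n%:R * dot x x by rewrite !mulr_ge0// ltW.
  lra.
have : dot (mult q x) x <= om * n%:R * dot x x.
  apply: (@le_trans _ _ (Q * dot x x)).
    rewrite -(mult_cst Q x); apply: le_mult_form => //.
    by exists `|Q|.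
  rewrite ler_wpM2r//; apply: le_trans QK _.
  by rewrite ler_wpM2l ?(ltW om0)// ler_nat.
by have := A0 x; lra.
Qed.

(** By [u <= sg / 8 + 2 u^2 / sg]: a fraction [sg / (4 om)] of [16 om u^2 / sg^2] is
   [4 u^2 / sg], which suffices.  The constant in [q] is chosen for this. *)
Lemma mult_absorbed x : dot (mult u x) x <= sg / 8 * dot x x + sg / (4 * om) * dot (mult q x) x.
Proof.
have su := mult_summ x bu; have sq := mult_summ x bq; have sx := ell2_summ x.
rewrite !mult_form// dot2_self -(rsumZ _ sx) -(rsumZ _ sq) -rsumD; last 2 first.
- exact: summZ.
- exact: summZ.
apply: le_rsum => // [|y]; first by apply: summD; exact: summZ.
rewrite mulrA -mulrDl ler_wpM2r ?sqr_ge0//.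
have al0 : 0 <= sg / (4 * om) by rewrite divr_ge0 ?mulr_ge0 ?ltW.
have h := ler_wpM2l al0 (q_ge y); apply: le_trans (lerD (lexx _) h).
have -> : sg / (4 * om) * (16 * om / sg ^+ 2 * u y ^+ 2) = 4 * u y ^+ 2 / sg.
  by field; rewrite !lt0r_neq0.
rewrite -subr_ge0.
have -> : sg / 8 + 4 * u y ^+ 2 / sg - u y = ((sg - 4 * u y) ^+ 2 + 16 * u y ^+ 2) / (8 * sg).
  by field; rewrite lt0r_neq0.
apply: divr_ge0; last by rewrite mulr_ge0// ltW.
by rewrite addr_ge0 ?sqr_ge0// mulr_ge0// sqr_ge0.
Qed.

(** As [om = sp + sg], the forms of [A] and [u] stay [9 / 16 sg] below [om (n + 1)],
   more than the half-gap requires: the fraction [sg / (4 om)] of [A] costs at most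
   [sg / 4]. *)
Lemma far_form (eps : R) n x : 0 <= eps -> eps <= sg / 8 ->
  - (2 * eps) * dot x x <= om * n%:R * dot x x + dot (A x) x - dot (mult q x) x ->
  dot (A x) x + dot (mult u x) x <= om * n%:R * dot x x + (sp + 7 / 16 * sg) * dot x x.
Proof.
move=> eps0 eps1; have := mult_absorbed x; have := As x; have := A0 x; have := dot_ge0 D x.
have al1 : sg / (4 * om) <= 1 / 4.
  by rewrite ler_pdivrMr ?mulr_gt0// mulrA divfK ?mul1r ?sgE ?gerBl.
have al0 : 0 <= sg / (4 * om) by rewrite divr_ge0 ?mulr_ge0 ?ltW.
have alsp : sg / (4 * om) * sp <= sg / 4.
  have -> : sg / (4 * om) * sp = sg / 4 * (sp / om) by field; rewrite lt0r_neq0.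
  rewrite ler_piMr ?divr_ge0 ?(ltW sg0)// ler_pdivrMr// mul1r -subr_ge0 -sgE.
  exact: ltW.
move: (sg / (4 * om)) al0 al1 alsp => al al0 al1 alsp.
have n0 : 0 <= om * n%:R by rewrite mulr_ge0 ?(ltW om0).
move: (om * n%:R) n0 (dot x x) (dot (A x) x) (dot (mult u x) x) (dot (mult q x) x).
move=> b b0 X a v w X0 a0 aX vw near.
have h1 : al * w <= al * (b * X + a + 2 * eps * X) by rewrite ler_wpM2l//; lra.
have h2 : al * (b * X) <= b * X by rewrite ler_piMl ?mulr_ge0//; lra.
have h3 : al * a <= sg / 4 * X.
  apply: le_trans (ler_wpM2l al0 aX) _; rewrite mulrA ler_wpM2r//.
have h4 : al * (2 * eps * X) <= sg / 16 * X.
  rewrite !mulrA ler_wpM2r//; apply: (@le_trans _ _ (1 / 4 * 2 * eps)); last lra.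
  by rewrite ler_wpM2r// ler_wpM2r.
lra.
Qed.

End GapForms.

(** * Margins *)

(** The levels lie in an interval whose closed end is the middle of the gap and
   whose open end is approached up to [a0]; [a1] is the remaining coercivity, [X] the
   square norm of the vector, [b] the frequency part, [a], [y], [w] the quadratic
   forms of the operator, of a bound on the potential and of [q]. *)

Section Margins.
Variables (R : realType) (sp sg a0 a1 X b a y w : R).
Hypothesis X0 : 0 <= X.

Lemma near_zero_margin : a1 <= a0 / 2 -> y <= w ->
  - (2 * (a0 / 4)) * X <= b * X + a - w ->
  (- (sg / 4 + a0 / 2) + (sg / 4 - a0 / 2) + a1) * X <= b * X + a - y.
Proof. by move=> h; have := ler_wpM2r X0 h; lra. Qed.

Lemma far_zero_margin : a1 <= sg / 16 ->
  a + y <= b * X + (sp + 7 / 16 * sg) * X ->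
  (- (- (sg / 4 + a0 / 2)) + (sg / 4 - a0 / 2) + a1) * X <= (b + (sg + sp)) * X - a - y.
Proof. by move=> h; have := ler_wpM2r X0 h; lra. Qed.

Lemma near_top_margin : a1 <= a0 / 2 -> y <= w ->
  - (2 * (a0 / 4)) * X <= b * X + (sp * X - a) - w ->
  (- (- (3 / 4 * sg - a0 / 2)) + (sg / 4 - a0 / 2) + a1) * X <= (b + (sg + sp)) * X - a - y.
Proof. by move=> h; have := ler_wpM2r X0 h; lra. Qed.

Lemma far_top_margin : a1 <= sg / 16 ->
  (sp * X - a) + y <= b * X + (sp + 7 / 16 * sg) * X ->
  (- (3 / 4 * sg - a0 / 2) + (sg / 4 - a0 / 2) + a1) * X <= b * X + a - y.
Proof. by move=> h; have := ler_wpM2r X0 h; lra. Qed.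

Lemma near_zero_level s : - (sg / 2) <= s -> s <= 0 - a0 ->
  `|s - - (sg / 4 + a0 / 2)| <= sg / 4 - a0 / 2.
Proof. by move=> h1 h2; rewrite ler_norml; apply/andP; split; lra. Qed.

Lemma near_top_level s : s <= - (sg / 2) -> - s <= sg - a0 ->
  `|s - - (3 / 4 * sg - a0 / 2)| <= sg / 4 - a0 / 2.
Proof. by move=> h1 h2; rewrite ler_norml; apply/andP; split; lra. Qed.

Lemma eighth_margin : a0 <= sg / 2 -> a0 / 4 <= sg / 8.
Proof. by lra. Qed.

End Margins.

(** * Counting eigenvalues in the gap *)

Section GapCount.
Variables (R : realType) (d : nat) (G : periodic_graph R d) (tau : R) (p : vert G -> R) (sp : R).
Variables (V : R -> vert G -> R) (u : vert G -> R).
Hypothesis d0 : (0 < d)%N.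
Hypothesis tau0 : 0 < tau.
Hypothesis perp : periodic_potential p.
Hypothesis spec_p : spectrum (schrodinger p) `<=` [set r%:C | r in `[0, sp]].
Hypothesis sp0 : 0 <= sp.
Hypothesis V_meas : forall x, measurable_fun setT (fun t => V t x).
Hypothesis V_u : forall t x, `|V t x| <= u x.
Local Notation C := R[i].
Local Notation T := (vert G).
Local Notation H := (ell2 R (vert G)).
Local Notation dot := (@dot2 R (vert G)).
Local Notation r := (d%:R / 2 : R).
Local Notation om := (2 * pi / tau).
Let D := @dot2_is_dot R (vert G).
Let sg := om - sp.
Hypothesis sg0 : 0 < sg.
Hypothesis u2_lp : lp_space r (fun x => u x ^+ 2).

Let r0 : 0 < r. Proof. by rewrite divr_gt0// ltr0n. Qed.
Let om0 : 0 < om. Proof. by rewrite divr_gt0// mulr_gt0 ?pi_gt0. Qed.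

Lemma u_ge0 x : 0 <= u x.
Proof. exact: le_trans (normr_ge0 _) (V_u 0 x). Qed.

Lemma u_bounded : bounded_potential u.
Proof.
have [B hB] := lp_bounded r0 u2_lp; exists (1 + B) => x.
have := hB x; rewrite normrX; have := sqr_ge0 (`|u x| - 1); have := sqr_ge0 `|u x|; lra.
Qed.

Definition gap_bound (K : R) (q : T -> R) : \bar R :=
  ((9 * om / sg * K)%:E * (1 + (2 / om)%:E * linf_norm q) * poweR (lp_norm r q) r)%E.

Lemma linf_norm_fin (q : T -> R) : bounded_potential q ->
  exists Q : R, [/\ linf_norm q = Q%:E, 0 <= Q & forall x, q x <= Q].
Proof.
move=> [B hB]; have [x0 _] := vert_inhabited G.
have up x : (`|q x|%:E <= linf_norm q)%E by apply: ereal_sup_ubound; exists x.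
have ub : (linf_norm q <= B%:E)%E by apply: ge_ereal_sup => _ [x _ <-]; rewrite lee_fin.
have fin : linf_norm q \is a fin_num.
  rewrite fin_numElt (lt_le_trans (ltNyr `|q x0|) (up x0)).
  exact: le_lt_trans ub (ltry B).
exists (fine (linf_norm q)); rewrite fineK//; split=> //.
  by rewrite -lee_fin fineK// (le_trans _ (up x0))// lee_fin.
by move=> x; rewrite -lee_fin fineK// (le_trans _ (up x))// lee_fin ler_norm.
Qed.

(** [2 (1 + Q / om) <= (9 om / sg) (1 + 2 Q / om)], since [sg <= om]. *)
Lemma le_gap_bound K (q : T -> R) (Q : R) (n N : nat) : 0 <= K -> lp_space r q ->
  linf_norm q = Q%:E -> 0 <= Q ->
  N%:R <= K * rsum (fun x => `|q x| `^ r) ->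
  (n <= ((Num.trunc (Q / om)).+1 * N).*2)%N ->
  (n%:R%:E <= gap_bound K q)%E.
Proof.
move=> K0 /(lp_spaceP r0) sq QE Q0 NK nN.
rewrite /gap_bound QE lp_norm_pow// -rsum_nnegE//.
have -> : (1 + (2 / om)%:E * Q%:E = (1 + 2 / om * Q)%:E)%E by [].
rewrite -!EFinM lee_fin.
move: (rsum _) (rsum_ge0 (fun x => powR_ge0 `|q x| r)) NK => S S0 NK.
have Qo0 : 0 <= Q / om by rewrite divr_ge0 ?(ltW om0).
have /andP[tr _] := truncn_itv Qo0.
have KS0 : 0 <= K * S by rewrite mulr_ge0.
apply: (@le_trans _ _ (2 * ((1 + Q / om) * (K * S)))).
  apply: (@le_trans _ _ (((Num.trunc (Q / om)).+1 * N).*2%:R)); first by rewrite ler_nat.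
  rewrite -muln2 natrM mulrC ler_wpM2l// natrM; apply: ler_pM => //.
  by rewrite -natr1 addrC lerD2l.
have om_sg : 1 <= om / sg by rewrite ler_pdivlMr// mul1r /sg gerBl.
have -> : 9 * om / sg * K * (1 + 2 / om * Q) * S = 9 * (om / sg) * ((1 + 2 * (Q / om)) * (K * S)).
  by ring.
move: (Q / om) (K * S) (om / sg) Qo0 KS0 om_sg => a b c a0 b0 c1.
apply: (@le_trans _ _ (9 * ((1 + 2 * a) * b))); first by have := mulr_ge0 a0 b0; lra.
rewrite ler_wpM2r ?mulr_ge0 ?addr_ge0 ?mulr_ge0//; lra.
Qed.

Lemma gap_bound_lty K (q : T -> R) : lp_space r q -> (gap_bound K q < +oo)%E.
Proof.
move=> lq; have [Q [QE _ _]] := linf_norm_fin (lp_bounded r0 lq).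
rewrite /gap_bound QE lp_norm_pow// -rsum_nnegE//; last exact/(lp_spaceP r0).
have -> : (1 + (2 / om)%:E * Q%:E = (1 + 2 / om * Q)%:E)%E by [].
by rewrite -!EFinM ltry.
Qed.

Lemma finite_gap k (s : 'I_k -> R) (b delta : R) : 0 < delta -> (forall j, s j < b) ->
  exists2 eta, 0 < eta <= delta & forall j, s j <= b - eta.
Proof.
move=> delta0 sb; exists (\big[Num.min/delta]_j (b - s j)).
  rewrite bigmin_le_id andbT; elim/big_ind: _ => // [x y x0 y0|j _].
    by rewrite lt_min x0 y0.
  by rewrite subr_gt0.
by move=> j; rewrite lerBrDr addrC -lerBrDr; exact: bigmin_le.
Qed.

Section Directions.
Variables (K : R) (q : T -> R) (eps : R).
Hypothesis q0 : forall x, 0 <= q x.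
Hypothesis lq : lp_space r q.
Hypothesis eps0 : 0 < eps.

Let S := rsum (fun x => `|q x| `^ r).

Let negative_directions_of (A : H -> H) : linear A -> selfadjoint dot A -> form_bounded dot A ->
  (forall m, m < 0 -> bounded_below dot A m /\ forall y, exists x, A x - m%:C *: x = y) ->
  0 <= K ->
  (forall n e l, eigenfamily dot (fun f => A f - mult (truncation q eps) f) (- eps) n e l ->
    (n%:R%:E <= K%:E * nnsum (fun x => (`|q x| `^ r)%R))%E) ->
  exists n (e : nat -> H), n%:R <= K * S /\ forall f,
    (forall i, (i < n)%N -> cip dot f (e i) = 0) ->
    - (2 * eps) * dot f f <= dot (A f) f - dot (mult q f) f.
Proof.
move=> linA symA bdA resA K0 ks.
have S0 : 0 <= S by apply: rsum_ge0 => x; exact: powR_ge0.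
have KS0 : 0 <= K * S by rewrite mulr_ge0.
have [n e l /ks|n [e [nN he]]] := @negative_directions _ _ A q eps (Num.trunc (K * S))
  linA symA bdA resA (lp_bounded r0 lq) eps0 (lp_level_finite r0 eps0 lq).
  rewrite -rsum_nnegE//; last exact/(lp_spaceP r0).
  by rewrite -EFinM lee_fin truncn_ge_nat.
by exists n, e; split=> //; rewrite -truncn_ge_nat.
Qed.

Lemma hop_directions : ks_minus p K -> exists n (e : nat -> H), n%:R <= K * S /\ forall f,
    (forall i, (i < n)%N -> cip dot f (e i) = 0) ->
    - (2 * eps) * dot f f <= dot (hop perp f) f - dot (mult q f) f.
Proof.
move=> ks; apply: negative_directions_of.
- exact: hop_linear.
- exact: hop_selfadjoint.
- exact: hop_form_bounded.
- by move=> m m0; apply: (hop_resolvent perp spec_p); rewrite leNgt m0.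
- exact: ks_minus_ge0 d0 _ ks.
- by move=> n e l; exact: ks_minus_family.
Qed.

Lemma cohop_directions : ks_plus p sp K -> exists n (e : nat -> H), n%:R <= K * S /\ forall f,
    (forall i, (i < n)%N -> cip dot f (e i) = 0) ->
    - (2 * eps) * dot f f <= dot (cohop sp perp f) f - dot (mult q f) f.
Proof.
move=> ks; apply: negative_directions_of.
- exact: cohop_linear.
- exact: cohop_selfadjoint.
- exact: cohop_form_bounded.
- exact: (cohop_resolvent perp spec_p).
- exact: ks_plus_ge0 d0 _ ks.
- by move=> n e l; exact: ks_plus_family.
Qed.

End Directions.

Lemma trunc_step (Q : R) : 0 <= Q -> Q <= om * (Num.trunc (Q / om)).+1%:R.
Proof.
move=> Q0; have Qo0 : 0 <= Q / om by rewrite divr_ge0 ?(ltW om0).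
have /andP[_ /ltW] := truncn_itv Qo0.
by rewrite ler_pdivrMr// mulrC.
Qed.

Let om_next (m : nat) : om * m.+1%:R = om * m%:R + (sg + sp).
Proof. by rewrite -[m.+1%:R]natr1 mulrDr mulr1 /sg subrK. Qed.

Section NearZero.
Variables (K : R) (v : T -> R).
Hypothesis v_ge : forall t x, neg_part (V t x) <= v x.
Hypothesis v_lp : lp_space r v.
Hypothesis ks : ks_minus p K.

Let q x := 16 * om / sg ^+ 2 * u x ^+ 2 + v x.

(** For a level [l] near zero the critical form is that of the frequencies [n >= 0],
   [om n + h - l], for which the sharp bound [- v <= V] is used. *)
Lemma gap_count_minus :
  (floquet_count tau p V [set` `[(- (sg / 2))%R, 0%R[ ] <= gap_bound K q)%E.
Proof.
have v0 x : 0 <= v x by exact: le_trans (neg_part_ge (V 0 x)).1 (v_ge 0 x).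
have cu0 x : 0 <= 16 * om / sg ^+ 2 * u x ^+ 2.
  by rewrite mulr_ge0 ?sqr_ge0// divr_ge0 ?sqr_ge0// mulr_ge0 ?(ltW om0).
have q0 x : 0 <= q x by rewrite addr_ge0.
have lq : lp_space r q by apply: (lpD r0) => //; exact: lpZ.
have bq := lp_bounded r0 lq; have bv := lp_bounded r0 v_lp; have bu := u_bounded; have [B uB] := bu.
have [Q [QE Q0 qQ]] := linf_norm_fin bq.
apply: eigen_count_le => k s n f sinj sA ef indep.
have [||eta0 /andP[eta0_gt0 eta0_le] s_le] := @finite_gap k s 0 (sg / 2).
- by rewrite divr_gt0.
- by move=> j; have := sA j; rewrite /= in_itv => /andP[].
have eps0 : 0 < eta0 / 4 by rewrite divr_gt0.
have [N [e [NK he]]] := hop_directions q0 lq eps0 ks.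
apply: (le_gap_bound _ lq QE Q0 NK); first exact: ks_minus_ge0 d0 _ ks.
pose eta := Num.min (eta0 / 2) (sg / 16).
have eta_gt0 : 0 < eta by rewrite lt_min !divr_gt0.
have [eta1 eta2] : eta <= eta0 / 2 /\ eta <= sg / 16 by split; rewrite ge_min lexx ?orbT.
have near_q := near_form om0 (hop_ge0 perp spec_p) bq (ltW eps0) qQ (trunc_step Q0) he.
have VB t x : `|V t x| <= B by apply: le_trans (V_u t x) _; exact: le_trans (ler_norm _) (uB x).
have lower t x : - v x <= V t x by apply: le_trans (neg_part_ge (V t x)).2; rewrite lerN2.
have upper t x : V t x <= u x by apply: le_trans (V_u t x); exact: ler_norm.
have ef' j i : floquet_graph tau p V (f j i) ((s j)%:C *: f j i) := ef j i.
apply: (floquet_family_le (c := - (sg / 4 + eta0 / 2)) (r := sg / 4 - eta0 / 2) (e := e)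
  tau0 V_meas VB bv bu v0 u_ge0 lower upper eta_gt0 _ _ sinj _ ef' indep).
- move=> m x /near_q h; apply: (near_zero_margin _ (dot_ge0 D x) eta1 _ h).
  by apply: le_mult_form => // y; rewrite lerDr.
- move=> m x /near_q h; rewrite om_next; apply: (far_zero_margin _ (dot_ge0 D x) eta2).
  apply: (far_form sp0 om0 erefl sg0 (hop_ge0 perp spec_p) (hop_le perp spec_p) bq bu _ (ltW eps0) _ h).
    by move=> y; rewrite lerDl.
  exact: eighth_margin.
- move=> j; have := sA j; rewrite /= in_itv /= => /andP[s1 _].
  exact: near_zero_level s1 (s_le j).
Qed.

End NearZero.

Section NearTop.
Variables (K : R) (v : T -> R).
Hypothesis v_ge : forall t x, pos_part (V t x) <= v x.
Hypothesis v_lp : lp_space r v.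
Hypothesis ks : ks_plus p sp K.

Let q x := 16 * om / sg ^+ 2 * u x ^+ 2 + v x.

(** For a level [l] near [- sg] the critical form is that of the negative frequencies,
   [om (n + 1) - h + l = om n + (s - h) + (sg + l)], for which the sharp bound [V <= v]
   is used. *)
Lemma gap_count_plus :
  (floquet_count tau p V [set` `](- sg)%R, (- (sg / 2))%R] ] <= gap_bound K q)%E.
Proof.
have v0 x : 0 <= v x by exact: le_trans (pos_part_ge (V 0 x)).1 (v_ge 0 x).
have cu0 x : 0 <= 16 * om / sg ^+ 2 * u x ^+ 2.
  by rewrite mulr_ge0 ?sqr_ge0// divr_ge0 ?sqr_ge0// mulr_ge0 ?(ltW om0).
have q0 x : 0 <= q x by rewrite addr_ge0.
have lq : lp_space r q by apply: (lpD r0) => //; exact: lpZ.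
have bq := lp_bounded r0 lq; have bv := lp_bounded r0 v_lp; have bu := u_bounded; have [B uB] := bu.
have [Q [QE Q0 qQ]] := linf_norm_fin bq.
apply: eigen_count_le => k s n f sinj sA ef indep.
have [||eta0 /andP[eta0_gt0 eta0_le] s_le] := @finite_gap k (fun j => - s j) sg (sg / 2).
- by rewrite divr_gt0.
- by move=> j; have := sA j; rewrite /= in_itv => /andP[]; rewrite ltrNl.
have eps0 : 0 < eta0 / 4 by rewrite divr_gt0.
have [N [e [NK he]]] := cohop_directions q0 lq eps0 ks.
apply: (le_gap_bound _ lq QE Q0 NK); first exact: ks_plus_ge0 d0 _ ks.
pose eta := Num.min (eta0 / 2) (sg / 16).
have eta_gt0 : 0 < eta by rewrite lt_min !divr_gt0.
have [eta1 eta2] : eta <= eta0 / 2 /\ eta <= sg / 16 by split; rewrite ge_min lexx ?orbT.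
have co0 x : 0 <= dot (cohop sp perp x) x.
  by rewrite cohop_dot subr_ge0; exact: (hop_le perp spec_p).
have cos x : dot (cohop sp perp x) x <= sp * dot x x.
  by rewrite cohop_dot gerBl; exact: (hop_ge0 perp spec_p).
have near_q := near_form om0 co0 bq (ltW eps0) qQ (trunc_step Q0) he.
have VB t x : `|V t x| <= B by apply: le_trans (V_u t x) _; exact: le_trans (ler_norm _) (uB x).
have lower t x : - u x <= V t x by have := V_u t x; rewrite ler_norml => /andP[].
have upper t x : V t x <= v x by exact: le_trans (pos_part_ge (V t x)).2 (v_ge t x).
have ef' j i : floquet_graph tau p V (f j i) ((s j)%:C *: f j i) := ef j i.
apply: (floquet_family_le (c := - (3 / 4 * sg - eta0 / 2)) (r := sg / 4 - eta0 / 2) (e := e)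
  tau0 V_meas VB bu bv u_ge0 v0 lower upper eta_gt0 _ _ sinj _ ef' indep).
- move=> m x /near_q h; apply: (far_top_margin (sp := sp) _ (dot_ge0 D x) eta2); rewrite -cohop_dot.
  apply: (far_form sp0 om0 erefl sg0 co0 cos bq bu _ (ltW eps0) _ h).
    by move=> y; rewrite lerDl.
  exact: eighth_margin.
- move=> m x /near_q; rewrite cohop_dot => h.
  rewrite om_next; apply: (near_top_margin _ (dot_ge0 D x) eta1 _ h).
  by apply: le_mult_form => // y; rewrite lerDr.
- move=> j; have := sA j; rewrite /= in_itv /= => /andP[_ s1].
  exact: near_top_level s1 (s_le j).
Qed.

End NearTop.

End GapCount.

Theorem theorem1p3 (R : realType) (d : nat) (G : periodic_graph R d)
  (p : vert G -> R) (sp tau Cminus Cplus : R)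
  (V : R -> vert G -> R) (u vminus vplus : vert G -> R)
  (hd : (3 <= d)%N)
  (hp : periodic_potential p)
  (hsp : spectrum (schrodinger p) sp%:C)
  (hspec : spectrum (schrodinger p) `<=` [set r%:C | r in `[0, sp]])
  (htau : 0 < tau)
  (hV_per : forall t x, V (t + tau) x = V t x)
  (hV_meas : forall x, measurable_fun setT (fun t => V t x)) :
  let omega := 2 * pi / tau in
  let sg := omega - sp in
  let c := 16 * omega / sg ^+ 2 in
  let r := d%:R / 2 in
  let qminus := fun x => c * u x ^+ 2 + vminus x in
  let qplus := fun x => c * u x ^+ 2 + vplus x in
  let hyp_minus :=
    [/\ forall t x, `|V t x| <= u x,
        forall t x, neg_part (V t x) <= vminus x,
        lp_space r (fun x => u x ^+ 2), lp_space r vminus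
      & ks_minus p Cminus] in
  let hyp_plus :=
    [/\ forall t x, `|V t x| <= u x,
        forall t x, pos_part (V t x) <= vplus x,
        lp_space r (fun x => u x ^+ 2), lp_space r vplus
      & (regular_top p sp \/ bipartite G) /\ ks_plus p sp Cplus] in
  let n := floquet_count tau p V in
  let Kminus := ((9 * omega / sg * Cminus)%:E
                   * (1 + (2 / omega)%:E * linf_norm qminus))%E in
  let Kplus := ((9 * omega / sg * Cplus)%:E
                   * (1 + (2 / omega)%:E * linf_norm qplus))%E in
  sp < omega ->
  [/\ hyp_minus ->
        (n [set` `[(- (sg / 2))%R, 0%R[ ] <= Kminus * poweR (lp_norm r qminus) r)%E,
      hyp_plus ->
        (n [set` `](- sg)%R, (- (sg / 2))%R] ] <= Kplus * poweR (lp_norm r qplus) r)%E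
    & hyp_minus -> hyp_plus ->
        (n [set` `](- sg)%R, 0%R[ ] < +oo)%E /\
        (n [set` `](- sg)%R, 0%R[ ] <= Kplus * poweR (lp_norm r qplus) r
                               + Kminus * poweR (lp_norm r qminus) r)%E].
Proof.
move=> omega sg c r qminus qplus hyp_minus hyp_plus n Kminus Kplus sp_omega.
have d0 : (0 < d)%N by apply: leq_trans hd.
have sp0 : 0 <= sp.
  by have [x /= xI [<-]] := hspec _ hsp; move: xI; rewrite in_itv => /andP[].
have sg0 : 0 < sg by rewrite /sg subr_gt0.
have r0 : 0 < r by rewrite divr_gt0// ltr0n.
have minus : hyp_minus -> (n [set` `[(- (sg / 2))%R, 0%R[ ] <= Kminus * poweR (lp_norm r qminus) r)%E.
  move=> [Vu Vv lu lv ks].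
  exact: (gap_count_minus d0 htau hp hspec sp0 hV_meas Vu sg0 lu Vv lv ks).
have plus : hyp_plus -> (n [set` `](- sg)%R, (- (sg / 2))%R] ] <= Kplus * poweR (lp_norm r qplus) r)%E.
  move=> [Vu Vv lu lv [_ ks]].
  exact: (gap_count_plus d0 htau hp hspec sp0 hV_meas Vu sg0 lu Vv lv ks).
split=> // hm hpl; have hm' := minus hm; have hp' := plus hpl.
have split_le : (n [set` `](- sg)%R, 0%R[ ] <= Kplus * poweR (lp_norm r qplus) r
                               + Kminus * poweR (lp_norm r qminus) r)%E.
  by apply: le_trans (eigen_count_split _ _ (- (sg / 2)) _) (leeD hp' hm').
split=> //; apply: le_lt_trans split_le _; apply: lte_add_pinfty.
  have [_ _ lu lv _] := hpl; apply: (gap_bound_lty tau sp d0).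
  by apply: (lpD r0) => //; exact: lpZ.
have [_ _ lu lv _] := hm; apply: (gap_bound_lty tau sp d0).
by apply: (lpD r0) => //; exact: lpZ.
Qed.
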